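(* Let $1\le p,q\le\infty$ and $s<-1$. Then there does not exist any $T>0$ such that the Cauchy problem for the Korteweg-de Vries--Burgers equation on the real line $$u_t+u_{xxx}-u_{xx}+u\,u_x=0,\qquad u(0,x)=u_0(x),\qquad x\in\mathbb R,\ u=u(t,x)\in\mathbb R,$$ admits a unique local solution $u$ defined on the interval $[0,T]$ and such that the flow-map $u_0\mapsto u(t)$, $t\in[0,T]$, is $C^2$-differentiable at zero from $\widehat{w}^{p,q}_s(\mathbb R)$ to $C([0,T];\widehat{w}^{p,q}_s(\mathbb R))$.
   Context: For $1\le p,q\le\infty$ and $s\in\mathbb R$, the Fourier amalgam space $\widehat{w}^{p,q}_s(\mathbb R)$ is $$\widehat{w}^{p,q}_s(\mathbb R)=\Big\{f\in\mathcal S'(\mathbb R):\ \|f\|_{\widehat{w}^{p,q}_s}=\Big\|\,\|\chi_{n+Q}(\xi)\,\mathcal Ff(\xi)\|_{L^p_\xi(\mathbb R)}\,\langle n\rangle^s\Big\|_{\ell^q_n(\mathbb Z)}<\infty\Big\},$$ where $Q=(-1/2,1/2]$, $\chi_A$ is the indicator function of the set $A$, $\langle n\rangle=(1+n^2)^{1/2}$, and $\mathcal F$ is the Fourier transform in $x$ (with the convention under which $\mathcal F(\partial_x f)(\xi)=i\xi\,\mathcal Ff(\xi)$). The integral (Duhamel) version of the Cauchy problem is $$u(t)=S(t)u_0-\frac12\int_0^tS(t-\tau)\,\partial_x[u(\tau)]^2\,d\tau,$$ where $\{S(t)\}_{t\ge0}$ is the semigroup of the linear part of the equation, given by $\mathcal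 F(S(t)u_0)(\xi)=e^{-t\xi^2+it\xi^3}\,\mathcal Fu_0(\xi)$ for $t\ge0$. The flow-map is the map sending the initial datum $u_0$ to the corresponding solution $u$ on $[0,T]$. *)

(* Defs.v *)
From HB Require Import structures.
From mathcomp Require Import all_boot all_order all_algebra.
From mathcomp Require Import complex.
From mathcomp Require Import all_classical all_reals all_analysis.

Set Implicit Arguments.
Unset Strict Implicit.
Unset Printing Implicit Defensive.
Import Order.TTheory GRing.Theory Num.Theory.
Import numFieldNormedType.Exports.

Local Open Scope classical_set_scope.
Local Open Scope ring_scope.
Local Open Scope complex_scope.

(* Discrete sigma-algebra on Z: the norm of l^q(Z) is then the library's L^q
   norm for the counting measure. *)
HB.instance Definition _ := isPointed.Build int 0.
HB.instance Definition _ := @isMeasurable.Build default_measure_display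
  int discrete_measurable discrete_measurable0
  discrete_measurableC discrete_measurableU.

Section ComplexValued.
Variable R : realType.
Let mu := @lebesgue_measure R.

Definition expi (x : R) : R[i] := cos x +i* sin x.

Definition cmeasurable (f : R -> R[i]) : Prop :=
  measurable_fun setT (fun x => complex.Re (f x)) /\
  measurable_fun setT (fun x => complex.Im (f x)).

Definition cintegrable (D : set R) (f : R -> R[i]) : Prop :=
  mu.-integrable D (fun x => (complex.Re (f x))%:E) /\
  mu.-integrable D (fun x => (complex.Im (f x))%:E).

Definition cintegral (D : set R) (f : R -> R[i]) : R[i] :=
  (\int[mu]_(x in D) complex.Re (f x)) +i* (\int[mu]_(x in D) complex.Im (f x)).

Definition cderiv (n : nat) (f : R -> R[i]) (x : R) : R[i] :=
  (derive1n n (fun y => complex.Re (f y)) x) +i*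
  (derive1n n (fun y => complex.Im (f y)) x).

Definition csmooth (f : R -> R[i]) : Prop :=
  forall (n : nat) (x : R),
    derivable (derive1n n (fun y => complex.Re (f y))) x 1 /\
    derivable (derive1n n (fun y => complex.Im (f y))) x 1.

Definition schwartz (f : R -> R[i]) : Prop :=
  csmooth f /\
  forall m n : nat, exists M : R,
    forall x : R, `|x| ^+ m * Normc.normc (cderiv n f x) <= M.

(* The convention is F f (xi) = \int f(x) e^{-i x xi} dx. *)
Definition fourier (f : R -> R[i]) (xi : R) : R[i] :=
  cintegral setT (fun x => expi (- (x * xi)) * f x).

Definition ifourier (f : R -> R[i]) (x : R) : R[i] :=
  ((2 * pi)^-1)%:C * cintegral setT (fun xi => expi (x * xi) * f xi).

End ComplexValued.

(* Distributions are carried by all functionals on R -> R[i]; only the values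
   on Schwartz functions are meaningful (see [distr_eq]).  This makes the
   operations defined by duality total. *)
Definition distr (R : realType) := (R -> R[i]) -> R[i].

Section Distributions.
Variable R : realType.
Implicit Types f g h : distr R.

Definition distr_eq f g : Prop :=
  forall phi : R -> R[i], schwartz phi -> f phi = g phi.

Definition tempered f : Prop :=
  (forall (a : R[i]) (phi psi : R -> R[i]), schwartz phi -> schwartz psi ->
     f (fun x => a * phi x + psi x) = a * f phi + f psi) /\
  exists (k : nat) (K : R), forall (phi : R -> R[i]) (M : R), schwartz phi ->
    (forall (i j : nat) (x : R), (i <= k)%N -> (j <= k)%N ->
       `|x| ^+ i * Normc.normc (cderiv j phi x) <= M) ->
    Normc.normc (f phi) <= K * M.

Definition real_valued f : Prop :=
  forall phi : R -> R[i], schwartz phi ->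
    f (fun x => (phi x)^*) = (f phi)^*.

Definition distr_is_fun f (g : R -> R[i]) : Prop :=
  cmeasurable g /\
  forall phi : R -> R[i], schwartz phi ->
    cintegrable setT (fun x => g x * phi x) /\
    f phi = cintegral setT (fun x => g x * phi x).

Definition distr_fourier f : distr R := fun phi => f (fourier phi).
Definition distr_ifourier f : distr R := fun phi => f (ifourier phi).
Definition distr_mul (m : R -> R[i]) f : distr R :=
  fun phi => f (fun x => m x * phi x).
Definition distr_dx f : distr R := fun phi => - f (cderiv 1 phi).

(* [distr_square f h]: f is a function v such that v ^ 2 also defines a
   tempered distribution, and h is v ^ 2. *)
Definition distr_square f h : Prop :=
  exists v : R -> R[i],
    distr_is_fun f v /\ distr_is_fun h (fun x => v x ^+ 2).

End Distributions.

Section FourierAmalgam.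
Variable R : realType.
Let mu := @lebesgue_measure R.

Definition japanese (n : int) : R := Num.sqrt (1 + n%:~R ^+ 2).

Definition unit_block (n : int) : set R :=
  `]n%:~R - 2^-1, n%:~R + 2^-1]%classic.

Definition amalgam_norm (p q : \bar R) (s : R) (g : R -> R[i]) : \bar R :=
  Lnorm counting q (fun n : int =>
    (Lnorm mu p (fun xi => (\1_(unit_block n) xi * Normc.normc (g xi))%:E)
     * (japanese n `^ s)%:E)%E).

(* The function representing F f is unique almost everywhere when it exists;
   otherwise the infimum is taken over the empty set and is +oo. *)
Definition fa_norm (p q : \bar R) (s : R) (f : distr R) : \bar R :=
  ereal_inf [set amalgam_norm p q s g |
              g in [set g | distr_is_fun (distr_fourier f) g]].

Definition fourier_amalgam (p q : \bar R) (s : R) : set (distr R) :=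
  [set f | tempered f /\ (fa_norm p q s f < +oo)%E].

End FourierAmalgam.

(* A real linear subspace of an ambient vector space with an extended norm,
   as bare data.  The ambient spaces below are spaces of functions into R[i],
   but the subspaces (real-valued distributions) are real ones, whence the
   restriction to real scalars in [bounded_linear]. *)
Record nspace (R : realType) (V : lmodType R[i]) :=
  NSpace { carrier : set V; nnorm : V -> \bar R }.

Section Differentiability.
Variable R : realType.

Definition bounded_linear (V W : lmodType R[i]) (X : nspace V) (Y : nspace W)
    (L : V -> W) : Prop :=
  [/\ forall x, carrier X x -> carrier Y (L x),
      forall (c : R) (x y : V), carrier X x -> carrier X y ->
        L (c%:C *: x + y) = c%:C *: L x + L y
    & exists K : R, forall x, carrier X x ->
        (nnorm Y (L x) <= K%:E * nnorm X x)%E].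

Definition blin_space (V W : lmodType R[i]) (X : nspace V) (Y : nspace W) :
    nspace (V -> W) :=
  @NSpace R (V -> W)
    [set L | bounded_linear X Y L]
    (fun L => ereal_sup [set nnorm Y (L x) |
                x in [set x | carrier X x /\ (nnorm X x <= 1)%E]]).

Definition is_frechet (V W : lmodType R[i]) (X : nspace V) (Y : nspace W)
    (F : V -> W) (a : V) (L : V -> W) : Prop :=
  bounded_linear X Y L /\
  forall e : R, 0 < e -> exists2 d : R, 0 < d &
    forall h, carrier X h -> (nnorm X h < d%:E)%E ->
      (nnorm Y (F (a + h) - F a - L h)%R <= e%:E * nnorm X h)%E.

(* Twice Frechet differentiable on a ball around 0, with a second derivative
   that is continuous at 0. *)
Definition C2_at_zero (V W : lmodType R[i]) (X : nspace V) (Y : nspace W)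
    (F : V -> W) : Prop :=
  exists (r : R) (DF : V -> V -> W) (D2F : V -> V -> V -> W),
    [/\ 0 < r,
        forall a, carrier X a -> (nnorm X a < r%:E)%E ->
          is_frechet X Y F a (DF a) /\
          is_frechet X (blin_space X Y) DF a (D2F a)
      & forall e : R, 0 < e -> exists2 d : R, 0 < d &
          forall a, carrier X a -> (nnorm X a < d%:E)%E ->
            (nnorm (blin_space X (blin_space X Y)) (D2F a - D2F 0)%R
               <= e%:E)%E].

(* C([0, T]; X); values outside [0, T] are irrelevant. *)
Definition path_space (V : lmodType R[i]) (T : R) (X : nspace V) :
    nspace (R -> V) :=
  @NSpace R (R -> V)
    [set u | (forall t, t \in `[0, T] -> carrier X (u t)) /\
       forall t, t \in `[0, T] -> forall e : R, 0 < e ->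
         exists2 d : R, 0 < d &
           forall t', t' \in `[0, T] -> `|t' - t| < d ->
             (nnorm X (u t' - u t)%R <= e%:E)%E]
    (fun u => ereal_sup [set nnorm X (u t) | t in [set t | t \in `[0, T]]]).

End Differentiability.

Section KdVBurgers.
Variable R : realType.
Let mu := @lebesgue_measure R.

Definition real_fourier_amalgam (p q : \bar R) (s : R) :
    nspace ((R -> R[i]) -> R[i]) :=
  @NSpace R ((R -> R[i]) -> R[i])
    [set f | fourier_amalgam p q s f /\ real_valued f]
    (fa_norm p q s).

Definition kdvb_symbol (t xi : R) : R[i] :=
  (expR (- (t * xi ^+ 2)))%:C * expi (t * xi ^+ 3).

(* F (S(t) f) = kdvb_symbol t * F f *)
Definition kdvb_semigroup (t : R) (f : distr R) : distr R :=
  distr_ifourier (distr_mul (kdvb_symbol t) (distr_fourier f)).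

(* The Duhamel equation in S'(R): w(tau) is the square of u(tau), and the
   time integral is taken after pairing with a test function. *)
Definition duhamel (T : R) (u0 : distr R) (u : R -> distr R) : Prop :=
  exists w : R -> distr R,
    {ae mu, forall tau, tau \in `[0, T] -> distr_square (u tau) (w tau)} /\
    forall (t : R) (phi : R -> R[i]), t \in `[0, T] -> schwartz phi ->
      let integrand tau := kdvb_semigroup (t - tau) (distr_dx (w tau)) phi in
      cintegrable `[0, t]%classic integrand /\
      u t phi = kdvb_semigroup t u0 phi
                - (2^-1)%:C * cintegral `[0, t]%classic integrand.

Definition kdvb_solution (p q : \bar R) (s T : R) (u0 : distr R)
    (u : R -> distr R) : Prop :=
  carrier (path_space T (real_fourier_amalgam p q s)) u /\ duhamel T u0 u.

Definition kdvb_unique_solution (p q : \bar R) (s T : R) (u0 : distr R)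
    (u : R -> distr R) : Prop :=
  kdvb_solution p q s T u0 u /\
  forall v, kdvb_solution p q s T u0 v ->
    forall t, t \in `[0, T] -> distr_eq (v t) (u t).

(* As differentiability at zero is at stake, well-posedness on [0, T] is only
   asked for data in some ball around 0. *)
Definition kdvb_flow_map (p q : \bar R) (s T : R)
    (Phi : distr R -> R -> distr R) : Prop :=
  exists2 r : R, 0 < r &
    forall u0, carrier (real_fourier_amalgam p q s) u0 ->
      (fa_norm p q s u0 < r%:E)%E ->
      kdvb_unique_solution p q s T u0 (Phi u0).

End KdVBurgers.

(* Main.v *)
(* Let [c] be the indicator function of the frequencies at distance at most 1/4
   from [N] or [- N], multiplied by [A ~ N ^ (- s)], so that the distribution [h]
   with transform [c] has norm at most 1 in the amalgam space.  On the Fourier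
   side, with the weight [(1 + xi ^ 2) ^ -3] that is stable under convolution, a
   Picard iteration solves the Duhamel equation with data [e h] for small [e]
   (small in a way that may depend on [N]).  By uniqueness this solution is the
   flow [Phi (e h)], whose expansion [e U1 + e ^ 2 U2 + O(e ^ 3)] is explicit.
   If [Phi] is C^2 at zero, then its symmetric second differences along [e h],
   paired with a fixed Schwartz function, are O(e ^ 2) uniformly in [N] and in
   the time [t]; hence so is the pairing of [U2].  But at time
   [t = 1 / (32 N ^ 2)] the high frequencies [N] and [- N] interact into low
   frequencies without cancellation, and the pairing of [U2] has size
   [t A ^ 2 ~ N ^ (- 2 s - 2)], which is unbounded since [s < -1]. *)

Require Import Defs.
From HB Require Import structures.
From mathcomp Require Import all_boot all_order all_algebra.
From mathcomp Require Import complex.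
From mathcomp Require Import all_classical all_reals all_analysis.
From mathcomp Require Import measurable_realfun ess_sup_inf ring lra.

Set Implicit Arguments.
Unset Strict Implicit.
Unset Printing Implicit Defensive.
Import Order.TTheory GRing.Theory Num.Theory.
Import numFieldNormedType.Exports.

Local Open Scope classical_set_scope.
Local Open Scope ring_scope.
Local Open Scope complex_scope.

(** * Complex-valued integrals *)

(** For [s < -1] the norm of [u] does not control [u ^ 2], so the Duhamel formula cannot be
    differentiated in the amalgam space itself. The second derivative of the flow is reached only
    along data whose solutions are known in a stronger sense, and uniqueness is what ties these
    solutions to the flow. The exponent [-1] comes from the interaction of [a] and [b = xi - a]: its
    phase [xi^3 - a^3 - b^3 = 3 a b xi] and its damping are both of size [N^2] when [a] is near [N]
    and [xi] is bounded. Up to times of order [N^-2] neither has acted, and the interaction grows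
    like [t A^2]; waiting longer would destroy its sign. The indices [p] and [q] drop out because
    each bump of the data sits in one unit block, of measure one, and because the output is observed
    through a single Schwartz function. The order of choices is: the constants of the C^2 bound,
    then [N], then [e]. No estimate of the Picard scheme therefore has to be uniform in [N]. *)

Notation normc := Normc.normc.
Notation Rec := complex.Re.
Notation Imc := complex.Im.

Section ComplexNumbers.
Variable R : realType.
Implicit Types z w : R[i].

Definition imag (x : R) : R[i] := 0 +i* x.

Lemma complex_eq z w : Rec z = Rec w -> Imc z = Imc w -> z = w.
Proof. by case: z w => [a b] [c d] /= -> ->. Qed.

Lemma ReD z w : Rec (z + w) = Rec z + Rec w. Proof. by case: z w => [? ?] []. Qed.
Lemma ImD z w : Imc (z + w) = Imc z + Imc w. Proof. by case: z w => [? ?] []. Qed.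
Lemma ReN z : Rec (- z) = - Rec z. Proof. by case: z. Qed.
Lemma ImN z : Imc (- z) = - Imc z. Proof. by case: z. Qed.
Lemma ReB z w : Rec (z - w) = Rec z - Rec w. Proof. by rewrite ReD ReN. Qed.
Lemma ImB z w : Imc (z - w) = Imc z - Imc w. Proof. by rewrite ImD ImN. Qed.
Lemma ReM z w : Rec (z * w) = Rec z * Rec w - Imc z * Imc w.
Proof. by case: z w => [? ?] []. Qed.
Lemma ImM z w : Imc (z * w) = Rec z * Imc w + Imc z * Rec w.
Proof. by case: z w => [? ?] []. Qed.
Lemma Re_conj z : Rec z^* = Rec z. Proof. by case: z. Qed.
Lemma Im_conj z : Imc z^* = - Imc z. Proof. by case: z. Qed.
Lemma Re_real (x : R) : Rec x%:C = x. Proof. by []. Qed.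
Lemma Im_real (x : R) : Imc x%:C = 0. Proof. by []. Qed.

Lemma Re_imag (x : R) : Rec (imag x) = 0. Proof. by []. Qed.
Lemma Im_imag (x : R) : Imc (imag x) = x. Proof. by []. Qed.
Lemma Re_expi (x : R) : Rec (expi x) = cos x. Proof. by []. Qed.
Lemma Im_expi (x : R) : Imc (expi x) = sin x. Proof. by []. Qed.
Lemma Re0 : Rec (0 : R[i]) = 0. Proof. by []. Qed.
Lemma Im0 : Imc (0 : R[i]) = 0. Proof. by []. Qed.
Lemma Re1 : Rec (1 : R[i]) = 1. Proof. by []. Qed.
Lemma Im1 : Imc (1 : R[i]) = 0. Proof. by []. Qed.

(** Rewriting with this tuple turns an identity between complex numbers into two real ones that
    [ring] can close. *)
Definition reimE := (ReB, ImB, ReD, ImD, ReN, ImN, ReM, ImM, Re_conj, Im_conj,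
  Re_real, Im_real, Re_imag, Im_imag, Re_expi, Im_expi, Re0, Im0, Re1, Im1).

Lemma normc_ge0 z : 0 <= normc z. Proof. by case: z => a b; exact: sqrtr_ge0. Qed.

Lemma normcE z : normc z = Num.sqrt (Rec z ^+ 2 + Imc z ^+ 2).
Proof. by case: z. Qed.

Lemma normcD z w : normc (z + w) <= normc z + normc w.
Proof. by have := ler_normD z w; rewrite !normc_def -rmorphD lecR !normcE. Qed.

Lemma normcN z : normc (- z) = normc z.
Proof. by rewrite !normcE !reimE !sqrrN. Qed.

Lemma normcB z w : normc (z - w) <= normc z + normc w.
Proof. by rewrite -(normcN w); exact: normcD. Qed.

Lemma normc_conj z : normc z^* = normc z.
Proof. by rewrite !normcE !reimE sqrrN. Qed.

Lemma normc_real (x : R) : normc x%:C = `|x|.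
Proof. by rewrite normcE /= expr0n addr0 sqrtr_sqr. Qed.

Lemma normc_imag (x : R) : normc (imag x) = `|x|.
Proof. by rewrite normcE /= expr0n add0r sqrtr_sqr. Qed.

Lemma Re_le_normc z : `|Rec z| <= normc z.
Proof. by rewrite normcE -sqrtr_sqr ler_wsqrtr// lerDl sqr_ge0. Qed.

Lemma Im_le_normc z : `|Imc z| <= normc z.
Proof. by rewrite normcE -sqrtr_sqr ler_wsqrtr// lerDr sqr_ge0. Qed.

Lemma normc_le_ReIm z : normc z <= `|Rec z| + `|Imc z|.
Proof.
rewrite normcE -(@ger0_norm _ (`|Rec z| + `|Imc z|)) ?addr_ge0//.
rewrite -sqrtr_sqr ler_wsqrtr// sqrrD !real_normK ?num_real//.
by rewrite addrAC lerDl mulrn_wge0// mulr_ge0.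
Qed.

Lemma normc_expi (x : R) : normc (expi x) = 1.
Proof. by rewrite normcE /= cos2Dsin2 sqrtr1. Qed.

Lemma normc0_eq z : normc z <= 0 -> z = 0.
Proof. by move=> z0; apply: Normc.eq0_normc; apply/eqP; rewrite eq_le z0 normc_ge0. Qed.

Lemma expiD (x y : R) : expi (x + y) = expi x * expi y.
Proof.
by apply: complex_eq; rewrite !reimE /= ?cosD ?sinD //; ring.
Qed.

Lemma expiN (x : R) : expi (- x) = (expi x)^*.
Proof. by rewrite /expi cosN sinN. Qed.

End ComplexNumbers.

Section ComplexMeasurable.
Context d (T : measurableType d) (R : realType).
Implicit Types f g : T -> R[i].

(** On the line this is [cmeasurable]; a general domain is needed for functions of time and
    frequency, to which Fubini is applied. *)
Definition cmfun f :=
  measurable_fun setT (fun x => Rec (f x)) /\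
  measurable_fun setT (fun x => Imc (f x)).

Lemma cmfunD f g : cmfun f -> cmfun g -> cmfun (fun x => f x + g x).
Proof.
move=> [f1 f2] [g1 g2]; split.
  by under eq_fun do rewrite ReD; exact: measurable_funD.
by under eq_fun do rewrite ImD; exact: measurable_funD.
Qed.

Lemma cmfunN f : cmfun f -> cmfun (fun x => - f x).
Proof.
move=> [f1 f2]; split.
  by under eq_fun do rewrite ReN; exact: measurableT_comp.
by under eq_fun do rewrite ImN; exact: measurableT_comp.
Qed.

Lemma cmfunB f g : cmfun f -> cmfun g -> cmfun (fun x => f x - g x).
Proof. by move=> mf mg; apply: cmfunD => //; exact: cmfunN. Qed.

Lemma cmfunM f g : cmfun f -> cmfun g -> cmfun (fun x => f x * g x).
Proof.
move=> [f1 f2] [g1 g2]; split.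
  under eq_fun do rewrite ReM.
  by apply: measurable_funB; exact: measurable_funM.
under eq_fun do rewrite ImM.
by apply: measurable_funD; exact: measurable_funM.
Qed.

Lemma cmfun_real (f : T -> R) : measurable_fun setT f ->
  cmfun (fun x => (f x)%:C).
Proof. by move=> mf; split => //=; exact: measurable_cst. Qed.

Lemma cmfun_cst (z : R[i]) : cmfun (fun=> z).
Proof. by split; exact: measurable_cst. Qed.

Lemma cmfun_expi (f : T -> R) : measurable_fun setT f ->
  cmfun (fun x => expi (f x)).
Proof.
move=> mf; split => /=; apply: measurableT_comp => //.
  by apply: continuous_measurable_fun; exact: continuous_cos.
by apply: continuous_measurable_fun; exact: continuous_sin.
Qed.

Lemma measurable_normc f : cmfun f -> measurable_fun setT (fun x => normc (f x)).
Proof.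
move=> [f1 f2]; under eq_fun do rewrite normcE.
apply: (@measurableT_comp _ _ _ _ _ _ (@Num.sqrt R)).
  by apply: continuous_measurable_fun; exact: sqrt_continuous.
apply: measurable_funD; first exact: measurable_funX f1.
exact: measurable_funX f2.
Qed.

End ComplexMeasurable.

Lemma cmfun_comp d d' (T : measurableType d) (T' : measurableType d')
    (R : realType) (f : T -> R[i]) (g : T' -> T) :
  cmfun f -> measurable_fun setT g -> cmfun (fun x => f (g x)).
Proof.
by move=> [f1 f2] mg; split; [exact: measurableT_comp f1 mg|
  exact: measurableT_comp f2 mg].
Qed.

Section ComplexIntegral.
Variable R : realType.
Let mu := @lebesgue_measure R.
Implicit Types (D : set R) (f g : R -> R[i]) (h : R -> R).

Lemma cintegrable_dom D f h : measurable D -> cmfun f ->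
  mu.-integrable D (EFin \o h) -> (forall x, D x -> normc (f x) <= h x) ->
  cintegrable D f.
Proof.
move=> mD [f1 f2] ih fh; split.
  apply: le_integrable ih => //.
    by apply/measurable_EFinP; exact: measurable_funS f1.
  move=> x Dx /=; rewrite lee_fin (le_trans (Re_le_normc _))//.
  by rewrite (le_trans (fh x Dx))// ler_norm.
apply: le_integrable ih => //.
  by apply/measurable_EFinP; exact: measurable_funS f2.
move=> x Dx /=; rewrite lee_fin (le_trans (Im_le_normc _))//.
by rewrite (le_trans (fh x Dx))// ler_norm.
Qed.

(* The constant 2 comes from estimating real and imaginary parts separately. *)
Lemma normc_cintegral_le D f h : measurable D -> cmfun f ->
  mu.-integrable D (EFin \o h) -> (forall x, D x -> normc (f x) <= h x) ->
  normc (cintegral D f) <= 2 * \int[mu]_(x in D) h x.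
Proof.
move=> mD mf ih fh; have [i1 i2] := cintegrable_dom mD mf ih fh.
rewrite mulr2n mulrDl !mul1r (le_trans (normc_le_ReIm _))//= lerD//.
  rewrite (le_trans (le_normr_Rintegral _ i1))// le_Rintegral//.
    exact: integrable_norm i1.
  by move=> x Dx; rewrite (le_trans (Re_le_normc _))// fh.
rewrite (le_trans (le_normr_Rintegral _ i2))// le_Rintegral//.
  exact: integrable_norm i2.
by move=> x Dx; rewrite (le_trans (Im_le_normc _))// fh.
Qed.

Lemma cintegralD D f g : measurable D -> cintegrable D f -> cintegrable D g ->
  cintegral D (fun x => f x + g x) = cintegral D f + cintegral D g.
Proof.
move=> mD [f1 f2] [g1 g2]; apply: complex_eq; rewrite !reimE /=.
  by rewrite -RintegralD//; apply: eq_Rintegral => x _; rewrite ReD.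
by rewrite -RintegralD//; apply: eq_Rintegral => x _; rewrite ImD.
Qed.

Lemma cintegrableD D f g : measurable D -> cintegrable D f -> cintegrable D g ->
  cintegrable D (fun x => f x + g x).
Proof.
move=> mD [f1 f2] [g1 g2]; split.
  by under eq_fun do rewrite ReD EFinD; exact: integrableD.
by under eq_fun do rewrite ImD EFinD; exact: integrableD.
Qed.

Lemma cintegralB D f g : measurable D -> cintegrable D f -> cintegrable D g ->
  cintegral D (fun x => f x - g x) = cintegral D f - cintegral D g.
Proof.
move=> mD [f1 f2] [g1 g2]; apply: complex_eq; rewrite !reimE /=.
  by rewrite -RintegralB//; apply: eq_Rintegral => x _; rewrite ReB.
by rewrite -RintegralB//; apply: eq_Rintegral => x _; rewrite ImB.
Qed.

Lemma cintegrableM D (z : R[i]) f : measurable D -> cintegrable D f ->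
  cintegrable D (fun x => z * f x).
Proof.
move=> mD [f1 f2]; split.
  under eq_fun do rewrite ReM EFinB !EFinM.
  by apply: integrableB => //; exact: integrableZl.
under eq_fun do rewrite ImM EFinD !EFinM.
by apply: integrableD => //; exact: integrableZl.
Qed.

Lemma cintegralM D (z : R[i]) f : measurable D -> cintegrable D f ->
  cintegral D (fun x => z * f x) = z * cintegral D f.
Proof.
move=> mD [f1 f2]; apply: complex_eq; rewrite !reimE /=.
  rewrite -!RintegralZl// -RintegralB//; last 2 first.
    exact: integrableZl f1.
    exact: integrableZl f2.
  by apply: eq_Rintegral => x _; rewrite ReM.
rewrite -!RintegralZl// -RintegralD//; last 2 first.
  exact: integrableZl f2.
  exact: integrableZl f1.
by apply: eq_Rintegral => x _; rewrite ImM.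
Qed.

Lemma cintegral_conj D f : measurable D -> cintegrable D f ->
  cintegral D (fun x => (f x)^*) = (cintegral D f)^*.
Proof.
move=> mD [f1 f2]; apply: complex_eq; rewrite !reimE /=.
  by apply: eq_Rintegral => x _; rewrite Re_conj.
rewrite -mulN1r -RintegralZl//; apply: eq_Rintegral => x _.
by rewrite Im_conj mulN1r.
Qed.

Lemma eq_cintegral D f g : (forall x, D x -> f x = g x) ->
  cintegral D f = cintegral D g.
Proof.
move=> fg; congr Complex; apply: eq_Rintegral => x /set_mem Dx; by rewrite fg.
Qed.

Lemma cintegral_mkcond D f :
  cintegral D f = cintegral setT (fun x => (\1_D x)%:C * f x).
Proof.
congr Complex; rewrite Rintegral_mkcond; apply: eq_Rintegral => x _;
  rewrite patchE indicE; case: (x \in D);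
  by rewrite !reimE /= ?mul1r ?mul0r ?subr0 ?addr0.
Qed.

End ComplexIntegral.

(** * Fubini's theorem for complex-valued functions *)

Section Fubini.
Variable R : realType.
Let mu := @lebesgue_measure R.

Lemma measurable_integral_snd d (T : measurableType d) (F : T * R -> \bar R) :
  measurable_fun setT F -> measurable_fun setT (fun x => \int[mu]_y F (x, y))%E.
Proof.
move=> mF.
rewrite (_ : (fun _ => _) = (fun x => (\int[mu]_y F^\+ (x, y))
     - (\int[mu]_y F^\- (x, y)))%E); last first.
  apply/funext => x; rewrite [LHS]integralE.
  under eq_integral do rewrite funepos_comp/=.
  by under [X in (_ - X = _)%E]eq_integral do rewrite funeneg_comp/=.
apply: emeasurable_funB.
  by apply: measurable_fun_fubini_tonelli_F => //; exact: measurable_funepos.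
by apply: measurable_fun_fubini_tonelli_F => //; exact: measurable_funeneg.
Qed.

Lemma measurable_Rintegral_snd d (T : measurableType d) (f : T * R -> R)
    (D : set R) : measurable D -> measurable_fun setT f ->
  measurable_fun setT (fun x => \int[mu]_(y in D) f (x, y)).
Proof.
move=> mD mf.
under eq_fun do rewrite Rintegral_mkcond.
pose g z : R := f z * \1_D z.2.
have mg : measurable_fun setT g.
  apply: measurable_funM => //.
  by apply: measurableT_comp => //; exact: measurable_indic.
have mG : measurable_fun setT (EFin \o g) by exact/measurable_EFinP.
rewrite (_ : (fun _ => _) = fine \o (fun x => \int[mu]_y (EFin \o g) (x, y))%E).
  by apply: measurableT_comp => //; exact: measurable_integral_snd.
apply/funext => x; rewrite /= /Rintegral; congr fine.
apply: eq_integral => y _; congr EFin.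
by rewrite /g patchE indicE; case: ifPn; rewrite ?mulr1 ?mulr0.
Qed.

Lemma cmfun_cintegral d (T : measurableType d) (f : T * R -> R[i])
    (D : set R) : measurable D -> cmfun f ->
  cmfun (fun x => cintegral D (fun y => f (x, y))).
Proof.
by move=> mD [f1 f2]; split; [exact: measurable_Rintegral_snd mD f1|
  exact: measurable_Rintegral_snd mD f2].
Qed.

(** The majorant [h] and the bound [G] on its inner integrals yield joint integrability of [f] by
    Tonelli. *)
Lemma Rfubini (f : R * R -> R) (h : R -> R -> R) (G : R -> R) :
  measurable_fun setT f -> mu.-integrable setT (EFin \o G) ->
  (forall x, mu.-integrable setT (EFin \o h x)) ->
  (forall x y, `|f (x, y)| <= h x y) ->
  (forall x, \int[mu]_y h x y <= G x) ->
  \int[mu]_x \int[mu]_y f (x, y) = \int[mu]_y \int[mu]_x f (x, y).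
Proof.
move=> mf iG ih fh hG.
have mF : measurable_fun setT (EFin \o f) by exact/measurable_EFinP.
have if1 x : mu.-integrable setT (fun y => (f (x, y))%:E).
  apply: le_integrable (ih x) => //.
    by apply/measurable_EFinP; exact: measurableT_comp mf _.
  by move=> y _ /=; rewrite lee_fin (le_trans (fh x y))// ler_norm.
have iF : (mu \x mu)%E.-integrable setT (EFin \o f).
  apply/integrable12ltyP => //.
  apply: (@le_lt_trans _ _ (\int[mu]_x (G x)%:E)%E); last first.
    move/integrableP : iG => [mG]; apply: le_lt_trans.
    rewrite ge0_le_integral//.
    - by move=> x _; rewrite lee_fin (le_trans _ (hG x))// Rintegral_ge0// => y _;
        rewrite (le_trans _ (fh x y)).
    - exact: measurableT_comp.
    - by move=> x _ /=; rewrite lee_fin ler_norm.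
  apply: ge0_le_integral => //.
  - by move=> x _; exact: integral_ge0.
  - apply: (@measurable_integral_snd _ _ (abse \o (EFin \o f))).
    exact: measurableT_comp.
  - by move/integrableP : iG => [].
  - move=> x _; rewrite (@le_trans _ _ (\int[mu]_y (h x y)%:E)%E)//.
      apply: ge0_le_integral => //.
      + by apply: measurableT_comp => //; move/integrableP : (if1 x) => [].
      + by move/integrableP : (ih x) => [].
      + by move=> y _; rewrite lee_fin fh.
    rewrite -[leLHS]fineK; first by rewrite lee_fin; exact: hG.
    exact: integrable_fin_num (ih x).
rewrite /Rintegral.
rewrite (_ : (\int[mu]_x (fine (\int[mu]_y (f (x, y))%:E))%:E)%E =
    (\int[mu]_x \int[mu]_y (EFin \o f) (x, y))%E); last first.
  by apply: eq_integral => x _; rewrite fineK//; exact: integrable_fin_num (if1 x).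
rewrite (Fubini iF); congr fine.
have mFG := measurable_fubini_G iF.
(* The integral in [x] is known to be finite only for almost every [y], so [fine] is removed almost
   everywhere. *)
apply: ae_eq_integral => //.
- apply/measurable_EFinP; apply: measurableT_comp => //.
- have := ae_integrable2 iF; apply: filterS => y /= iy _.
  by rewrite fineK//; exact: integrable_fin_num iy.
Qed.

Lemma cfubini (f : R * R -> R[i]) (h : R -> R -> R) (G : R -> R) :
  cmfun f -> mu.-integrable setT (EFin \o G) ->
  (forall x, mu.-integrable setT (EFin \o h x)) ->
  (forall x y, normc (f (x, y)) <= h x y) ->
  (forall x, \int[mu]_y h x y <= G x) ->
  cintegral setT (fun x => cintegral setT (fun y => f (x, y))) =
  cintegral setT (fun y => cintegral setT (fun x => f (x, y))).
Proof.
move=> [f1 f2] iG ih fh hG; apply: complex_eq.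
  apply: (Rfubini f1 iG ih) => // x y.
  exact: le_trans (Re_le_normc _) (fh x y).
apply: (Rfubini f2 iG ih) => // x y.
exact: le_trans (Im_le_normc _) (fh x y).
Qed.

End Fubini.

(** * Invariance of the integral under translation and reflection *)

Section Translation.
Variable R : realType.
Let mu := @lebesgue_measure R.

Lemma lebesgue_measure_shift (a : R) (A : set R) : measurable A ->
  pushforward mu (shift a : _ -> measurableTypeR R) A = mu A.
Proof.
move=> mA.
have mphi : measurable_fun [set: measurableTypeR R] (shift a : _ -> measurableTypeR R).
  exact: measurable_funD.
apply/esym/lebesgue_measure_unique => //= _ [[b c]] _ <-.
rewrite /pushforward.
have -> : (+%R^~ a) @^-1` `]b, c] = `]b - a, c - a]%classic :> set R.
  by apply/seteqP; split => x /=; rewrite !in_itv /= ltrBlDr lerBrDr.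
rewrite !lebesgue_measure_itv/= !lte_fin ltrD2r.
by case: ifPn => // _; rewrite -!EFinD; congr EFin; ring.
Qed.

Lemma ge0_integral_shift (a : R) (f : R -> \bar R) : measurable_fun setT f ->
  (forall x, 0 <= f x)%E -> (\int[mu]_x f (x + a)%R = \int[mu]_x f x)%E.
Proof.
move=> mf f0.
have mphi : measurable_fun [set: measurableTypeR R] (shift a : _ -> measurableTypeR R).
  exact: measurable_funD.
rewrite -[LHS](ge0_integral_pushforward mphi mu (D := setT))//.
by apply: eq_measure_integral => A mA _; exact: lebesgue_measure_shift.
Qed.

Lemma ge0_integral_oppr (f : R -> \bar R) : measurable_fun setT f ->
  (forall x, 0 <= f x)%E -> (\int[mu]_x f (- x)%R = \int[mu]_x f x)%E.
Proof.
move=> mf f0.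
have mphi : measurable_fun [set: measurableTypeR R] (-%R : _ -> measurableTypeR R).
  exact: oppr_measurable.
rewrite -[LHS](ge0_integral_pushforward mphi mu (D := setT))//.
by apply: eq_measure_integral => A mA _; exact: lebesgue_measureN.
Qed.

(** The integral is defined through positive and negative parts, so a change of variables passes
    from nonnegative to all measurable functions without integrability. *)
Lemma integral_affine (phi : R -> R) (f : R -> \bar R) :
  (forall g : R -> \bar R, measurable_fun setT g -> (forall x, 0 <= g x)%E ->
     (\int[mu]_x g (phi x) = \int[mu]_x g x)%E) ->
  measurable_fun setT f -> (\int[mu]_x f (phi x) = \int[mu]_x f x)%E.
Proof.
move=> H mf; rewrite integralE [RHS]integralE.
rewrite -[in RHS](H f^\+%E)//; last exact: measurable_funepos.
rewrite -[in RHS](H f^\-%E)//; last exact: measurable_funeneg.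
by rewrite -[fun x => f (phi x)]/(f \o phi) funepos_comp funeneg_comp.
Qed.

Lemma Rintegral_shift (a : R) (f : R -> R) : measurable_fun setT f ->
  \int[mu]_x f (x + a) = \int[mu]_x f x.
Proof.
move=> mf; congr fine; apply: (@integral_affine (shift a) (EFin \o f)).
  by move=> g mg g0; exact: ge0_integral_shift.
exact/measurable_EFinP.
Qed.

Lemma Rintegral_oppr (f : R -> R) : measurable_fun setT f ->
  \int[mu]_x f (- x) = \int[mu]_x f x.
Proof.
move=> mf; congr fine; apply: (@integral_affine -%R (EFin \o f)).
  by move=> g mg g0; exact: ge0_integral_oppr.
exact/measurable_EFinP.
Qed.

Lemma cintegral_shift (a : R) (f : R -> R[i]) : cmfun f ->
  cintegral setT (fun x => f (x + a)) = cintegral setT f.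
Proof.
by move=> [f1 f2]; apply: complex_eq; [exact: Rintegral_shift f1|
  exact: Rintegral_shift f2].
Qed.

Lemma cintegral_oppr (f : R -> R[i]) : cmfun f ->
  cintegral setT (fun x => f (- x)) = cintegral setT f.
Proof.
by move=> [f1 f2]; apply: complex_eq; [exact: Rintegral_oppr f1|
  exact: Rintegral_oppr f2].
Qed.

Lemma integrable_shift (a : R) (f : R -> R) : mu.-integrable setT (EFin \o f) ->
  mu.-integrable setT (fun x => (f (x + a))%:E).
Proof.
move=> /integrableP[mf fi]; apply/integrableP; split.
  by apply: (measurableT_comp mf); exact: measurable_funD.
rewrite (@ge0_integral_shift a (fun x => `|(f x)%:E|%E))//.
exact: measurableT_comp.
Qed.

Lemma integrable_oppr (f : R -> R) : mu.-integrable setT (EFin \o f) ->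
  mu.-integrable setT (fun x => (f (- x))%:E).
Proof.
move=> /integrableP[mf fi]; apply/integrableP; split.
  by apply: (measurableT_comp mf); exact: oppr_measurable.
rewrite (@ge0_integral_oppr (fun x => `|(f x)%:E|%E))//.
exact: measurableT_comp.
Qed.

End Translation.

(** * Schwartz functions *)

Section Weight.
Variable R : realType.
Let mu := @lebesgue_measure R.

(** The inverse square of the Japanese bracket: it is integrable, and being rational it reduces
    pointwise bounds to polynomial inequalities. *)
Definition wt (x : R) : R := (1 + x ^+ 2)^-1.

Lemma oneD_sqr_gt0 (x : R) : 0 < 1 + x ^+ 2.
Proof. by rewrite ltr_pwDl// sqr_ge0. Qed.

Lemma wt_gt0 x : 0 < wt x. Proof. by rewrite invr_gt0 oneD_sqr_gt0. Qed.
Lemma wt_ge0 x : 0 <= wt x. Proof. exact/ltW/wt_gt0. Qed.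
Lemma wt_le1 x : wt x <= 1.
Proof. by rewrite invf_le1 ?oneD_sqr_gt0// lerDl sqr_ge0. Qed.
Lemma wtN x : wt (- x) = wt x. Proof. by rewrite /wt sqrrN. Qed.

Lemma continuous_wt : continuous wt.
Proof. exact: continuous_oneDsqrV. Qed.

Lemma measurable_wt : measurable_fun setT wt.
Proof. by apply: continuous_measurable_fun; exact: continuous_wt. Qed.

Lemma integrable_wt : mu.-integrable setT (EFin \o wt).
Proof.
apply/integrableP; split; first by apply/measurable_EFinP; exact: measurable_wt.
under eq_integral do rewrite /= ger0_norm ?wt_ge0//.
rewrite ge0_symfun_integralT//.
- rewrite -set_itvcy.
  by rewrite [X in (_ * X)%E](_ : _ = (pi / 2)%:E)%E ?integral0y_oneDsqr// ltry.
- exact: wt_ge0.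
- exact: continuous_wt.
- by move=> x /=; rewrite wtN.
Qed.

Lemma integrable_wtX k : mu.-integrable setT (fun x => (wt x ^+ k.+1)%:E).
Proof.
apply: le_integrable integrable_wt => //.
  by apply/measurable_EFinP; apply: measurable_funX; exact: measurable_wt.
move=> x _ /=; rewrite lee_fin normrX exprS ler_piMr//.
by rewrite exprn_ile1// ger0_norm ?wt_ge0// wt_le1.
Qed.

Definition wt_mass : R := \int[mu]_x wt x.

Lemma wt_mass_ge0 : 0 <= wt_mass.
Proof. by apply: Rintegral_ge0 => x _; exact: wt_ge0. Qed.

Lemma integrable_cst_wt (M : R) k : mu.-integrable setT (fun x => (M * wt x ^+ k.+1)%:E).
Proof.
under eq_fun do rewrite EFinM.
by apply: integrableZl => //; exact: integrable_wtX.
Qed.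

End Weight.

Section ComplexDerivative.
Variable R : realType.
Implicit Types (f g : R -> R[i]) (x : R).

Definition has_cderiv f x (d : R[i]) :=
  is_derive x 1 (fun y => Rec (f y)) (Rec d) /\
  is_derive x 1 (fun y => Imc (f y)) (Imc d).

Lemma has_cderivD f g x a b : has_cderiv f x a -> has_cderiv g x b ->
  has_cderiv (fun y => f y + g y) x (a + b).
Proof.
move=> [f1 f2] [g1 g2]; split.
  by under eq_fun do rewrite ReD; rewrite ReD; exact: is_deriveD.
by under eq_fun do rewrite ImD; rewrite ImD; exact: is_deriveD.
Qed.

Lemma has_cderivM f g x a b : has_cderiv f x a -> has_cderiv g x b ->
  has_cderiv (fun y => f y * g y) x (a * g x + f x * b).
Proof.
move=> [f1 f2] [g1 g2]; split.
  under eq_fun do rewrite ReM; apply: is_derive_eq.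
  by rewrite !reimE /GRing.scale /=; ring.
under eq_fun do rewrite ImM; apply: is_derive_eq.
by rewrite !reimE /GRing.scale /=; ring.
Qed.

Lemma has_cderiv_cst (z : R[i]) x : has_cderiv (fun=> z) x 0.
Proof. by split; exact: is_derive_cst. Qed.

Lemma has_cderivZ (z : R[i]) f x a : has_cderiv f x a ->
  has_cderiv (fun y => z * f y) x (z * a).
Proof.
move=> /(has_cderivM (has_cderiv_cst z x)); by rewrite mul0r add0r.
Qed.

Lemma has_cderiv_real (h : R -> R) x a : is_derive x 1 h a ->
  has_cderiv (fun y => (h y)%:C) x a%:C.
Proof. by move=> dh; split => //=; exact: is_derive_cst. Qed.

Lemma has_cderiv_expi (h : R -> R) x a : is_derive x 1 h a ->
  has_cderiv (fun y => expi (h y)) x (imag a * expi (h x)).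
Proof.
move=> dh; split; rewrite !reimE.
  by apply: (is_derive_eq (is_derive1_comp (is_derive_cos (h x)) dh)); ring.
by apply: (is_derive_eq (is_derive1_comp (is_derive_sin (h x)) dh)); ring.
Qed.


Definition ccontinuous f :=
  continuous (fun x => Rec (f x)) /\ continuous (fun x => Imc (f x)).

Lemma ccontinuousD f g : ccontinuous f -> ccontinuous g ->
  ccontinuous (fun x => f x + g x).
Proof.
move=> [f1 f2] [g1 g2]; split => x.
  rewrite (_ : (fun _ => _) = (fun x => Rec (f x) + Rec (g x))).
    by apply: (@continuousD _ _ _ (fun x => Rec (f x)) (fun x => Rec (g x)));
      [exact: f1|exact: g1].
  by apply/funext => y; rewrite ReD.
rewrite (_ : (fun _ => _) = (fun x => Imc (f x) + Imc (g x))).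
  by apply: (@continuousD _ _ _ (fun x => Imc (f x)) (fun x => Imc (g x)));
      [exact: f2|exact: g2].
by apply/funext => y; rewrite ImD.
Qed.

Lemma ccontinuousM f g : ccontinuous f -> ccontinuous g ->
  ccontinuous (fun x => f x * g x).
Proof.
move=> [f1 f2] [g1 g2]; split => x.
  rewrite (_ : (fun _ => _) = (fun x => Rec (f x) * Rec (g x) - Imc (f x) * Imc (g x))).
    by apply: (@continuousB _ _ _ (fun x => Rec (f x) * Rec (g x))
      (fun x => Imc (f x) * Imc (g x))); apply: continuousM;
      [exact: f1|exact: g1|exact: f2|exact: g2].
  by apply/funext => y; rewrite ReM.
rewrite (_ : (fun _ => _) = (fun x => Rec (f x) * Imc (g x) + Imc (f x) * Rec (g x))).
  by apply: (@continuousD _ _ _ (fun x => Rec (f x) * Imc (g x))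
      (fun x => Imc (f x) * Rec (g x))); apply: continuousM;
    [exact: f1|exact: g2|exact: f2|exact: g1].
by apply/funext => y; rewrite ImM.
Qed.

Lemma ccontinuous_cst (z : R[i]) : ccontinuous (fun=> z).
Proof. by split; exact: cst_continuous. Qed.

Lemma has_cderiv_continuous f d : (forall x, has_cderiv f x (d x)) -> ccontinuous f.
Proof.
move=> df; split => x; apply: differentiable_continuous; apply/derivable1_diffP.
  by case: (df x) => -[].
by case: (df x) => _ [].
Qed.

Lemma ccontinuous_cmfun f : ccontinuous f -> cmfun f.
Proof. by move=> [f1 f2]; split; exact: continuous_measurable_fun. Qed.

Lemma has_cderiv_cmfun f d : (forall x, has_cderiv f x (d x)) -> cmfun f.
Proof. by move=> /has_cderiv_continuous; exact: ccontinuous_cmfun. Qed.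

Lemma cderiv1E f x d : has_cderiv f x d -> cderiv 1 f x = d.
Proof.
by move=> [f1 f2]; rewrite /cderiv !derive1n1 !derive1E !derive_val; case: d {f1 f2}.
Qed.

Lemma cderiv_eq f d : (forall x, has_cderiv f x (d x)) -> cderiv 1 f = d.
Proof. by move=> df; apply/funext => x; exact: cderiv1E. Qed.

Lemma cderiv0 f : cderiv 0 f = f.
Proof. by apply/funext => x; exact: complex_eq. Qed.

Lemma cderivSn n f : cderiv n.+1 f = cderiv n (cderiv 1 f).
Proof. by apply/funext => x; rewrite /cderiv !derive1Sn. Qed.

End ComplexDerivative.

Section Schwartz.
Variable R : realType.
Implicit Types (f g phi : R -> R[i]).

(** A coinduction principle: in a class stable under derivation, decay of the members themselves
    gives decay of all derivatives. Each closure property of Schwartz functions then amounts to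
    exhibiting such a class, without a Leibniz formula of higher order. *)
Lemma schwartz_coind (K : (R -> R[i]) -> Prop) :
  (forall f, K f -> exists2 d, K d & forall x, has_cderiv f x (d x)) ->
  (forall f, K f -> forall m, exists M : R, forall x, `|x| ^+ m * normc (f x) <= M) ->
  forall f, K f -> schwartz f.
Proof.
move=> Kd Kb.
have Kn n f : K f -> K (cderiv n f).
  elim: n f => [|n IH] f Kf; first by rewrite cderiv0.
  have [d Kd' df] := Kd f Kf.
  by rewrite cderivSn (cderiv_eq df); exact: IH.
move=> f Kf; split => [n x|m n]; last exact: Kb (Kn n f Kf) m.
have [d _ /(_ x)[df1 df2]] := Kd _ (Kn n f Kf).
by split; [case: df1|case: df2].
Qed.

Lemma schwartz_has_cderiv f x : schwartz f -> has_cderiv f x (cderiv 1 f x).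
Proof.
move=> [+ _] => /(_ 0%N x)[f1 f2].
rewrite /cderiv !derive1n1 !derive1E.
by split; [exact: derivableP f1|exact: derivableP f2].
Qed.

Lemma schwartz_deriv f : schwartz f -> schwartz (cderiv 1 f).
Proof.
move=> [fs fb]; split => [n x|m n].
  by have := fs n.+1 x; rewrite !derive1Sn.
by rewrite -cderivSn; exact: fb.
Qed.

Lemma schwartz_bound f m : schwartz f ->
  exists M : R, forall x, `|x| ^+ m * normc (f x) <= M.
Proof. by move=> [_ /(_ m 0%N)]; rewrite cderiv0. Qed.

Lemma schwartzD f g : schwartz f -> schwartz g -> schwartz (fun x => f x + g x).
Proof.
move=> Sf Sg; pose K h := exists f g, [/\ schwartz f, schwartz g &
  h = fun x => f x + g x].
apply: (@schwartz_coind K); last by exists f, g.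
  move=> _ [u [v [Su Sv ->]]].
  exists (fun x => cderiv 1 u x + cderiv 1 v x).
    by exists (cderiv 1 u), (cderiv 1 v); split => //; exact: schwartz_deriv.
  by move=> x; apply: has_cderivD; exact: schwartz_has_cderiv.
move=> _ [u [v [Su Sv ->]]] m.
have [M HM] := schwartz_bound m Su; have [N HN] := schwartz_bound m Sv.
exists (M + N) => x; apply: le_trans (lerD (HM x) (HN x)).
by rewrite -mulrDr ler_wpM2l ?exprn_ge0// normcD.
Qed.

Lemma schwartzZ (z : R[i]) f : schwartz f -> schwartz (fun x => z * f x).
Proof.
move=> Sf; pose K h := exists2 f, schwartz f & h = fun x => z * f x.
apply: (@schwartz_coind K); last by exists f.
  move=> _ [u Su ->]; exists (fun x => z * cderiv 1 u x).
    by exists (cderiv 1 u) => //; exact: schwartz_deriv.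
  by move=> x; apply: has_cderivZ; exact: schwartz_has_cderiv.
move=> _ [u Su ->] m; have [M HM] := schwartz_bound m Su.
exists (normc z * M) => x.
by rewrite Normc.normcM mulrCA ler_wpM2l ?normc_ge0.
Qed.

Lemma schwartzX f : schwartz f -> schwartz (fun x => x%:C * f x).
Proof.
(* Since [(x f)' = f + x f'], the products [x f] alone are not stable under derivation; adding an
   arbitrary Schwartz term closes the class. *)
move=> Sf; pose K h := exists f g, [/\ schwartz f, schwartz g &
  h = fun x => x%:C * f x + g x].
have Kf : K (fun x => x%:C * f x).
  exists f, (fun x => 0 * f x); split => //; first exact: schwartzZ.
  by apply/funext => x; rewrite mul0r addr0.
apply: (@schwartz_coind K) Kf.
  move=> _ [u [v [Su Sv ->]]].
  exists (fun x => x%:C * cderiv 1 u x + (u x + cderiv 1 v x)).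
    exists (cderiv 1 u), (fun x => u x + cderiv 1 v x).
    by split => //; [|apply: schwartzD => //]; exact: schwartz_deriv.
  move=> x; rewrite addrA [x%:C * _ + u x]addrC.
  apply: has_cderivD; last exact: schwartz_has_cderiv.
  rewrite -[X in X + _]mul1r; apply: has_cderivM; last exact: schwartz_has_cderiv.
  exact: (has_cderiv_real (is_derive_id x 1)).
move=> _ [u [v [Su Sv ->]]] m.
have [M HM] := schwartz_bound m.+1 Su; have [N HN] := schwartz_bound m Sv.
exists (M + N) => x; apply: le_trans (lerD (HM x) (HN x)).
rewrite exprSr -mulrA -mulrDr ler_wpM2l ?exprn_ge0//.
by rewrite (le_trans (normcD _ _))// Normc.normcM normc_real.
Qed.

Lemma schwartz_cmfun f : schwartz f -> cmfun f.
Proof. by move=> Sf; apply: (@has_cderiv_cmfun _ f) => x; exact: schwartz_has_cderiv. Qed.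

Lemma schwartz_wt_bound f : schwartz f ->
  exists2 M : R, 0 <= M & forall x, normc (f x) <= M * wt x.
Proof.
move=> Sf; have [M HM] := schwartz_bound 0 Sf; have [N HN] := schwartz_bound 2 Sf.
have H x : normc (f x) <= (M + N) * wt x.
  rewrite ler_pdivlMr ?oneD_sqr_gt0// mulrC mulrDl mul1r lerD//.
    by have := HM x; rewrite expr0 mul1r.
  by have := HN x; rewrite real_normK ?num_real.
exists (M + N) => //.
by have := H 0; rewrite /wt expr0n addr0 invr1 mulr1; apply: le_trans; exact: normc_ge0.
Qed.

(* Iterates [schwartz_wt_bound] on [(1 + x ^ 2) ^ k f]. *)
Lemma schwartz_wtX_bound f k : schwartz f ->
  exists2 M : R, 0 <= M & forall x, normc (f x) <= M * wt x ^+ k.+1.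
Proof.
elim: k f => [|k IH] f Sf.
  by have [M M0 HM] := schwartz_wt_bound Sf; exists M.
have Sg : schwartz (fun x => f x + x%:C * (x%:C * f x)).
  by apply: schwartzD => //; do 2 apply: schwartzX.
have [M M0 HM] := IH _ Sg; exists M => // x.
rewrite exprSr mulrA ler_pdivlMr ?oneD_sqr_gt0//; apply: le_trans (HM x).
rewrite (_ : f x + _ = (1 + x ^+ 2)%:C * f x); last first.
  by rewrite rmorphD rmorphXn rmorph1; ring.
rewrite Normc.normcM normc_real ger0_norm; first by rewrite mulrC.
exact/ltW/oneD_sqr_gt0.
Qed.

Lemma schwartz_integrable f : schwartz f -> cintegrable setT f.
Proof.
move=> Sf; have [M M0 HM] := schwartz_wtX_bound 0 Sf.
apply: (cintegrable_dom _ (schwartz_cmfun Sf) (integrable_cst_wt M 0)) => //.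
Qed.

End Schwartz.

(** * Fourier inversion *)

Section UnderIntegral.
Variable R : realType.
Let mu := @lebesgue_measure R.

Lemma is_derive_Rintegral (f df : R -> R -> R) (G : R -> R) (a : R) :
  (forall x, mu.-integrable setT (EFin \o f x)) ->
  (forall x y : R, is_derive x 1 (f ^~ y) (df x y)) ->
  mu.-integrable setT (EFin \o G) -> (forall x y, `|df x y| <= G y) ->
  is_derive a 1 (fun x : R => \int[mu]_y f x y) (\int[mu]_y df a y).
Proof.
move=> fi fd Gi dfG.
have aI : `]a - 1, a + 1[%classic a.
  by rewrite /= in_itv /= ltrBlDr ltrDl ltr01.
have fd' (x y : R) : `]a - 1, a + 1[%classic x -> setT y -> derivable (f^~ y) x 1.
  by case: (fd x y).
have d1E (x y : R) : partial1of2 f x y = df x y by rewrite partial1of2E; exact: derive_val.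
have G0 y : 0 <= G y by rewrite (le_trans _ (dfG a y)).
have dG (x y : R) : `]a - 1, a + 1[%classic x -> setT y -> `|partial1of2 f x y| <= G y.
  by rewrite d1E.
have der := derivable_under_integral measurableT aI (fun x _ => fi x) fd' G0 Gi dG.
have dif := differentiation_under_integral measurableT aI (fun x _ => fi x) fd' G0 Gi dG.
apply: DeriveDef => //; rewrite -derive1E dif.
by apply: eq_Rintegral => y _.
Qed.

Lemma has_cderiv_cintegral (f df : R -> R -> R[i]) (G : R -> R) (a : R) :
  (forall x, cintegrable setT (f x)) ->
  (forall x y : R, has_cderiv (f ^~ y) x (df x y)) ->
  mu.-integrable setT (EFin \o G) -> (forall x y, normc (df x y) <= G y) ->
  has_cderiv (fun x : R => cintegral setT (f x)) a (cintegral setT (df a)).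
Proof.
move=> fi fd Gi dfG; split => /=.
  apply: (@is_derive_Rintegral (fun x y => Rec (f x y)) (fun x y => Rec (df x y)) G) => //.
  - by move=> x; case: (fi x).
  - by move=> x y; case: (fd x y).
  - by move=> x y; rewrite (le_trans (Re_le_normc _)).
apply: (@is_derive_Rintegral (fun x y => Imc (f x y)) (fun x y => Imc (df x y)) G) => //.
- by move=> x; case: (fi x).
- by move=> x y; case: (fd x y).
- by move=> x y; rewrite (le_trans (Im_le_normc _)).
Qed.

Lemma cvg_wt_nat (a : R) : a * wt (n%:R : R) @[n --> \oo] --> (0 : R).
Proof.
rewrite -[X in _ --> X](mulr0 a); apply: cvgMr.
have h : (harmonic n : R) @[n --> \oo] --> (0 : R) by exact: cvg_harmonic.
apply: (squeeze_cvgr _ (cvg_cst (0:R)) (_ : (n.+1%:R^-1 : R) *+ 2 @[n --> \oo] --> (0:R))).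
  apply: nearW => n; rewrite wt_ge0 /=.
  rewrite -[leRHS]mulr_natl ler_pdivlMr// mulrC ler_pdivrMr ?oneD_sqr_gt0//.
  by rewrite -natr1; nra.
rewrite -[X in _ --> X](mul0rn _ 2); exact: cvgMn.
Qed.

(** The fundamental theorem on [[-n, n]] leaves boundary terms that vanish by the bound with [wt],
    and dominated convergence gives the full integral. *)
Lemma Rintegral_derive0 (h dh : R -> R) (M : R) :
  (forall x : R, is_derive x 1 h (dh x)) -> continuous dh ->
  (forall x, `|h x| <= M * wt x) -> mu.-integrable setT (EFin \o dh) ->
  \int[mu]_x dh x = 0.
Proof.
move=> hd cdh hM idh.
have ch : continuous h.
  by move=> x; apply: differentiable_continuous; apply/derivable1_diffP; case: (hd x).
pose f_ (n : nat) x := (dh x * \1_(`[- n%:R, n%:R]%classic) x)%:E.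
have f_E n : (\int[mu]_x f_ n x = (h n%:R - h (- n%:R))%:E)%E.
  (* The interval is degenerate for [n = 0], where the fundamental theorem does not apply. *)
  rewrite /f_; case: n => [|n].
    rewrite oppr0 subrr (_ : (fun _ => _) = (EFin \o dh) \_ `[0, 0]%classic).
      by rewrite -integral_mkcond /= set_itv1 integral_set1.
    by apply/funext => x; rewrite patchE indicE /=; case: ifPn => _; rewrite ?mulr1 ?mulr0.
  rewrite (_ : (fun _ => _) = (EFin \o dh) \_ `[(- n.+1%:R), (n.+1%:R)]%classic); last first.
    by apply/funext => x; rewrite patchE indicE /=; case: ifPn => _; rewrite ?mulr1 ?mulr0.
  rewrite -integral_mkcond /= (@continuous_FTC2 _ _ h) ?EFinB//.
  - by rewrite (@lt_le_trans _ _ 0) ?oppr_lt0.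
  - exact: continuous_subspaceT.
  - split.
    + by move=> x _; case: (hd x).
    + by apply: cvg_at_right_filter; exact: ch.
    + by apply: cvg_at_left_filter; exact: ch.
  - by move=> x _; rewrite derive1E; exact: derive_val.
have cv1 : (\int[mu]_x f_ n x @[n --> \oo] --> \int[mu]_x (dh x)%:E)%E.
  have := @dominated_convergence _ _ R mu setT measurableT f_ (EFin \o dh) (fun x => `|dh x|%:E).
  case => //.
  - move=> n; apply/measurable_EFinP; apply: measurable_funM.
      exact: continuous_measurable_fun.
    exact: measurable_indic.
  - by case/integrableP : idh.
  - apply: aeW => x _.
    apply: cvg_near_cst.
    near=> n.
    rewrite /f_ indicE mem_set ?mulr1//= in_itv /= -ler_norml.
    near: n; exact: nbhs_infty_ger.
  - exact: integrable_norm idh.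
  - apply: aeW => x n _.
    rewrite /f_ /= lee_fin normrM indicE; case: (_ \in _); rewrite ?normr1 ?normr0 ?mulr1 ?mulr0//.
have cv2 : (\int[mu]_x f_ n x @[n --> \oo] --> (0:R)%:E)%E.
  rewrite (_ : (fun n => _) = (fun n => (h n%:R - h (- n%:R))%:E)); last by apply/funext.
  apply: cvg_EFin; first by apply: nearW.
  apply/norm_cvg0P.
  apply: (squeeze_cvgr _ (cvg_cst (0:R)) (cvg_wt_nat (M + M))).
  apply: nearW => n; rewrite normr_ge0 /= (le_trans (ler_normB _ _))//.
  by rewrite mulrDl lerD//; have := hM (- n%:R); rewrite ?wtN.
by rewrite /Rintegral -(cvg_lim _ cv1)// (cvg_lim _ cv2).
Unshelve. all: by end_near. Qed.

Lemma cintegral_derive0 (g d : R -> R[i]) (M : R) :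
  (forall x, has_cderiv g x (d x)) ->
  ccontinuous d ->
  (forall x, normc (g x) <= M * wt x) -> cintegrable setT d ->
  cintegral setT d = 0.
Proof.
move=> gd [c1 c2] gM [d1 d2]; apply: complex_eq.
  apply: (@Rintegral_derive0 (fun x => Rec (g x)) _ M) => //.
    by move=> x; case: (gd x).
  by move=> x; rewrite (le_trans (Re_le_normc _)).
apply: (@Rintegral_derive0 (fun x => Imc (g x)) _ M) => //.
  by move=> x; case: (gd x).
by move=> x; rewrite (le_trans (Im_le_normc _)).
Qed.

End UnderIntegral.

(** * The Fourier transform on Schwartz functions *)

Section FourierTransform.
Variable R : realType.
Let mu := @lebesgue_measure R.
Implicit Types (f g phi : R -> R[i]) (s x xi : R).

(* [ft (-1)] is the Fourier transform and [ft 1] is [2 pi] times its inverse. *)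
Definition ft s f xi : R[i] := cintegral setT (fun x => expi (s * (x * xi)) * f x).

Lemma fourierE f : fourier f = ft (-1) f.
Proof. by apply/funext => xi; apply: eq_cintegral => x _; rewrite mulN1r. Qed.

Lemma ifourierE f : ifourier f = fun x => ((2 * pi)^-1)%:C * ft 1 f x.
Proof.
apply/funext => x; congr (_ * _).
by apply: eq_cintegral => xi _; rewrite mul1r [x * xi]mulrC.
Qed.

Lemma cmfun_kernel s f xi : cmfun f -> cmfun (fun x => expi (s * (x * xi)) * f x).
Proof.
move=> mf; apply: cmfunM => //; apply: cmfun_expi.
apply: measurable_funM => //; exact: measurable_funM.
Qed.

Lemma normc_kernel s x xi (z : R[i]) : normc (expi (s * (x * xi)) * z) = normc z.
Proof. by rewrite Normc.normcM normc_expi mul1r. Qed.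

Lemma cintegrable_kernel s f xi (M : R) : cmfun f ->
  (forall x, normc (f x) <= M * wt x) ->
  cintegrable setT (fun x => expi (s * (x * xi)) * f x).
Proof.
move=> mf fM.
apply: (cintegrable_dom measurableT (cmfun_kernel s xi mf) (integrable_cst_wt M 0)) => x _.
by rewrite normc_kernel.
Qed.

Lemma Rintegral_cst_wt (M : R) : \int[mu]_x (M * wt x) = M * wt_mass R.
Proof. by rewrite RintegralZl//; exact: integrable_wt. Qed.

Lemma normc_ft_le s f xi (M : R) : cmfun f ->
  (forall x, normc (f x) <= M * wt x) -> normc (ft s f xi) <= 2 * (M * wt_mass R).
Proof.
move=> mf fM; rewrite -Rintegral_cst_wt.
apply: (normc_cintegral_le measurableT (cmfun_kernel s xi mf) (integrable_cst_wt M 0)) => x _.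
by rewrite normc_kernel.
Qed.

Lemma cmfun_ft s f : cmfun f -> cmfun (ft s f).
Proof.
move=> mf; apply: (@cmfun_cintegral R _ _ (fun z => expi (s * (z.2 * z.1)) * f z.2)) => //.
apply: cmfunM; last exact: cmfun_comp mf _.
apply: cmfun_expi; apply: measurable_funM => //.
exact: measurable_funM.
Qed.

Lemma schwartz_kernel_integrable s f xi : schwartz f ->
  cintegrable setT (fun x => expi (s * (x * xi)) * f x).
Proof.
move=> Sf; have [M _ HM] := schwartz_wt_bound Sf.
exact: cintegrable_kernel (schwartz_cmfun Sf) HM.
Qed.

Lemma schwartz_ft_bounded s f : schwartz f ->
  exists2 M : R, 0 <= M & forall xi, normc (ft s f xi) <= M.
Proof.
move=> Sf; have [M M0 HM] := schwartz_wt_bound Sf.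
exists (2 * (M * wt_mass R)); first by rewrite !mulr_ge0// wt_mass_ge0.
by move=> xi; exact: normc_ft_le (schwartz_cmfun Sf) HM.
Qed.

Lemma ftZ s (z : R[i]) f xi : cintegrable setT (fun x => expi (s * (x * xi)) * f x) ->
  ft s (fun x => z * f x) xi = z * ft s f xi.
Proof.
by move=> fi; rewrite -cintegralM//; apply: eq_cintegral => x _; rewrite mulrCA.
Qed.

Lemma has_cderiv_ft s f xi : schwartz f ->
  has_cderiv (ft s f) xi (imag s * ft s (fun x => x%:C * f x) xi).
Proof.
move=> Sf; have Sxf := schwartzX Sf.
rewrite -ftZ; last exact: schwartz_kernel_integrable.
have Sg := schwartzZ (imag s) Sxf.
have [M M0 HM] := schwartz_wt_bound Sg.
apply: (@has_cderiv_cintegral R (fun xi x => expi (s * (x * xi)) * f x)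
  (fun xi x => expi (s * (x * xi)) * (imag s * (x%:C * f x))) (fun x => M * wt x ^+ 1)).
- by move=> x; exact: schwartz_kernel_integrable.
- move=> eta x; rewrite [X in has_cderiv _ _ X](_ : _ =
    imag (s * x) * expi (s * (x * eta)) * f x + expi (s * (x * eta)) * 0); last first.
    by apply: complex_eq; rewrite !reimE; ring.
  apply: has_cderivM; last exact: has_cderiv_cst.
  apply: (@has_cderiv_expi _ (fun y => s * (x * y))).
  apply: is_derive_eq; rewrite /GRing.scale /=; ring.
- exact: integrable_cst_wt.
- by move=> eta x; rewrite normc_kernel expr1.
Qed.

Lemma schwartz_continuous f : schwartz f ->
  ccontinuous f.
Proof. by move=> Sf; apply: (@has_cderiv_continuous _ f) => x; exact: schwartz_has_cderiv. Qed.

(** Integration by parts, in the form that the derivative of the kernel times [f] has integral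
    zero. *)
Lemma ft_cderiv s f xi : schwartz f ->
  ft s (cderiv 1 f) xi = - imag (s * xi) * ft s f xi.
Proof.
move=> Sf; have Sd := schwartz_deriv Sf.
have [M M0 HM] := schwartz_wt_bound Sf.
pose e x := expi (s * (x * xi)).
have de (x : R) : has_cderiv e x (imag (s * xi) * e x).
  apply: (@has_cderiv_expi _ (fun x => s * (x * xi))).
  apply: is_derive_eq; rewrite /GRing.scale /=; ring.
have ce : ccontinuous e by exact: has_cderiv_continuous de.
have i1 : cintegrable setT (fun x => imag (s * xi) * (e x * f x)).
  by apply: cintegrableM => //; exact: schwartz_kernel_integrable.
have i2 : cintegrable setT (fun x => e x * cderiv 1 f x).
  exact: schwartz_kernel_integrable.
have := @cintegral_derive0 R (fun x => e x * f x)
  (fun x => imag (s * xi) * (e x * f x) + e x * cderiv 1 f x) M.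
rewrite cintegralD// cintegralM//; last exact: schwartz_kernel_integrable.
rewrite -[cintegral _ (fun x => e x * f x)]/(ft s f xi).
rewrite -[cintegral _ (fun x => e x * _)]/(ft s (cderiv 1 f) xi).
move=> H; apply/eqP; rewrite mulNr -addr_eq0 addrC; apply/eqP; apply: H.
- move=> x; rewrite mulrA; apply: has_cderivM => //; exact: schwartz_has_cderiv.
- apply: ccontinuousD; last by apply: ccontinuousM ce _; exact: schwartz_continuous.
  apply: ccontinuousM; first exact: ccontinuous_cst.
  by apply: ccontinuousM ce _; exact: schwartz_continuous.
- by move=> x; rewrite normc_kernel.
- exact: cintegrableD.
Qed.

Lemma schwartz_ft s f : s != 0 -> schwartz f -> schwartz (ft s f).
Proof.
move=> s0 Sf; pose K h := exists2 f, schwartz f & h = ft s f.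
apply: (@schwartz_coind R K); last by exists f.
  move=> _ [u Su ->]; exists (ft s (fun x => imag s * (x%:C * u x))).
    by exists (fun x => imag s * (x%:C * u x)) => //; apply/schwartzZ/schwartzX.
  move=> x; rewrite ftZ; first exact: has_cderiv_ft.
  exact/schwartz_kernel_integrable/schwartzX.
(* Each power of the frequency is traded for one derivative of [u] by [ft_cderiv], at the price of a
   factor [1 / |s|]. *)
move=> _ [u Su ->] m; elim: m u Su => [|m IH] u Su.
  have [M _ HM] := schwartz_ft_bounded s Su.
  by exists M => x; rewrite expr0 mul1r.
have [M HM] := IH _ (schwartz_deriv Su).
exists (`|s|^-1 * M) => x; rewrite ler_pdivlMl ?normr_gt0//.
apply: le_trans (HM x); rewrite ft_cderiv// Normc.normcM.
rewrite [normc (- _)](_ : _ = `|s| * `|x|); last first.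
  by rewrite normcN normc_imag normrM.
by rewrite exprS; lra.
Qed.

End FourierTransform.

(** * Gaussians and their Fourier transforms *)

Section Gaussian.
Variable R : realType.
Let mu := @lebesgue_measure R.
Implicit Types (a s x xi : R).

Definition gauss a x : R := expR (- (a * x ^+ 2)).

Lemma is_derive_gauss a x : is_derive x 1 (gauss a) (- (2 * a * x) * gauss a x).
Proof.
have d : is_derive x 1 (fun x : R => - (a * x ^+ 2)) (- (2 * a * x)).
  by apply: is_derive_eq; rewrite /GRing.scale /=; ring.
by apply: (is_derive_eq (is_derive1_comp (is_derive_expR _) d)); rewrite mulrC.
Qed.

Lemma measurable_gauss a : measurable_fun setT (gauss a).
Proof.
apply: continuous_measurable_fun => x; apply: differentiable_continuous.
by apply/derivable1_diffP; case: (is_derive_gauss a x).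
Qed.

Lemma gauss_bound a (m : nat) : 0 < a ->
  exists M : R, forall x, `|x| ^+ m * gauss a x <= M.
Proof.
(* With [a x^2 = k y], the exponential of [k y] dominates [(1 + y)^k], and [c] is such that
   [1 + x^2 <= c (1 + y)]. Taking [k = m + 1] keeps the division by [k] meaningful for [m = 0]. *)
move=> a0; pose k := m.+1; pose c : R := 1 + k%:R / a.
have c1 : 1 <= c by rewrite lerDl divr_ge0// ltW.
have c0 : 0 <= c := le_trans ler01 c1.
exists (c ^+ k) => x.
pose y := a * x ^+ 2 / k%:R.
have y0 : 0 <= y by rewrite divr_ge0// mulr_ge0 ?sqr_ge0// ltW.
have h1 : 1 + x ^+ 2 <= c * (1 + y).
  have : x ^+ 2 = y * (k%:R / a) by rewrite /y; field; rewrite gt_eqF//= pnatr_eq0.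
  move=> {1}->; rewrite /c; have : 0 <= k%:R / a by rewrite divr_ge0// ltW.
  by nra.
have h2 : `|x| <= 1 + x ^+ 2 by rewrite -[x ^+ 2]real_normK ?num_real//; nra.
rewrite /gauss expRN -ler_pdivlMr ?invr_gt0 ?expR_gt0// invrK.
apply: (@le_trans _ _ ((1 + x ^+ 2) ^+ k)).
  apply: (@le_trans _ _ ((1 + x ^+ 2) ^+ m)); first by rewrite lerXn2r ?nnegrE// addr_ge0// sqr_ge0.
  by rewrite [leRHS]exprS ler_peMl ?exprn_ge0 ?addr_ge0 ?sqr_ge0// lerDl sqr_ge0.
have -> : a * x ^+ 2 = k%:R * y by rewrite /y; field; rewrite pnatr_eq0.
rewrite expRM_natl -exprMn lerXn2r ?nnegrE ?mulr_ge0 ?expR_ge0 ?c0 ?(addr_ge0 ler01) ?sqr_ge0//.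
by apply: (le_trans h1); rewrite ler_wpM2l ?expR_ge1Dx.
Qed.

(** Polynomials times a Gaussian, presented by the operations that differentiation produces: the
    class used for coinduction. *)
Inductive gauss_span a : (R -> R[i]) -> Prop :=
| GaussBase : gauss_span a (fun x => (gauss a x)%:C)
| GaussX f : gauss_span a f -> gauss_span a (fun x => x%:C * f x)
| GaussZ z f : gauss_span a f -> gauss_span a (fun x => z * f x)
| GaussD f g : gauss_span a f -> gauss_span a g -> gauss_span a (fun x => f x + g x).

Lemma schwartz_gauss a : 0 < a -> schwartz (fun x => (gauss a x)%:C).
Proof.
move=> a0; apply: (@schwartz_coind R (gauss_span a)); last exact: GaussBase.
  move=> f; elim=> {f} [|f Kf [d Kd df]|z f _ [d Kd df]|f g _ [d Kd df] _ [d' Kd' df']].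
  - exists (fun x => (- (2 * a))%:C * (x%:C * (gauss a x)%:C)).
      exact/GaussZ/GaussX/GaussBase.
    move=> x; rewrite -!rmorphM.
    by apply: has_cderiv_real; apply: (is_derive_eq (is_derive_gauss a x)); ring.
  - exists (fun x => 1 * f x + x%:C * d x).
      by apply: GaussD; [exact: GaussZ|exact: GaussX].
    move=> x; apply: has_cderivM => //.
    exact: (has_cderiv_real (is_derive_id x 1)).
  - exists (fun x => z * d x); first exact: GaussZ.
    by move=> x; exact: has_cderivZ.
  - exists (fun x => d x + d' x); first exact: GaussD.
    by move=> x; exact: has_cderivD.
move=> f; elim=> {f} [|f _ IH|z f _ IH|f g _ IH _ IH'] m.
- have [M HM] := gauss_bound m a0; exists M => x.
  by rewrite normc_real [`|gauss _ _|]ger0_norm ?expR_ge0.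
- have [M HM] := IH m.+1; exists M => x.
  by rewrite Normc.normcM normc_real mulrA -exprSr.
- have [M HM] := IH m; exists (normc z * M) => x.
  by rewrite Normc.normcM mulrCA ler_wpM2l ?normc_ge0.
- have [M HM] := IH m; have [N HN] := IH' m.
  exists (M + N) => x; apply: le_trans (lerD (HM x) (HN x)).
  by rewrite -mulrDr ler_wpM2l ?exprn_ge0// normcD.
Qed.

Lemma integrable_gauss a : 0 < a -> mu.-integrable setT (EFin \o gauss a).
Proof. by move=> a0; have [] := schwartz_integrable (schwartz_gauss a0). Qed.

(** Read off from the total mass of the centred normal density of variance [1 / (2 a)]. *)
Lemma Rintegral_gauss a : 0 < a -> \int[mu]_x gauss a x = Num.sqrt (pi / a).
Proof.
move=> a0; pose sg : R := Num.sqrt (2 * a)^-1.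
have a20 : 0 < (2 * a)^-1 :> R by rewrite invr_gt0 mulr_gt0.
have sg0 : sg != 0 by rewrite gt_eqF// sqrtr_gt0.
have sg2 : sg ^+ 2 *+ 2 = a^-1.
  by rewrite sqr_sqrtr ?ltW// -mulr_natl invfM mulrA divff ?pnatr_eq0// mul1r.
have E x : normal_pdf 0 sg x = (Num.sqrt (pi / a))^-1 * gauss a x.
  rewrite /normal_pdf (negbTE sg0) /normal_peak /normal_fun /gauss subr0 sg2 invrK.
  rewrite -mulrnAl sg2 [pi / a]mulrC; congr (_ * expR _); ring.
have s0 : 0 < Num.sqrt (pi / a) by rewrite sqrtr_gt0 divr_gt0// pi_gt0.
have := integral_normal_pdf 0 sg.
under eq_integral do rewrite E EFinM.
rewrite integralZl//; last exact: integrable_gauss.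
rewrite -[(\int[mu]_x _)%E]fineK; last exact: integrable_fin_num (integrable_gauss a0).
move=> [] /eqP; rewrite -[fine _]/(\int[mu]_x gauss a x) mulrC => /eqP H.
by rewrite -[RHS]mul1r -H -mulrA mulVf ?mulr1// gt_eqF.
Qed.

(** The Gaussian satisfies [g' = -2 a x g]; its transform therefore solves a linear equation of
    first order in the frequency. Multiplication by the integrating factor [gauss (- c)] gives a
    constant [p], whose value at 0 is the Gaussian integral. *)
Lemma ft_gauss a s xi : 0 < a ->
  ft s (fun x => (gauss a x)%:C) xi =
  (Num.sqrt (pi / a) * gauss (s ^+ 2 / (4 * a)) xi)%:C.
Proof.
move=> a0; pose g x : R[i] := (gauss a x)%:C.
have Sg : schwartz g by exact: schwartz_gauss.
have dg : cderiv 1 g = fun x => (- (2 * a))%:C * (x%:C * g x).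
  apply: cderiv_eq => x; rewrite /g -!rmorphM.
  by apply: has_cderiv_real; apply: (is_derive_eq (is_derive_gauss a x)); ring.
have dftg (y : R) : has_cderiv (ft s g) y ((- (s ^+ 2 / (2 * a) * y))%:C * ft s g y).
  suff -> : (- (s ^+ 2 / (2 * a) * y))%:C * ft s g y =
      imag s * ft s (fun x => x%:C * g x) y by exact: has_cderiv_ft.
  have : (- (2 * a))%:C * ft s (fun x => x%:C * g x) y = - imag (s * y) * ft s g y.
    rewrite -ft_cderiv// dg ftZ//.
    exact/schwartz_kernel_integrable/schwartzX.
  move=> H; have a20 : (- (2 * a))%:C != 0 :> R[i].
    by rewrite fmorph_eq0 oppr_eq0 mulf_neq0 ?pnatr_eq0// gt_eqF.
  apply: (mulfI a20); rewrite [RHS]mulrCA H.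
  set z := ft s g y; apply: complex_eq; rewrite !reimE; field; by rewrite gt_eqF.
pose c := s ^+ 2 / (4 * a).
pose p y := (gauss (- c) y)%:C * ft s g y.
have dp (y : R) : has_cderiv p y 0.
  suff -> : 0 = (- (2 * (- c) * y) * gauss (- c) y)%:C * ft s g y +
     (gauss (- c) y)%:C * ((- (s ^+ 2 / (2 * a) * y))%:C * ft s g y).
    apply: has_cderivM => //; apply: has_cderiv_real; exact: is_derive_gauss.
  set z := ft s g y; apply: complex_eq; rewrite !reimE /c; field; by rewrite gt_eqF.
have pE : p xi = p 0.
  apply: complex_eq.
    by apply: (@is_derive_0_is_cst _ (fun y => Rec (p y))) => y; case: (dp y).
  by apply: (@is_derive_0_is_cst _ (fun y => Imc (p y))) => y; case: (dp y).
have ft0 : ft s g 0 = (Num.sqrt (pi / a))%:C.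
  rewrite -Rintegral_gauss//; apply: complex_eq => /=.
    by apply: eq_Rintegral => x _; rewrite !mulr0 cos0 subr0 mul1r.
  rewrite (_ : (fun x => _) = cst 0); last first.
    by apply/funext => x; rewrite !mulr0 sin0 mul0r addr0.
  by rewrite /Rintegral integral0.
have gE y : (gauss c y)%:C * (gauss (- c) y)%:C = 1 :> R[i].
  rewrite -rmorphM /gauss -expRD (_ : _ + _ = 0) ?expR0//; ring.
rewrite -[LHS]mul1r -(gE xi) -mulrA -/(p xi) pE /p ft0 /gauss.
by rewrite expr0n !mulr0 oppr0 expR0 mul1r mulrC -rmorphM.
Qed.

End Gaussian.

(** * The inversion formula *)

Section Inversion.
Variable R : realType.
Let mu := @lebesgue_measure R.
Implicit Types (x y z xi s e : R) (f : R -> R[i]).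

Lemma integrable_scale (k : R) (h : R -> R) : mu.-integrable setT (EFin \o h) ->
  mu.-integrable setT (EFin \o (fun x => k * h x)).
Proof.
move=> ih; rewrite (_ : EFin \o _ = fun x => (k%:E * (EFin \o h) x)%E)//.
exact: integrableZl.
Qed.

Lemma lipschitz_derive_bound (h dh : R -> R) (M : R) (x y : R) :
  (forall x : R, is_derive x 1 h (dh x)) -> (forall x, `|dh x| <= M) ->
  `|h y - h x| <= M * `|y - x|.
Proof.
move=> hd hM; wlog xy : x y / x <= y.
  move=> H; have [|/ltW] := leP x y; first exact: H.
  by rewrite distrC [`|y - x|]distrC; exact: H.
have ch : continuous h.
  by move=> z; apply: differentiable_continuous; apply/derivable1_diffP; case: (hd z).
have [z _ ->] := MVT_segment xy (fun z _ => hd z) (continuous_subspaceT ch).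
by rewrite normrM ler_wpM2r.
Qed.

Lemma schwartz_lipschitz f : schwartz f -> exists2 L : R, 0 <= L &
  forall x y, normc (f y - f x) <= L * `|y - x|.
Proof.
move=> Sf; have [M HM] := schwartz_bound 0 (schwartz_deriv Sf).
have M0 : 0 <= M by rewrite (le_trans _ (HM 0))// expr0 mul1r normc_ge0.
exists (M + M); first exact: addr_ge0.
have {}HM x : normc (cderiv 1 f x) <= M by have := HM x; rewrite expr0 mul1r.
move=> x y; rewrite (le_trans (normc_le_ReIm _))// ReB ImB mulrDl lerD//.
  apply: (@lipschitz_derive_bound (fun x => Rec (f x)) (fun x => Rec (cderiv 1 f x))).
    by move=> z; case: (schwartz_has_cderiv z Sf).
  by move=> z; rewrite (le_trans (Re_le_normc _)).
apply: (@lipschitz_derive_bound (fun x => Imc (f x)) (fun x => Imc (cderiv 1 f x))).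
  by move=> z; case: (schwartz_has_cderiv z Sf).
by move=> z; rewrite (le_trans (Im_le_normc _)).
Qed.

Lemma le0_small (a C : R) : 0 <= C ->
  (forall e, 0 < e -> e <= 1 -> a <= C * e) -> a <= 0.
Proof.
move=> C0 H; rewrite leNgt; apply/negP => a0.
have C1 : 0 < 2 * (C + 1) by lra.
have [|h] := leP (a / (2 * (C + 1))) 1.
  have e0 : 0 < a / (2 * (C + 1)) by rewrite divr_gt0.
  move=> /(H _ e0); rewrite mulrA ler_pdivlMr//; nra.
have := H 1 ltr01 (lexx _); move: h; rewrite ltr_pdivlMr//; nra.
Qed.

Lemma gauss_sub1 a x : 0 <= a -> `|gauss a x - 1| <= a * x ^+ 2.
Proof.
move=> a0; have h : 0 <= a * x ^+ 2 by rewrite mulr_ge0// sqr_ge0.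
have g1 : gauss a x <= 1 by rewrite /gauss -expR0 ler_expR oppr_le0.
have := expR_ge1Dx (- (a * x ^+ 2)); rewrite -/(gauss a x) => g2.
rewrite ler0_norm; lra.
Qed.

(** The Gaussian damping makes the double integral absolutely convergent. After Fubini, [f] is
    integrated against the transform of a Gaussian, an approximate identity of mass [2 pi]. *)
Lemma gauss_regularization s f x e : 0 < e -> s ^+ 2 = 1 -> schwartz f ->
  ft (- s) (fun xi => (gauss (e ^+ 2) xi)%:C * ft s f xi) x =
  cintegral setT (fun z =>
    (Num.sqrt (pi / e ^+ 2) * gauss (4 * e ^+ 2)^-1 z)%:C * f (z + x)).
Proof.
move=> e0 s2 Sf; set a := e ^+ 2; have a0 : 0 < a by rewrite exprn_gt0.
have Sg := schwartz_gauss a0.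
have [M M0 HM] := schwartz_wt_bound Sf; have [N N0 HN] := schwartz_wt_bound Sg.
have mf := schwartz_cmfun Sf.
pose F (z : R * R) := expi (- s * (z.1 * x)) * (gauss a z.1)%:C *
  (expi (s * (z.2 * z.1)) * f z.2).
transitivity (cintegral setT (fun xi => cintegral setT (fun y => F (xi, y)))).
  apply: eq_cintegral => xi _; rewrite mulrA -cintegralM//.
  exact: schwartz_kernel_integrable.
rewrite (@cfubini R F (fun xi y => N * wt xi ^+ 1 * (M * wt y ^+ 1))
  (fun xi => M * wt_mass R * N * wt xi ^+ 1)).
- transitivity (cintegral setT (fun y =>
     (Num.sqrt (pi / a) * gauss (4 * a)^-1 (y - x))%:C * f y)).
    apply: eq_cintegral => y _.
    rewrite (_ : (fun x0 => _) = fun xi => f y *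
        (expi (s * (xi * (y - x))) * (gauss a xi)%:C)); last first.
      apply/funext => xi; rewrite /F /=.
      rewrite (_ : s * (xi * (y - x)) = - s * (xi * x) + s * (y * xi)); last by ring.
      rewrite expiD; ring.
    rewrite cintegralM//; last exact: schwartz_kernel_integrable.
    by rewrite -/(ft s _ (y - x)) ft_gauss// s2 mul1r mulrC.
  rewrite -(cintegral_shift x).
    by apply: eq_cintegral => z _; rewrite addrK.
  apply: cmfunM => //; apply: cmfun_real.
  apply: measurable_funM => //; apply: measurableT_comp; first exact: measurable_gauss.
  exact: measurable_funB.
- apply: cmfunM.
    apply: cmfunM; last exact: cmfun_comp (schwartz_cmfun Sg) _.
    apply: cmfun_expi; apply: measurable_funM => //; exact: measurable_funM.
  apply: cmfunM; last exact: cmfun_comp mf _.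
  apply: cmfun_expi; apply: measurable_funM => //; exact: measurable_funM.
- exact: integrable_cst_wt.
- move=> xi; under eq_fun do rewrite mulrA.
  exact: integrable_cst_wt.
- move=> xi y; rewrite /F !Normc.normcM !normc_expi !mul1r !expr1.
  by rewrite ler_pM ?normc_ge0.
- move=> xi; under eq_Rintegral do rewrite mulrA expr1.
  rewrite Rintegral_cst_wt expr1; lra.
Qed.

Lemma ft_inversion s f x : s ^+ 2 = 1 -> schwartz f ->
  ft (- s) (ft s f) x = (2 * pi)%:C * f x.
Proof.
move=> s2 Sf.
have s0 : s != 0 by apply/eqP => s0; move: s2; rewrite s0 expr0n /= => /eqP; rewrite eq_sym oner_eq0.
have SF := schwartz_ft s0 Sf.
have [M M0 HM] := schwartz_wtX_bound 1 SF.
have [L L0 HL] := schwartz_lipschitz Sf.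
have W0 := wt_mass_ge0 R.
pose C1 := 2 * (M * wt_mass R).
pose C2 := 2 * (L * (2 * Num.sqrt pi) * Num.sqrt (8 * pi)).
have C10 : 0 <= C1 by rewrite !mulr_ge0.
have C20 : 0 <= C2 by rewrite !mulr_ge0.
apply/eqP; rewrite -subr_eq0; apply/eqP; apply: normc0_eq.
apply: (@le0_small _ (C1 + C2)); first exact: addr_ge0.
move=> e e0 e1.
have e20 : 0 < e ^+ 2 by rewrite exprn_gt0.
pose A := ft (- s) (fun xi => (gauss (e ^+ 2) xi)%:C * ft s f xi) x.
have mg (a : R) : cmfun (fun xi => (gauss a xi)%:C : R[i]).
  by apply: cmfun_real; exact: measurable_gauss.
have mF := schwartz_cmfun SF.
(* Removing the damping: [1 - gauss] is at most [e^2 y^2], and [y^2] is paid for by one of the two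
   powers of [wt] that bound the transform of [f]. *)
have step1 : normc (ft (- s) (ft s f) x - A) <= C1 * e.
  have i1 : cintegrable setT (fun y => expi (- s * (y * x)) * ft s f y).
    exact: schwartz_kernel_integrable.
  have bd (a xi : R) : 0 <= a -> normc ((gauss a xi)%:C * ft s f xi) <= M * wt xi.
    move=> a0; rewrite Normc.normcM normc_real ger0_norm ?expR_ge0//.
    rewrite -[leRHS]mul1r ler_pM ?expR_ge0 ?normc_ge0//.
      by rewrite /gauss -expR0 ler_expR oppr_le0 mulr_ge0// sqr_ge0.
    apply: le_trans (HM xi) _; rewrite expr2 mulrA ler_piMr ?wt_le1//.
    by rewrite mulr_ge0// wt_ge0.
  have i2 : cintegrable setT
      (fun y => expi (- s * (y * x)) * ((gauss (e ^+ 2) y)%:C * ft s f y)).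
    by apply: (cintegrable_kernel _ _ (cmfunM (mg _) mF) (fun y => bd _ y (ltW e20))).
  rewrite /A /ft -cintegralB//.
  apply: le_trans (normc_cintegral_le (h := fun y => e * M * wt y ^+ 1) measurableT _ _ _) _.
  - apply: cmfunB; apply: cmfun_kernel => //; exact: cmfunM.
  - exact: integrable_cst_wt.
  - move=> y _; rewrite -mulrBr normc_kernel.
    rewrite -/(ft s f y) (_ : _ - _ = (1 - gauss (e ^+ 2) y)%:C * ft s f y); last first.
      by rewrite rmorphB rmorph1; ring.
    rewrite Normc.normcM normc_real distrC.
    apply: (@le_trans _ _ (e ^+ 2 * y ^+ 2 * (M * wt y ^+ 2))).
      by rewrite ler_pM ?normc_ge0// gauss_sub1// ltW.
    have yw : y ^+ 2 * wt y <= 1.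
      by rewrite ler_pdivrMr ?oneD_sqr_gt0// mul1r lerDr.
    rewrite (_ : _ * _ = (e ^+ 2 * M * wt y) * (y ^+ 2 * wt y)); last by ring.
    apply: le_trans (ler_piMr _ yw) _; first by rewrite !mulr_ge0 ?wt_ge0 ?(ltW e0).
    rewrite expr1 ler_wpM2r ?wt_ge0// ler_wpM2r//.
    by rewrite expr2 ler_piMr// ltW.
  - under eq_Rintegral do rewrite expr1.
    by rewrite Rintegral_cst_wt /C1; lra.
have step2 : normc (A - (2 * pi)%:C * f x) <= C2 * e.
  (* [b] is half of [a]: the factor [|z|] left by the Lipschitz bound costs half of the Gaussian
     exponent, and the mass of the remaining Gaussian supplies the factor [e]. *)
  set a := (4 * e ^+ 2)^-1; set b := (8 * e ^+ 2)^-1.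
  have a0 : 0 < a by rewrite invr_gt0 mulr_gt0.
  have b0 : 0 < b by rewrite invr_gt0 mulr_gt0.
  pose c := Num.sqrt (pi / e ^+ 2).
  have cE : c = Num.sqrt pi / e by rewrite /c sqrtrM ?pi_ge0// sqrtrV ?ltW// sqrtr_sqr gtr0_norm.
  have k0 z : 0 <= c * gauss a z by rewrite mulr_ge0 ?sqrtr_ge0// expR_ge0.
  have ik : mu.-integrable setT (fun z => (c * gauss a z)%:E).
    by apply: integrable_scale; exact: integrable_gauss.
  have Ik : \int[mu]_z (c * gauss a z) = 2 * pi.
    rewrite RintegralZl//; last exact: integrable_gauss.
    rewrite Rintegral_gauss// /c -sqrtrM ?divr_ge0 ?pi_ge0 ?ltW//.
    rewrite (_ : pi / e ^+ 2 * (pi / a) = (2 * pi) ^+ 2) ?sqrtr_sqr ?ger0_norm ?mulr_ge0 ?pi_ge0//.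
    by rewrite /a; field; rewrite gt_eqF.
  have mk : cmfun (fun z => (c * gauss a z)%:C : R[i]).
    by apply: cmfun_real; apply: measurable_funM => //; exact: measurable_gauss.
  have mfx : cmfun (fun z => f (z + x)).
    by apply: cmfun_comp (schwartz_cmfun Sf) _; exact: measurable_funD.
  have [B B0 HB] := schwartz_wt_bound Sf.
  have i1 : cintegrable setT (fun z => (c * gauss a z)%:C * f (z + x)).
    apply: (cintegrable_dom (h := fun z => B * (c * gauss a z)) measurableT).
    - exact: cmfunM.
    - exact: integrable_scale.
    - move=> z _; rewrite Normc.normcM normc_real ger0_norm// mulrC ler_wpM2r//.
      by rewrite (le_trans (HB _))// ler_piMr// wt_le1.
  have i2 : cintegrable setT (fun z => (c * gauss a z)%:C * f x).
    under eq_fun do rewrite mulrC; apply: cintegrableM => //.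
    apply: (cintegrable_dom (h := fun z => c * gauss a z) measurableT) => // z _.
    by rewrite normc_real ger0_norm.
  have -> : (2 * pi)%:C * f x = cintegral setT (fun z => (c * gauss a z)%:C * f x).
    under [in RHS]eq_fun do rewrite mulrC.
    rewrite cintegralM//; last first.
      apply: (cintegrable_dom (h := fun z => c * gauss a z) measurableT) => // z _.
      by rewrite normc_real ger0_norm.
    rewrite mulrC; congr (_ * _); apply: complex_eq; rewrite /= ?Ik//.
    by rewrite /Rintegral integral0.
  rewrite /A gauss_regularization// -cintegralB//.
  apply: le_trans (normc_cintegral_le
    (h := fun z => L * (2 * Num.sqrt pi) * gauss b z) measurableT _ _ _) _.
  - by apply: cmfunB; apply: cmfunM => //; exact: cmfun_cst.
  - by apply: integrable_scale; exact: integrable_gauss.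
  - move=> z _; rewrite -mulrBr Normc.normcM normc_real ger0_norm ?k0//.
    apply: (@le_trans _ _ (c * gauss a z * (L * `|z|))).
      by rewrite ler_wpM2l// (le_trans (HL _ _))// addrK.
    have zb : `|z| <= 2 * e * expR (b * z ^+ 2).
      apply: (@le_trans _ _ (2 * e * (1 + b * z ^+ 2))).
        rewrite -[z ^+ 2]real_normK ?num_real// /b.
        set u := `|z|; rewrite (_ : 2 * e * _ = (8 * e ^+ 2 + u ^+ 2) / (4 * e)); last first.
          by field; rewrite gt_eqF.
        rewrite ler_pdivlMr ?mulr_gt0//; have := sqr_ge0 (u - 2 * e); nra.
      by rewrite ler_wpM2l ?expR_ge1Dx// mulr_ge0// ltW.
    have gg : gauss a z * expR (b * z ^+ 2) = gauss b z.
      rewrite /gauss -expRD; congr expR; rewrite /a /b; field; by rewrite gt_eqF.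
    rewrite -gg; rewrite (_ : c * gauss a z * (L * `|z|) = (L * c * gauss a z) * `|z|); last by ring.
    rewrite (le_trans (ler_wpM2l _ zb)) ?mulr_ge0 ?sqrtr_ge0 ?expR_ge0//.
    by rewrite cE le_eqVlt; apply/orP; left; apply/eqP; field; rewrite gt_eqF.
  - rewrite RintegralZl//; last exact: integrable_gauss.
    rewrite Rintegral_gauss// /b invrK /C2.
    rewrite (_ : Num.sqrt (pi * _) = Num.sqrt (8 * pi) * e); first by lra.
    rewrite (_ : pi * _ = 8 * pi * e ^+ 2); last by ring.
    by rewrite sqrtrM ?mulr_ge0 ?pi_ge0// sqrtr_sqr gtr0_norm.
rewrite -[X in normc X](subrKA A) (le_trans (normcD _ _))// [leRHS]mulrDl.
exact: lerD.
Qed.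

End Inversion.

(** * Distributions with integrable Fourier transform *)

Section Symbol.
Variable R : realType.
Let mu := @lebesgue_measure R.
Implicit Types (t x xi : R) (f : R -> R[i]).

Lemma conjcM (z w : R[i]) : conjc (z * w) = conjc z * conjc w.
Proof. by apply: complex_eq; rewrite !reimE; ring. Qed.

Lemma conjc_involutive (z : R[i]) : conjc (conjc z) = z.
Proof. by apply: complex_eq; rewrite !reimE ?opprK. Qed.

Lemma conjc_ofreal (x : R) : conjc x%:C = x%:C.
Proof. by apply: complex_eq; rewrite !reimE ?oppr0. Qed.

Lemma normc_symbol t xi : normc (kdvb_symbol t xi) = gauss t xi.
Proof. by rewrite Normc.normcM normc_expi mulr1 normc_real ger0_norm ?expR_ge0. Qed.

Lemma gauss_le1 t xi : 0 <= t -> gauss t xi <= 1.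
Proof. by move=> t0; rewrite /gauss -expR0 ler_expR oppr_le0 mulr_ge0// sqr_ge0. Qed.

Lemma normc_symbol_le1 t xi : 0 <= t -> normc (kdvb_symbol t xi) <= 1.
Proof. by move=> t0; rewrite normc_symbol gauss_le1. Qed.

Lemma symbolD t t' xi : kdvb_symbol (t + t') xi = kdvb_symbol t xi * kdvb_symbol t' xi.
Proof.
rewrite /kdvb_symbol !mulrDl opprD expRD expiD rmorphM; ring.
Qed.

(** The damping is even and the phase odd in [xi]; this Hermitian symmetry is what keeps solutions
    with real data real-valued. *)
Lemma symbol_conj t xi : kdvb_symbol t (- xi) = conjc (kdvb_symbol t xi).
Proof.
rewrite /kdvb_symbol sqrrN (_ : t * (- xi) ^+ 3 = - (t * xi ^+ 3)); last by ring.
by rewrite expiN; apply: complex_eq; rewrite !reimE; ring.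
Qed.

Lemma cmfun_symbol d (T : measurableType d) (a b : T -> R) :
  measurable_fun setT a -> measurable_fun setT b ->
  cmfun (fun z => kdvb_symbol (a z) (b z)).
Proof.
move=> ma mb; apply: cmfunM.
  apply: cmfun_real; apply: measurableT_comp => //; apply: measurableT_comp => //.
  apply: measurable_funM => //; exact: measurable_funX.
apply: cmfun_expi; apply: measurable_funM => //; exact: measurable_funX.
Qed.

Lemma has_cderiv_symbol t x : has_cderiv (kdvb_symbol t) x
  (((- (2 * t * x))%:C + imag (3 * t * x ^+ 2)) * kdvb_symbol t x).
Proof.
rewrite [X in has_cderiv _ _ X](_ : _ =
    (- (2 * t * x) * gauss t x)%:C * expi (t * x ^+ 3) +
    (gauss t x)%:C * (imag (3 * t * x ^+ 2) * expi (t * x ^+ 3))); last first.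
  by rewrite /kdvb_symbol /gauss rmorphM; ring.
apply: has_cderivM; first exact: (has_cderiv_real (is_derive_gauss t x)).
apply: (@has_cderiv_expi _ (fun y => t * y ^+ 3)).
by apply: is_derive_eq; rewrite /GRing.scale /=; ring.
Qed.

Lemma schwartz_symbol t f : 0 <= t -> schwartz f ->
  schwartz (fun x => kdvb_symbol t x * f x).
Proof.
move=> t0 Sf; pose K h := exists2 f, schwartz f & h = fun x => kdvb_symbol t x * f x.
apply: (@schwartz_coind R K); last by exists f.
  move=> _ [u Su ->].
  pose v x := (- (2 * t))%:C * (x%:C * u x) +
    (imag (3 * t) * (x%:C * (x%:C * u x)) + cderiv 1 u x).
  exists (fun x => kdvb_symbol t x * v x).
    exists v => //; apply: schwartzD; first exact/schwartzZ/schwartzX.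
    by apply: schwartzD; [exact/schwartzZ/schwartzX/schwartzX|exact: schwartz_deriv].
  move=> x; rewrite [X in has_cderiv _ _ X](_ : _ =
      ((- (2 * t * x))%:C + imag (3 * t * x ^+ 2)) * kdvb_symbol t x * u x +
      kdvb_symbol t x * cderiv 1 u x); last first.
    have -> : imag (3 * t * x ^+ 2) = imag (3 * t) * (x%:C * x%:C).
      by apply: complex_eq; rewrite !reimE; ring.
    have -> : (- (2 * t * x))%:C = (- (2 * t))%:C * x%:C by rewrite -rmorphM mulNr.
    rewrite /v; ring.
  apply: has_cderivM; first exact: has_cderiv_symbol.
  exact: schwartz_has_cderiv.
move=> _ [u Su ->] m; have [M HM] := schwartz_bound m Su; exists M => x.
apply: le_trans (HM x); rewrite ler_wpM2l ?exprn_ge0// Normc.normcM.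
by rewrite ler_piMl ?normc_ge0// normc_symbol_le1.
Qed.

Lemma expi_lipschitz (x : R) : normc (expi x - 1) <= 2 * `|x|.
Proof.
have c : `|cos x - cos 0| <= 1 * `|x - 0|.
  apply: (@lipschitz_derive_bound _ cos (fun x => - sin x)) => y.
    by rewrite normrN ler_norml sin_geN1 sin_le1.
have s : `|sin x - sin 0| <= 1 * `|x - 0|.
  apply: (@lipschitz_derive_bound _ sin cos) => y.
    by rewrite ler_norml cos_geN1 cos_le1.
rewrite (le_trans (normc_le_ReIm _))// !reimE.
move: c s; rewrite cos0 sin0 !subr0 !mul1r; lra.
Qed.

Lemma symbol_sub1 t xi : 0 <= t ->
  normc (kdvb_symbol t xi - 1) <= t * (xi ^+ 2 + 2 * `|xi| ^+ 3).
Proof.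
move=> t0; rewrite (_ : _ - 1 = (gauss t xi)%:C * (expi (t * xi ^+ 3) - 1) +
    (gauss t xi - 1)%:C); last by rewrite rmorphB rmorph1 /kdvb_symbol /gauss; ring.
rewrite (le_trans (normcD _ _))// [leRHS]mulrDr [leRHS]addrC lerD//; last first.
  by rewrite normc_real gauss_sub1.
rewrite Normc.normcM normc_real ger0_norm ?expR_ge0//.
apply: (@le_trans _ _ (1 * (2 * `|t * xi ^+ 3|))).
  by rewrite ler_pM ?expR_ge0 ?normc_ge0 ?gauss_le1// expi_lipschitz.
by rewrite normrM (ger0_norm t0) normrX; lra.
Qed.

End Symbol.

Section SpectralDistribution.
Variable R : realType.
Let mu := @lebesgue_measure R.
Implicit Types (c d f phi : R -> R[i]) (t x xi M : R).

Lemma schwartz_ifourier phi : schwartz phi -> schwartz (ifourier phi).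
Proof. by move=> S; rewrite ifourierE; apply/schwartzZ/schwartz_ft/S; exact: oner_neq0. Qed.

Lemma schwartz_fourier phi : schwartz phi -> schwartz (fourier phi).
Proof. by move=> S; rewrite fourierE; apply/schwartz_ft/S; rewrite oppr_eq0 oner_neq0. Qed.

Lemma fourierK phi : schwartz phi -> ifourier (fourier phi) = phi.
Proof.
move=> S; rewrite ifourierE fourierE; apply/funext => x.
have := @ft_inversion R (-1) phi x; rewrite opprK => -> //; last by rewrite sqrrN expr1n.
by rewrite mulrA -rmorphM mulVf ?rmorph1 ?mul1r// mulf_neq0 ?pnatr_eq0// gt_eqF ?pi_gt0.
Qed.

Lemma cderiv_fourier phi : schwartz phi ->
  cderiv 1 (fourier phi) = fourier (fun x => imag (-1) * (x%:C * phi x)).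
Proof.
move=> S; rewrite !fourierE; apply: cderiv_eq => x.
rewrite ftZ; first exact: has_cderiv_ft.
exact/schwartz_kernel_integrable/schwartzX.
Qed.

Lemma normc_ifourier_le c x M : cmfun c -> (forall xi, normc (c xi) <= M * wt xi) ->
  normc (ifourier c x) <= (2 * pi)^-1 * (2 * (M * wt_mass R)).
Proof.
move=> mc cM; rewrite ifourierE Normc.normcM normc_real.
have p0 : 0 <= (2 * pi)^-1 :> R by rewrite invr_ge0 mulr_ge0// pi_ge0.
by rewrite ger0_norm// ler_wpM2l// normc_ft_le.
Qed.

Lemma cmfun_ifourier c : cmfun c -> cmfun (ifourier c).
Proof. by move=> mc; rewrite ifourierE; apply: cmfunM; [exact: cmfun_cst|exact: cmfun_ft]. Qed.

(* The distribution whose Fourier transform is the function [c]. *)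
Definition spectral c : distr R := fun phi =>
  cintegral setT (fun xi => c xi * ifourier phi xi).

(** The constant is explicit because the Picard scheme runs under a smallness condition on it. *)
Definition wt_bounded k M c := cmfun c /\ forall xi, normc (c xi) <= M * wt xi ^+ k.

Lemma wt_boundedW k j M c : (j <= k)%N -> wt_bounded k M c -> wt_bounded j M c.
Proof.
move=> jk [mc cM]; split => // xi.
have M0 : 0 <= M.
  have := le_trans (normc_ge0 _) (cM xi).
  by rewrite pmulr_lge0// exprn_gt0// wt_gt0.
rewrite (le_trans (cM xi))// ler_wpM2l// -(subnK jk) exprD.
by rewrite ler_piMl ?exprn_ge0 ?exprn_ile1 ?wt_ge0// wt_le1.
Qed.

Lemma wt_bounded_ge0 k M c : wt_bounded k M c -> 0 <= M.
Proof.
move=> [_ cM]; have := le_trans (normc_ge0 _) (cM 0).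
by rewrite pmulr_lge0// exprn_gt0// wt_gt0.
Qed.

Lemma wt_boundedM k M c f N : wt_bounded k M c -> cmfun f ->
  (forall x, normc (f x) <= N) -> wt_bounded k (M * N) (fun x => c x * f x).
Proof.
move=> [mc cM] mf fN; split; first exact: cmfunM.
move=> x; rewrite Normc.normcM mulrAC; apply: ler_pM; rewrite ?normc_ge0//.
Qed.

Lemma wt_bounded_integrable k M c : wt_bounded k.+1 M c -> cintegrable setT c.
Proof.
move=> /(@wt_boundedW k.+1 1 M c isT)[mc cM].
by apply: (cintegrable_dom measurableT mc (integrable_cst_wt M 0)) => x _.
Qed.

Lemma wt_bounded_cintegral_le k M c : wt_bounded k.+1 M c ->
  normc (cintegral setT c) <= 2 * (M * wt_mass R).
Proof.
move=> /(@wt_boundedW k.+1 1 M c isT)[mc cM]; rewrite -Rintegral_cst_wt.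
by apply: (normc_cintegral_le measurableT mc (integrable_cst_wt M 0)) => x _; exact: cM.
Qed.

Lemma schwartz_bounded phi : schwartz phi -> exists2 M, 0 <= M &
  forall x, normc (phi x) <= M.
Proof.
move=> /schwartz_wt_bound[M M0 HM]; exists M => // x.
by rewrite (le_trans (HM x))// ler_piMr// wt_le1.
Qed.

Lemma spectral_integrable k M c phi : wt_bounded k.+1 M c -> schwartz phi ->
  cintegrable setT (fun xi => c xi * phi xi).
Proof.
move=> cM S; have [N N0 HN] := schwartz_bounded S.
exact: wt_bounded_integrable (wt_boundedM cM (schwartz_cmfun S) HN).
Qed.

Lemma spectral_fourier c phi : schwartz phi ->
  spectral c (fourier phi) = cintegral setT (fun xi => c xi * phi xi).
Proof. by move=> S; rewrite /spectral fourierK. Qed.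

Lemma spectral_fourier_is_fun k M c : wt_bounded k.+1 M c ->
  distr_is_fun (distr_fourier (spectral c)) c.
Proof.
move=> cM; split; first by case: cM.
move=> phi S; split; first exact: spectral_integrable cM S.
exact: spectral_fourier.
Qed.

(** Fubini moves the inverse transform from the test function to [c]. That the distribution is a
    function is what gives a meaning to its square in the Duhamel equation. *)
Lemma spectral_is_fun k M c : wt_bounded k.+1 M c -> distr_is_fun (spectral c) (ifourier c).
Proof.
move=> /(@wt_boundedW k.+1 1 M c isT) cM; have [mc cb] := cM.
split; first exact: cmfun_ifourier.
move=> phi S; have [N N0 HN] := schwartz_wt_bound S.
have mphi := schwartz_cmfun S.
have cb1 xi : normc (c xi) <= M * wt xi by have := cb xi; rewrite expr1.
split.
  have phiN : wt_bounded 1 N phi by split => // x; rewrite expr1.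
  have := wt_boundedM phiN (cmfun_ifourier mc) (fun x => normc_ifourier_le x mc cb1).
  by move/wt_bounded_integrable; under [X in _ -> cintegrable _ X]eq_fun do rewrite mulrC.
pose k2 : R[i] := ((2 * pi)^-1)%:C.
pose F (z : R * R) := k2 * (expi (1 * (z.2 * z.1)) * c z.1 * phi z.2).
transitivity (cintegral setT (fun xi => cintegral setT (fun x => F (xi, x)))).
  apply: eq_cintegral => xi _; rewrite ifourierE mulrCA -cintegralM//; last first.
    exact: schwartz_kernel_integrable.
  rewrite -cintegralM//; last first.
    exact/cintegrableM/schwartz_kernel_integrable.
  by apply: eq_cintegral => x _; rewrite /F /=; ring.
have k20 : 0 <= normc k2 by exact: normc_ge0.
rewrite (@cfubini R F (fun xi x => normc k2 * (M * wt xi ^+ 1) * (N * wt x ^+ 1))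
  (fun xi => normc k2 * (N * wt_mass R * M) * wt xi ^+ 1)).
- apply: eq_cintegral => x _; rewrite ifourierE -[RHS]mulrA -/k2.
  rewrite [ft 1 c x * _]mulrC mulrA -cintegralM//; last exact: cintegrable_kernel mc cb1.
  by apply: eq_cintegral => xi _; rewrite /F /= [x * xi]mulrC; ring.
- apply: cmfunM; first exact: cmfun_cst.
  apply: cmfunM; last exact: cmfun_comp mphi _.
  apply: cmfunM; last exact: cmfun_comp mc _.
  apply: cmfun_expi; apply: measurable_funM => //; exact: measurable_funM.
- exact: integrable_cst_wt.
- move=> xi; under eq_fun do rewrite mulrA.
  exact: integrable_cst_wt.
- move=> xi x; rewrite /F !Normc.normcM normc_expi mul1r -mulrA ler_wpM2l//.
  by rewrite ler_pM ?normc_ge0// expr1.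
- move=> xi; under eq_Rintegral do rewrite mulrA expr1.
  rewrite Rintegral_cst_wt expr1; lra.
Qed.

Lemma spectral_semigroup c t phi : 0 <= t -> schwartz phi ->
  kdvb_semigroup t (spectral c) phi =
  cintegral setT (fun xi => c xi * (kdvb_symbol t xi * ifourier phi xi)).
Proof.
move=> t0 S; rewrite /kdvb_semigroup /distr_ifourier /distr_mul /distr_fourier.
by rewrite spectral_fourier//; apply: schwartz_symbol => //; exact: schwartz_ifourier.
Qed.

Lemma spectral_semigroup_dx k M c t phi : wt_bounded k.+1 M c -> 0 <= t -> schwartz phi ->
  kdvb_semigroup t (distr_dx (spectral c)) phi =
  cintegral setT (fun xi => c xi * (imag xi * (kdvb_symbol t xi * ifourier phi xi))).
Proof.
move=> cM t0 S.
rewrite /kdvb_semigroup /distr_ifourier /distr_mul /distr_fourier /distr_dx.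
have Sg : schwartz (fun xi => kdvb_symbol t xi * ifourier phi xi).
  by apply: schwartz_symbol => //; exact: schwartz_ifourier.
have Sxg := schwartzZ (imag (-1)) (schwartzX Sg).
rewrite cderiv_fourier// spectral_fourier// -[LHS]mulN1r -cintegralM//; last first.
  exact: spectral_integrable cM Sxg.
apply: eq_cintegral => xi _.
by rewrite (_ : imag xi = - imag (-1) * xi%:C) ?mulNr; [ring|apply: complex_eq; rewrite !reimE; ring].
Qed.

Lemma ifourier_linear (a : R[i]) phi psi : schwartz phi -> schwartz psi ->
  ifourier (fun x => a * phi x + psi x) = fun xi => a * ifourier phi xi + ifourier psi xi.
Proof.
move=> S S'; rewrite !ifourierE; apply/funext => xi.
rewrite [a * _]mulrCA -mulrDr -[a * ft 1 phi xi]ftZ; last exact: schwartz_kernel_integrable.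
rewrite /ft -cintegralD//; last 2 first.
- exact/schwartz_kernel_integrable/schwartzZ.
- exact: schwartz_kernel_integrable.
by congr (_ * _); apply: eq_cintegral => x _; rewrite mulrDr.
Qed.

Lemma spectral_tempered k M c : wt_bounded k.+1 M c -> tempered (spectral c).
Proof.
move=> cM; split.
  move=> a phi psi S S'; rewrite /spectral ifourier_linear//.
  have i1 := spectral_integrable cM (schwartz_ifourier S).
  have i2 := spectral_integrable cM (schwartz_ifourier S').
  rewrite -cintegralM// -cintegralD//; last exact: cintegrableM.
  by apply: eq_cintegral => xi _; ring.
pose N := (2 * pi)^-1 * (2 * (2 * wt_mass R)).
have N0 : 0 <= N by rewrite !mulr_ge0 ?invr_ge0 ?mulr_ge0 ?pi_ge0 ?wt_mass_ge0.
(* Order 2 suffices: the seminorms with weights 1 and [x^2] bound [phi] by [2 M' wt], hence its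
   inverse transform by a constant. *)
exists 2, (2 * (M * N * wt_mass R)) => phi M' S HM'.
have b x : normc (phi x) <= 2 * M' * wt x.
  rewrite ler_pdivlMr ?oneD_sqr_gt0// mulrC mulrDl mul1r mulr2n mulrDl !mul1r lerD//.
    by have := HM' 0%N 0%N x isT isT; rewrite expr0 mul1r cderiv0.
  by have := HM' 2%N 0%N x isT isT; rewrite cderiv0 real_normK ?num_real.
have := wt_bounded_cintegral_le (wt_boundedM cM (cmfun_ifourier (schwartz_cmfun S))
  (fun x => normc_ifourier_le x (schwartz_cmfun S) b)).
rewrite /spectral; rewrite /N; lra.
Qed.

Lemma ifourier_conj phi xi : schwartz phi ->
  ifourier (fun x => conjc (phi x)) xi = conjc (ifourier phi (- xi)).
Proof.
move=> S; rewrite !ifourierE.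
rewrite conjcM conjc_ofreal; congr (_ * _).
rewrite /ft -cintegral_conj//; last exact: schwartz_kernel_integrable.
by apply: eq_cintegral => x _; rewrite conjcM -expiN !mul1r mulrN opprK.
Qed.

Lemma spectral_real_valued k M c : wt_bounded k.+1 M c ->
  (forall xi, c (- xi) = conjc (c xi)) -> real_valued (spectral c).
Proof.
move=> cM cN phi S; rewrite /spectral.
pose G xi := c xi * ifourier phi xi.
have [G1 G2] : cintegrable setT G by exact: spectral_integrable cM (schwartz_ifourier S).
have mG : cmfun G.
  by apply: cmfunM; [case: cM|exact/cmfun_ifourier/schwartz_cmfun].
rewrite -[cintegral _ (fun xi => c xi * ifourier phi xi)]/(cintegral setT G).
rewrite -(cintegral_oppr mG) -cintegral_conj//.
  apply: eq_cintegral => xi _.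
  by rewrite /G conjcM cN conjc_involutive ifourier_conj.
by split; [exact: integrable_oppr G1|exact: integrable_oppr G2].
Qed.

End SpectralDistribution.

(** * The quadratic Duhamel operator on the Fourier side *)

Section Convolution.
Variable R : realType.
Let mu := @lebesgue_measure R.
Implicit Types (x y t xi eta A B D : R) (U V f g : R * R -> R[i]).

(** This is [1 + (x + y)^2 <= 2 ((1 + x^2) + (1 + y^2))] divided by the three factors. *)
Lemma wt_submul x y : wt x * wt y <= 2 * wt (x + y) * (wt x + wt y).
Proof.
have := oneD_sqr_gt0 x; have := oneD_sqr_gt0 y; have := oneD_sqr_gt0 (x + y).
rewrite /wt; set a := 1 + x ^+ 2; set b := 1 + y ^+ 2; set c := 1 + (x + y) ^+ 2.
move=> c0 b0 a0.
have cab : c <= 2 * (a + b) by rewrite /a /b /c; have := sqr_ge0 (x - y); nra.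
have -> : 2 * c^-1 * (a^-1 + b^-1) = a^-1 * b^-1 * (2 * (a + b) / c).
  by field; rewrite !gt_eqF.
have h : 1 <= 2 * (a + b) / c by rewrite ler_pdivlMr// mul1r.
by rewrite ler_peMr// mulr_ge0// invr_ge0 ltW.
Qed.

(** In the cube of [wt_submul] one factor [wt x + wt y] is kept, to be integrated in a convolution;
    the other two are at most 4 together, whence [32 = 8 * 4]. *)
Lemma wt3_submul x y : wt x ^+ 3 * wt y ^+ 3 <= 32 * wt (x + y) ^+ 3 * (wt x + wt y).
Proof.
have h := wt_submul x y.
have a0 := wt_ge0 x; have b0 := wt_ge0 y; have c0 := wt_ge0 (x + y).
have a1 := wt_le1 x; have b1 := wt_le1 y.
rewrite -exprMn; apply: (@le_trans _ _ ((2 * wt (x + y) * (wt x + wt y)) ^+ 3)).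
  by rewrite lerXn2r ?nnegrE ?mulr_ge0 ?addr_ge0.
set a := wt x in a0 a1 *; set b := wt y in b0 b1 *; set c := wt (x + y) in c0 *.
have ab : (a + b) ^+ 2 <= 4 by nra.
rewrite (_ : (2 * c * (a + b)) ^+ 3 = 8 * c ^+ 3 * (a + b) * (a + b) ^+ 2); last by ring.
rewrite (_ : 32 * c ^+ 3 * (a + b) = 8 * c ^+ 3 * (a + b) * 4); last by ring.
by rewrite ler_wpM2l// !mulr_ge0 ?exprn_ge0 ?addr_ge0.
Qed.

(** The first coordinate is time and the second frequency. The bound is imposed at all times, so the
    paths below are cut off outside [[0, T]]. *)
Definition path_bounded D U :=
  cmfun U /\ forall z, normc (U z) <= D * wt z.2 ^+ 3.

Lemma path_bounded_ge0 D U : path_bounded D U -> 0 <= D.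
Proof.
move=> [_ cM]; have := le_trans (normc_ge0 _) (cM (0, 0)).
by rewrite pmulr_lge0// exprn_gt0// wt_gt0.
Qed.

Lemma path_bounded_slice D U t : path_bounded D U -> wt_bounded 3 D (fun xi => U (t, xi)).
Proof.
move=> [mU UD]; split; last by move=> xi; exact: UD.
by apply: cmfun_comp mU _; exact: measurable_fun_pair.
Qed.

Definition conv_kernel U V (z : (R * R) * R) : R[i] :=
  U (z.1.1, z.2) * V (z.1.1, z.1.2 - z.2).

Definition conv U V (w : R * R) : R[i] :=
  cintegral setT (fun eta => conv_kernel U V (w, eta)).

Lemma cmfun_conv_kernel U V : cmfun U -> cmfun V -> cmfun (conv_kernel U V).
Proof.
move=> mU mV; apply: cmfunM.
  apply: cmfun_comp mU _; apply: measurable_fun_pair => //.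
  exact: measurableT_comp.
apply: cmfun_comp mV _; apply: measurable_fun_pair => //.
  exact: measurableT_comp.
apply: measurable_funB => //; exact: measurableT_comp.
Qed.

Lemma cmfun_conv U V : cmfun U -> cmfun V -> cmfun (conv U V).
Proof. by move=> mU mV; apply: cmfun_cintegral => //; exact: cmfun_conv_kernel. Qed.

Definition conv_dom (D xi eta : R) : R := D * 32 * wt xi ^+ 3 * (wt eta + wt (xi - eta)).

Lemma wt3_conv_dom D xi eta : 0 <= D ->
  D * (wt eta ^+ 3 * wt (xi - eta) ^+ 3) <= conv_dom D xi eta.
Proof.
move=> D0; have := wt3_submul eta (xi - eta); rewrite [eta + _]addrC subrK => h.
rewrite /conv_dom (_ : D * 32 * _ * _ =
  D * (32 * wt xi ^+ 3 * (wt eta + wt (xi - eta)))); last by ring.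
exact: ler_wpM2l.
Qed.

Lemma integrable_wt_shift xi : mu.-integrable setT (EFin \o (fun eta => wt (xi - eta))).
Proof.
have := integrable_shift (- xi) (integrable_wt R).
rewrite [X in mu.-integrable _ X -> _](_ : _ = EFin \o (fun eta => wt (xi - eta)))//.
by apply/funext => eta /=; rewrite -wtN opprB.
Qed.

Lemma Rintegral_wt_shift xi : \int[mu]_eta wt (xi - eta) = wt_mass R.
Proof.
rewrite /wt_mass -(@Rintegral_shift R (- xi) _ (@measurable_wt R)).
by apply: eq_Rintegral => eta _; rewrite -wtN opprB.
Qed.

Lemma integrable_conv_dom D xi : mu.-integrable setT (EFin \o conv_dom D xi).
Proof.
apply: integrable_scale.
rewrite (_ : EFin \o _ = (EFin \o (@wt R)) \+ (EFin \o (fun eta => wt (xi - eta))))%E//.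
by apply: integrableD => //; [exact: integrable_wt|exact: integrable_wt_shift].
Qed.

Lemma Rintegral_conv_dom D xi :
  \int[mu]_eta conv_dom D xi eta = D * 64 * wt_mass R * wt xi ^+ 3.
Proof.
have i1 := integrable_wt R; have i2 := integrable_wt_shift xi.
rewrite RintegralZl//; last by
  rewrite (_ : EFin \o _ = (EFin \o (@wt R)) \+ (EFin \o (fun eta => wt (xi - eta))))%E//;
  exact: integrableD.
by rewrite RintegralD// Rintegral_wt_shift -/(wt_mass R); ring.
Qed.

Lemma normc_conv_kernel A B U V xi t eta : path_bounded A U -> path_bounded B V ->
  normc (conv_kernel U V ((t, xi), eta)) <= conv_dom (A * B) xi eta.
Proof.
move=> UA VB; have A0 := path_bounded_ge0 UA; have B0 := path_bounded_ge0 VB.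
apply: le_trans (wt3_conv_dom _ _ (mulr_ge0 A0 B0)).
rewrite /conv_kernel Normc.normcM /=.
have := ler_pM (normc_ge0 _) (normc_ge0 _) (UA.2 (t, eta)) (VB.2 (t, xi - eta)).
by rewrite /=; lra.
Qed.

Lemma conv_kernel_integrable A B U V w : path_bounded A U -> path_bounded B V ->
  cintegrable setT (fun eta => conv_kernel U V (w, eta)).
Proof.
case: w => t xi UA VB.
apply: (cintegrable_dom measurableT _ (integrable_conv_dom (A * B) xi)) => [|eta _].
  apply: cmfun_comp (cmfun_conv_kernel UA.1 VB.1) _; exact: measurable_fun_pair.
exact: normc_conv_kernel.
Qed.

(** Here [128 = 2 * 32 * 2]: real and imaginary parts are estimated separately, 32 is the constant
    of [wt3_submul], and two translates of [wt] are integrated. *)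
Definition conv_const : R := 128 * wt_mass R.

Lemma conv_const_ge0 : 0 <= conv_const.
Proof. by rewrite mulr_ge0// wt_mass_ge0. Qed.

Lemma conv_bounded A B U V : path_bounded A U -> path_bounded B V ->
  path_bounded (conv_const * (A * B)) (conv U V).
Proof.
move=> UA VB; split; first exact: cmfun_conv UA.1 VB.1.
move=> [t xi]; rewrite -[wt (t, xi).2]/(wt xi).
apply: le_trans (normc_cintegral_le measurableT _ (integrable_conv_dom (A * B) xi) _) _.
- apply: cmfun_comp (cmfun_conv_kernel UA.1 VB.1) _; exact: measurable_fun_pair.
- move=> eta _; exact: normc_conv_kernel.
- by rewrite Rintegral_conv_dom /conv_const; lra.
Qed.

Lemma conv_diff A D U V : path_bounded A U -> path_bounded A V ->
  (forall z, normc (U z - V z) <= D * wt z.2 ^+ 3) ->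
  forall z, normc (conv U U z - conv V V z) <= conv_const * (2 * A * D) * wt z.2 ^+ 3.
Proof.
move=> UA VA UV [t xi]; rewrite -[wt (t, xi).2]/(wt xi).
have A0 := path_bounded_ge0 UA.
have D0 : 0 <= D.
  have := le_trans (normc_ge0 _) (UV (0, 0)).
  by rewrite pmulr_lge0// exprn_gt0// wt_gt0.
rewrite /conv -cintegralB//; last 2 first.
- exact: (conv_kernel_integrable _ UA UA).
- exact: (conv_kernel_integrable _ VA VA).
apply: le_trans (normc_cintegral_le measurableT _ (integrable_conv_dom (2 * A * D) xi) _) _.
- by apply: cmfunB; [apply: cmfun_comp (cmfun_conv_kernel UA.1 UA.1) _|
    apply: cmfun_comp (cmfun_conv_kernel VA.1 VA.1) _]; exact: measurable_fun_pair.
- move=> eta _; apply: le_trans (wt3_conv_dom _ _ _); last by rewrite !mulr_ge0.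
  rewrite /conv_kernel /=.
  set u := U (t, eta); set u' := U (t, xi - eta); set v := V (t, eta); set v' := V (t, xi - eta).
  rewrite (_ : u * u' - v * v' = (u - v) * u' + v * (u' - v')); last by ring.
  rewrite (le_trans (normcD _ _))// !Normc.normcM.
  have h1 := ler_pM (normc_ge0 _) (normc_ge0 _) (UV (t, eta)) (UA.2 (t, xi - eta)).
  have h2 := ler_pM (normc_ge0 _) (normc_ge0 _) (VA.2 (t, eta)) (UV (t, xi - eta)).
  move: h1 h2; rewrite /= -/u -/u' -/v -/v'; lra.
- by rewrite Rintegral_conv_dom /conv_const; lra.
Qed.

Lemma conv_sym U t xi : cmfun U ->
  (forall eta, U (t, - eta) = conjc (U (t, eta))) ->
  cintegrable setT (fun eta => conv_kernel U U ((t, xi), eta)) ->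
  conv U U (t, - xi) = conjc (conv U U (t, xi)).
Proof.
move=> mU US ci; rewrite /conv -cintegral_conj//.
have mk : cmfun (fun eta => conv_kernel U U ((t, - xi), eta)).
  apply: cmfun_comp (cmfun_conv_kernel mU mU) _; exact: measurable_fun_pair.
rewrite -(cintegral_oppr mk); apply: eq_cintegral => eta _.
rewrite /conv_kernel /= US conjcM -(US (xi - eta)); congr (_ * U (_, _)); ring.
Qed.

(** The convolution theorem; it shows which spectrum the square of a solution has, and it brings in
    the factor [1 / (2 pi)]. *)
Lemma ifourier_sqr A U t x : path_bounded A U ->
  ifourier (fun xi => U (t, xi)) x ^+ 2 =
  ifourier (fun xi => ((2 * pi)^-1)%:C * conv U U (t, xi)) x.
Proof.
move=> UA; pose k2 : R[i] := ((2 * pi)^-1)%:C.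
pose u xi := U (t, xi).
have [mu_ ub] : wt_bounded 1 A u by apply: (@wt_boundedW R 3 1) => //; exact: path_bounded_slice.
have ub1 xi : normc (u xi) <= A * wt xi by have := ub xi; rewrite expr1.
have iu : cintegrable setT (fun xi => expi (1 * (xi * x)) * u xi).
  exact: cintegrable_kernel mu_ ub1.
pose F (z : R * R) := expi (1 * (z.1 * x)) * u z.1 * (expi (1 * ((z.2 - z.1) * x)) * u (z.2 - z.1)).
have A0 := path_bounded_ge0 UA.
have E1 : ft 1 u x * ft 1 u x = cintegral setT (fun eta => cintegral setT (fun xi => F (eta, xi))).
  rewrite {1}/ft mulrC -cintegralM//; apply: eq_cintegral => eta _.
  rewrite mulrC [X in _ * X = _](_ : _ = cintegral setT
     (fun xi => expi (1 * ((xi - eta) * x)) * u (xi - eta))); last first.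
    rewrite -[RHS](cintegral_shift eta); last first.
      apply: cmfunM; last by apply: cmfun_comp mu_ _; exact: measurable_funB.
      by apply: cmfun_expi; apply: measurable_funM => //; apply: measurable_funM => //;
        exact: measurable_funB.
    by apply: eq_cintegral => xi _; rewrite addrK.
  rewrite -cintegralM//.
  apply: (cintegrable_dom measurableT (h := fun xi => A * wt (eta - xi))).
  - apply: cmfunM; last by apply: cmfun_comp mu_ _; exact: measurable_funB.
    by apply: cmfun_expi; apply: measurable_funM => //; apply: measurable_funM => //;
      exact: measurable_funB.
  - by apply: integrable_scale; exact: integrable_wt_shift.
  - by move=> xi _; rewrite Normc.normcM normc_expi mul1r (le_trans (ub1 _))// -wtN opprB.
have E2 : ft 1 (fun xi => conv U U (t, xi)) x =
    cintegral setT (fun xi => cintegral setT (fun eta => F (eta, xi))).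
  apply: eq_cintegral => xi _; rewrite -cintegralM//; last first.
    exact: (conv_kernel_integrable _ UA UA).
  apply: eq_cintegral => eta _; rewrite /F /conv_kernel /= -/(u eta) -/(u (xi - eta)).
  rewrite (_ : 1 * (xi * x) = 1 * (eta * x) + 1 * ((xi - eta) * x)); last by ring.
  by rewrite expiD; ring.
have cv := @wt_boundedW R 3 1 _ _ isT (path_bounded_slice t (conv_bounded UA UA)).
have icv : cintegrable setT (fun xi => expi (1 * (xi * x)) * conv U U (t, xi)).
  have cvb y : normc (conv U U (t, y)) <= conv_const * (A * A) * wt y.
    by have := cv.2 y; rewrite expr1.
  exact: cintegrable_kernel cv.1 cvb.
rewrite !ifourierE ftZ// -/k2 exprMn expr2 -mulrA; congr (_ * (_ * _)).
rewrite -/u expr2 E1 E2; apply: (@cfubini R F (fun eta xi => A * wt eta * (A * wt (xi - eta)))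
  (fun eta => A * A * wt_mass R * wt eta ^+ 1)).
- have mb : measurable_fun [set: R * R] (fun z => z.2 - z.1) by exact: measurable_funB.
  apply: cmfunM.
    apply: cmfunM; last exact: cmfun_comp mu_ _.
    by apply: cmfun_expi; apply: measurable_funM => //; exact: measurable_funM.
  apply: cmfunM; last exact: cmfun_comp mu_ mb.
  by apply: cmfun_expi; apply: measurable_funM => //; exact: measurable_funM.
- exact: integrable_cst_wt.
- move=> eta; do 2 apply: integrable_scale.
  have := integrable_wt_shift eta; congr (mu.-integrable _ _).
  by apply/funext => xi /=; rewrite -wtN opprB.
- by move=> eta xi; rewrite /F !Normc.normcM !normc_expi !mul1r ler_pM ?normc_ge0.
- move=> eta; rewrite RintegralZl//; last first.
    apply: integrable_scale.
    have := integrable_wt_shift eta; congr (mu.-integrable _ _).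
    by apply/funext => xi /=; rewrite -wtN opprB.
  rewrite RintegralZl//; last first.
    have := integrable_wt_shift eta; congr (mu.-integrable _ _).
    by apply/funext => xi /=; rewrite -wtN opprB.
  under eq_Rintegral do rewrite -wtN opprB.
  by rewrite Rintegral_wt_shift expr1; lra.
Qed.

End Convolution.

(** * The Duhamel integral and parabolic smoothing *)

Section DuhamelOperator.
Variables (R : realType) (T : R).
Hypothesis T_ge0 : 0 <= T.
Let mu := @lebesgue_measure R.
Implicit Types (t tau xi D : R) (f g : R * R -> R[i]).

(** As a factor of the integrand, this cut-off turns the moving domain [[0, t]] into the whole line,
    which keeps joint measurability simple, and it extends paths by zero outside [[0, T]]. *)
Definition causal t tau : R := if [&& 0 <= tau, tau <= t & t <= T] then 1 else 0.

Lemma causal_ge0 t tau : 0 <= causal t tau.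
Proof. by rewrite /causal; case: ifP. Qed.

Lemma measurable_causal d (X : measurableType d) (a b : X -> R) :
  measurable_fun setT a -> measurable_fun setT b ->
  measurable_fun setT (fun z => causal (a z) (b z)).
Proof.
move=> ma mb; apply: measurable_fun_ifT => //.
apply: measurable_and; first exact: measurable_fun_ler.
by apply: measurable_and; exact: measurable_fun_ler.
Qed.

Definition duhamel_kernel f (z : (R * R) * R) : R[i] :=
  (causal z.1.1 z.2)%:C * (kdvb_symbol (z.1.1 - z.2) z.1.2 * f (z.2, z.1.2)).

(** The constant collects the [-1/2] of the equation and the [1 / (2 pi)] of the convolution
    theorem; [imag w.2] is the symbol of the derivative. *)
Definition duhamel_op f (w : R * R) : R[i] :=
  (- (4 * pi)^-1)%:C * imag w.2 * cintegral setT (fun tau => duhamel_kernel f (w, tau)).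

Lemma cmfun_duhamel_kernel f : cmfun f -> cmfun (duhamel_kernel f).
Proof.
move=> mf; have m11 : measurable_fun [set: (R * R) * R] (fun z => z.1.1).
  exact: measurableT_comp.
have m12 : measurable_fun [set: (R * R) * R] (fun z => z.1.2).
  exact: measurableT_comp.
apply: cmfunM; first by apply: cmfun_real; exact: measurable_causal.
apply: cmfunM; first by apply: cmfun_symbol => //; exact: measurable_funB.
by apply: cmfun_comp mf _; exact: measurable_fun_pair.
Qed.

Lemma cmfun_imag d (X : measurableType d) (a : X -> R) : measurable_fun setT a ->
  cmfun (fun z => imag (a z)).
Proof. by move=> ma; split => //=; exact: measurable_cst. Qed.

Lemma cmfun_duhamel_op f : cmfun f -> cmfun (duhamel_op f).
Proof.
move=> mf; apply: cmfunM; last by apply: cmfun_cintegral => //; exact: cmfun_duhamel_kernel.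
by apply: cmfunM; [exact: cmfun_cst|exact: cmfun_imag].
Qed.

Definition heat_weight t xi tau : R := causal t tau * gauss (t - tau) xi.

Lemma heat_weight_ge0 t xi tau : 0 <= heat_weight t xi tau.
Proof. by rewrite mulr_ge0 ?causal_ge0 ?expR_ge0. Qed.

Lemma heat_weightE t xi tau : 0 <= t <= T ->
  heat_weight t xi tau = \1_(`[0, t]%classic) tau * gauss (t - tau) xi.
Proof.
move=> /andP[t0 tT]; rewrite /heat_weight /causal tT andbT indicE.
congr (_ * _); case: ifPn => h; first by rewrite mem_set.
by rewrite memNset//= in_itv/=; exact/negP.
Qed.

Lemma heat_weight_out t xi tau : ~~ (0 <= t <= T) -> heat_weight t xi tau = 0.
Proof.
move=> h; rewrite /heat_weight /causal; case: ifPn => [/and3P[a b c]|]; last by rewrite mul0r.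
by move: h; rewrite c andbT (le_trans a b).
Qed.

Lemma heat_weight_le t xi tau : heat_weight t xi tau <= \1_(`[0, T]%classic) tau.
Proof.
rewrite /heat_weight /causal indicE; case: ifPn => [/and3P[a b c]|_]; last first.
  by rewrite mul0r.
rewrite mem_set ?mul1r; last by rewrite /= in_itv /= a (le_trans b).
by apply: gauss_le1; rewrite subr_ge0.
Qed.

Lemma measurable_gauss2 d (X : measurableType d) (a b : X -> R) :
  measurable_fun setT a -> measurable_fun setT b ->
  measurable_fun setT (fun z => gauss (a z) (b z)).
Proof.
move=> ma mb; apply: measurableT_comp => //; apply: measurableT_comp => //.
by apply: measurable_funM => //; exact: measurable_funX.
Qed.

Lemma integrable_indic_itv (a b : R) (o : bool) :
  mu.-integrable setT (EFin \o \1_([set` Interval (BSide o a) (BRight b)])).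
Proof.
apply/integrableP; split.
  by apply/measurable_EFinP; exact: measurable_indic.
under eq_integral do rewrite /= ger0_norm ?indicE//.
rewrite (_ : (fun _ => _) = EFin \o \1_([set` Interval (BSide o a) (BRight b)])); last first.
  by apply/funext => x; rewrite /= indicE.
rewrite integral_indic// setIT.
have : (mu [set` Interval (BSide o a) (BRight b)] < +oo)%E.
  by rewrite /mu lebesgue_measure_itv/=; case: ifPn => _; rewrite -?EFinB ltry.
by [].
Qed.

Lemma Rintegral_indic_itv (a b : R) (o : bool) : a <= b ->
  \int[mu]_x \1_([set` Interval (BSide o a) (BRight b)]) x = b - a.
Proof.
move=> ab; rewrite /Rintegral integral_indic// setIT.
have : fine (mu [set` Interval (BSide o a) (BRight b)]) = b - a.
  rewrite /mu lebesgue_measure_itv/= lte_fin; case: ltP => //= ba.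
  by apply/esym/eqP; rewrite subr_eq0 eq_le ba ab.
by [].
Qed.

Lemma integrable_heat_weight t xi : mu.-integrable setT (EFin \o heat_weight t xi).
Proof.
apply: le_integrable (integrable_indic_itv 0 T true) => //.
  apply/measurable_EFinP; apply: measurable_funM; first exact: measurable_causal.
  by apply: measurable_gauss2 => //; exact: measurable_funB.
move=> tau _ /=; rewrite lee_fin ger0_norm ?heat_weight_ge0// ger0_norm.
  exact: heat_weight_le.
by rewrite indicE.
Qed.

(** Dissipation recovers the derivative lost in the nonlinearity: [xi^2] times the heat kernel is a
    derivative in [tau], with integral at most 1, and [|xi| <= xi^2] for [|xi| > 1]. Low frequencies
    are bounded by the length [T]. *)
Lemma heat_smoothing t xi : `|xi| * \int[mu]_tau heat_weight t xi tau <= 1 + T.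
Proof.
have [/andP[t0 tT]|h] := boolP (0 <= t <= T); last first.
  rewrite (_ : heat_weight t xi = cst 0); last first.
    by apply/funext => tau; exact: heat_weight_out.
  by rewrite /Rintegral integral0 /= mulr0 addr_ge0.
have [x1|x1] := leP `|xi| 1.
  apply: (@le_trans _ _ (1 * T)); last by rewrite mul1r lerDr.
  rewrite ler_pM//; first by apply: Rintegral_ge0 => tau _; exact: heat_weight_ge0.
  apply: (@le_trans _ _ (\int[mu]_tau \1_(`[0, T]%classic) tau)).
    apply: le_Rintegral => //.
    - exact: integrable_heat_weight.
    - exact: (integrable_indic_itv 0 T true).
    - by move=> tau _; exact: heat_weight_le.
  by rewrite (@Rintegral_indic_itv 0 T true)// subr0.
have x0 : 0 <= `|xi| by [].
apply: (@le_trans _ _ (\int[mu]_tau (xi ^+ 2 * heat_weight t xi tau))).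
  rewrite RintegralZl//; last exact: integrable_heat_weight.
  rewrite ler_wpM2r//; first by apply: Rintegral_ge0 => tau _; exact: heat_weight_ge0.
  by rewrite -[xi ^+ 2]real_normK ?num_real// expr2 ler_peMl// ltW.
pose g tau := xi ^+ 2 * gauss (t - tau) xi.
have dF (tau : R) : is_derive tau 1 (fun tau => gauss (t - tau) xi) (g tau).
  have d : is_derive tau 1 (fun tau : R => - ((t - tau) * xi ^+ 2)) (xi ^+ 2).
    by apply: is_derive_eq; rewrite /GRing.scale /=; ring.
  by apply: (is_derive_eq (is_derive1_comp (is_derive_expR _) d)); rewrite /g mulrC.
have cG : continuous (fun tau => gauss (t - tau) xi).
  by move=> x; apply: differentiable_continuous; apply/derivable1_diffP; case: (dF x).
have cg : continuous g.
  by move=> x; apply: cvgM; [exact: cvg_cst|exact: cG].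
have -> : \int[mu]_tau (xi ^+ 2 * heat_weight t xi tau) = \int[mu]_(tau in `[0, t]) g tau.
  rewrite [RHS]Rintegral_mkcond; apply: eq_Rintegral => tau _.
  rewrite heat_weightE ?t0// patchE indicE /g.
  by case: ifPn => _; rewrite ?mul1r ?mul0r ?mulr0.
move: t0; rewrite le_eqVlt => /predU1P[<-|t0].
  by rewrite set_itv1 Rintegral_set1 addr_ge0.
rewrite /Rintegral (@continuous_FTC2 _ _ (fun tau => gauss (t - tau) xi))//.
- rewrite /= subrr subr0 {1}/gauss mul0r oppr0 expR0.
  have := expR_ge0 (- (t * xi ^+ 2)); rewrite -/(gauss t xi); lra.
- exact: continuous_subspaceT.
- split.
  + by move=> x _; case: (dF x).
  + by apply: cvg_at_right_filter; exact: cG.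
  + by apply: cvg_at_left_filter; exact: cG.
- by move=> x _; rewrite derive1E; exact: derive_val.
Qed.

Lemma normc_duhamel_kernel D f t xi tau : path_bounded D f ->
  normc (duhamel_kernel f ((t, xi), tau)) <= D * wt xi ^+ 3 * heat_weight t xi tau.
Proof.
move=> fD; rewrite /duhamel_kernel Normc.normcM.
rewrite [normc (kdvb_symbol _ _ * _)]Normc.normcM normc_real normc_symbol /=.
rewrite ger0_norm ?causal_ge0// mulrA [leRHS]mulrC ler_pM ?mulr_ge0 ?causal_ge0 ?expR_ge0 ?normc_ge0//.
exact: (fD.2 (tau, xi)).
Qed.

Lemma duhamel_kernel_integrable D f w : path_bounded D f ->
  cintegrable setT (fun tau => duhamel_kernel f (w, tau)).
Proof.
case: w => t xi fD.
apply: (cintegrable_dom measurableT (h := fun tau => D * wt xi ^+ 3 * heat_weight t xi tau)).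
- apply: cmfun_comp (cmfun_duhamel_kernel fD.1) _; exact: measurable_fun_pair.
- by apply: integrable_scale; exact: integrable_heat_weight.
- by move=> tau _; exact: normc_duhamel_kernel.
Qed.

Definition duhamel_const : R := (4 * pi)^-1 * (2 * (1 + T)).

Lemma fourpi_ge0 : 0 <= (4 * pi)^-1 :> R.
Proof. by rewrite invr_ge0 mulr_ge0// pi_ge0. Qed.

Lemma duhamel_const_ge0 : 0 <= duhamel_const.
Proof. by rewrite mulr_ge0 ?fourpi_ge0// mulr_ge0// addr_ge0. Qed.

Lemma duhamel_bounded D f : path_bounded D f ->
  path_bounded (duhamel_const * D) (duhamel_op f).
Proof.
move=> fD; have D0 := path_bounded_ge0 fD.
split; first by apply: cmfun_duhamel_op; case: fD.
move=> [t xi]; rewrite /duhamel_op -[(t, xi).2]/xi !Normc.normcM normc_real normrN.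
rewrite (ger0_norm fourpi_ge0) normc_imag /duhamel_const -!mulrA ler_wpM2l ?fourpi_ge0//.
have h := normc_cintegral_le measurableT
  (cmfun_comp (cmfun_duhamel_kernel fD.1) (measurable_fun_pair (measurable_cst (t, xi)) (@measurable_id _ _ _)))
  (integrable_scale (D * wt xi ^+ 3) (integrable_heat_weight t xi))
  (fun tau _ => normc_duhamel_kernel t xi tau fD).
apply: le_trans (ler_wpM2l (normr_ge0 _) h) _.
rewrite RintegralZl//; last exact: integrable_heat_weight.
have := heat_smoothing t xi; set I := \int[mu]_tau _ => hI.
rewrite [leLHS](_ : _ = 2 * (D * wt xi ^+ 3) * (`|xi| * I)); last by ring.
rewrite [leRHS](_ : _ = 2 * (D * wt xi ^+ 3) * (1 + T)); last by ring.
by rewrite ler_wpM2l// !mulr_ge0// wt_ge0.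
Qed.

Lemma duhamel_opB D D' f g w : path_bounded D f -> path_bounded D' g ->
  duhamel_op f w - duhamel_op g w = duhamel_op (fun z => f z - g z) w.
Proof.
move=> fD gD; rewrite /duhamel_op -mulrBr -cintegralB//; last 2 first.
- exact: duhamel_kernel_integrable fD.
- exact: duhamel_kernel_integrable gD.
by congr (_ * _); apply: eq_cintegral => tau _; rewrite /duhamel_kernel; ring.
Qed.

Lemma duhamel_diff A B D f g : path_bounded A f -> path_bounded B g ->
  (forall z, normc (f z - g z) <= D * wt z.2 ^+ 3) ->
  forall z, normc (duhamel_op f z - duhamel_op g z) <= duhamel_const * D * wt z.2 ^+ 3.
Proof.
move=> fA gB fg z; rewrite (duhamel_opB _ fA gB).
apply: (duhamel_bounded (D := D) _).2; split => //.
by apply: cmfunB; [case: fA|case: gB].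
Qed.

Lemma duhamel_sym D f t xi : path_bounded D f ->
  (forall tau, f (tau, - xi) = conjc (f (tau, xi))) ->
  duhamel_op f (t, - xi) = conjc (duhamel_op f (t, xi)).
Proof.
move=> fD fs; rewrite /duhamel_op !conjcM conjc_ofreal -cintegral_conj//; last first.
  exact: duhamel_kernel_integrable fD.
rewrite -[(t, - xi).2]/(- xi) -[(t, xi).2]/xi.
rewrite (_ : imag (- xi) = conjc (imag xi)); last first.
  by apply: complex_eq; rewrite !reimE ?oppr0.
congr (_ * _); apply: eq_cintegral => tau _.
rewrite /duhamel_kernel /= conjcM [conjc (kdvb_symbol _ _ * _)]conjcM conjc_ofreal.
by rewrite symbol_conj fs.
Qed.

(** By the semigroup law the contributions of the times up to [t] cancel, and only the source on
    []t, t']] remains. This gives the Lipschitz continuity in time. *)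
Lemma duhamel_step D f t t' xi : path_bounded D f -> 0 <= t -> t <= t' -> t' <= T ->
  normc (duhamel_op f (t', xi) - kdvb_symbol (t' - t) xi * duhamel_op f (t, xi)) <=
  (4 * pi)^-1 * `|xi| * (2 * (D * wt xi ^+ 3 * (t' - t))).
Proof.
move=> fD t0 tt' t'T; have D0 := path_bounded_ge0 fD.
rewrite /duhamel_op -[(t', xi).2]/xi -[(t, xi).2]/xi.
set k := (- (4 * pi)^-1)%:C * imag xi.
rewrite mulrCA -mulrBr -cintegralM//; last exact: duhamel_kernel_integrable fD.
rewrite -cintegralB//; last 2 first.
- exact: duhamel_kernel_integrable fD.
- by apply: cintegrableM => //; exact: duhamel_kernel_integrable fD.
rewrite Normc.normcM /k Normc.normcM normc_real normrN (ger0_norm fourpi_ge0) normc_imag.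
rewrite ler_wpM2l ?mulr_ge0 ?fourpi_ge0//.
pose h tau := D * wt xi ^+ 3 * \1_(`]t, t']%classic) tau.
have I1 : \int[mu]_tau h tau = D * wt xi ^+ 3 * (t' - t).
  rewrite RintegralZl//; last exact: (integrable_indic_itv t t' false).
  by rewrite (@Rintegral_indic_itv t t' false).
have mpair s : measurable_fun [set: R] (fun tau : R => ((s, xi), tau)) by exact: measurable_fun_pair.
rewrite -I1; apply: normc_cintegral_le => //.
- apply: cmfunB; first by apply: cmfun_comp (cmfun_duhamel_kernel fD.1) _.
  apply: cmfunM; first exact: cmfun_cst.
  by apply: cmfun_comp (cmfun_duhamel_kernel fD.1) _.
- by apply: integrable_scale; exact: (integrable_indic_itv t t' false).
- move=> tau _; rewrite /duhamel_kernel /=.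
  have [a|a] := boolP (0 <= tau <= t).
    have /andP[a1 a2] := a.
    rewrite /causal a1 a2 (le_trans a2 tt') t'T (le_trans tt' t'T) /= rmorph1 !mul1r.
    rewrite (_ : t' - tau = (t' - t) + (t - tau)); last by ring.
    rewrite symbolD -mulrA subrr normcE /= expr0n addr0 sqrtr0.
    by rewrite /h !mulr_ge0 ?wt_ge0// indicE.
  rewrite [causal t tau]/causal (_ : [&& _, _ & _] = false); last first.
    by apply/negbTE/negP => /and3P[a1 a2 _]; move: a; rewrite a1 a2.
  rewrite mul0r mulr0 subr0.
  rewrite [causal t' tau]/causal; case: ifPn => b; last first.
    rewrite mul0r normcE /= expr0n addr0 sqrtr0.
    by rewrite /h !mulr_ge0 ?wt_ge0// indicE.
  have /and3P[b1 b2 _] := b.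
  rewrite /h indicE mem_set ?mulr1; last first.
    by rewrite /= in_itv /= b2 andbT ltNge; move: a; rewrite b1.
  rewrite rmorph1 mul1r Normc.normcM.
  apply: le_trans (fD.2 (tau, xi)); rewrite ler_piMl ?normc_ge0//.
  by apply: normc_symbol_le1; rewrite subr_ge0.
Qed.

End DuhamelOperator.

(** * Picard iteration *)

Section GeometricLimit.
Variable R : realType.
Implicit Types (a C : R) (u : nat -> R).

Lemma le0_geometric a C : (forall n, a <= C / 2 ^+ n) -> a <= 0.
Proof.
move=> h; rewrite leNgt; apply/negP => a0.
have C0 : 0 < C by have := h 0%N; rewrite expr0 divr1; exact: lt_le_trans.
have := archi_boundP (divr_ge0 (ltW C0) (ltW a0)); set n := Num.bound _ => hn.
have := h n; rewrite ler_pdivlMr ?exprn_gt0//; apply/negP; rewrite -ltNge.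
rewrite mulrC -ltr_pdivrMr// (lt_le_trans hn)// -natrX ler_nat ltnW//.
exact: ltn_expl.
Qed.

(** When the steps are at most [C / 2^n], the sequence [u n - 2 C / 2^n] is nondecreasing, so its
    supremum is the limit. The explicit formula allows the limit to be taken pointwise with a
    rate. *)
Definition geometric_limit u C : R := sup [set u n - 2 * C / 2 ^+ n | n in setT].

Lemma geometric_limitP u C : (forall n, `|u n.+1 - u n| <= C / 2 ^+ n) ->
  forall n, `|u n - geometric_limit u C| <= 2 * C / 2 ^+ n.
Proof.
move=> h.
have C0 : 0 <= C by have := le_trans (normr_ge0 _) (h 0%N); rewrite expr0 divr1.
pose e n := 2 * C / 2 ^+ n.
have e0 n : 0 <= e n by rewrite divr_ge0// mulr_ge0.
have eS n : e n.+1 = C / 2 ^+ n by rewrite /e exprS; field; rewrite expf_neq0.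
have e2 n : e n = C / 2 ^+ n + C / 2 ^+ n by rewrite /e; field; rewrite expf_neq0.
have lo n : u n - e n <= u n.+1 - e n.+1.
  by have := h n; rewrite ler_norml => /andP[]; rewrite eS e2; lra.
have hi n : u n.+1 + e n.+1 <= u n + e n.
  by have := h n; rewrite ler_norml => /andP[]; rewrite eS e2; lra.
have lo_mono n k : u n - e n <= u (n + k)%N - e (n + k)%N.
  by elim: k => [|k IH]; rewrite ?addn0// addnS (le_trans IH).
have hi_mono n k : u (n + k)%N + e (n + k)%N <= u n + e n.
  by elim: k => [|k IH]; rewrite ?addn0// addnS (le_trans (hi _)).
have lohi m n : u m - e m <= u n + e n.
  have := lo_mono m n; have := hi_mono n m; rewrite [(n + m)%N]addnC.
  by have := e0 (m + n)%N; lra.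
have hs : has_sup [set u n - 2 * C / 2 ^+ n | n in setT].
  split; first by exists (u 0%N - e 0%N); exists 0%N.
  by exists (u 0%N + e 0%N) => _ [m _ <-]; exact: lohi.
move=> n; rewrite distrC ler_norml; apply/andP; split.
  by rewrite lerBrDl; apply: sup_upper_bound => //; exists n.
rewrite lerBlDl; apply: ge_sup; first by case: hs.
by move=> _ [m _ <-]; exact: lohi.
Qed.

Lemma geometric_limit_cvg u C : (forall n, `|u n.+1 - u n| <= C / 2 ^+ n) ->
  u n @[n --> \oo] --> geometric_limit u C.
Proof.
move=> h; have hl := geometric_limitP h.
have C0 : 0 <= C by have := le_trans (normr_ge0 _) (h 0%N); rewrite expr0 divr1.
apply/cvgrPdist_le => e e0; near=> n.
rewrite distrC (le_trans (hl n))// ler_pdivrMr ?exprn_gt0// -ler_pdivrMl//.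
rewrite (@le_trans _ _ n%:R)//; last by rewrite -natrX ler_nat ltnW// ltn_expl.
near: n; exact: nbhs_infty_ger.
Unshelve. all: by end_near. Qed.

End GeometricLimit.

(** * The fixed point of the Duhamel map *)

Section Picard.
Variables (R : realType) (T : R).
Hypothesis T_ge0 : 0 <= T.
Variables (L : R * R -> R[i]) (m : R).
Hypothesis L_bounded : path_bounded m L.
Let K := duhamel_const T * conv_const R.
Hypothesis m_small : 8 * K * m <= 1.

Definition duhamel_sqr (U : R * R -> R[i]) := duhamel_op T (conv U U).

Let m_ge0 : 0 <= m. Proof. exact: path_bounded_ge0 L_bounded. Qed.

Lemma duhamel_sqr_bounded A U : path_bounded A U ->
  path_bounded (K * A ^+ 2) (duhamel_sqr U).
Proof.
by move=> UA; have := duhamel_bounded T_ge0 (conv_bounded UA UA); rewrite mulrA expr2.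
Qed.

Lemma duhamel_sqr_diff A D U V : path_bounded A U -> path_bounded A V ->
  (forall z, normc (U z - V z) <= D * wt z.2 ^+ 3) ->
  forall z, normc (duhamel_sqr U z - duhamel_sqr V z) <= K * (2 * A * D) * wt z.2 ^+ 3.
Proof.
move=> UA VA UV z.
have := duhamel_diff T_ge0 (conv_bounded UA UA) (conv_bounded VA VA) (conv_diff UA VA UV) z.
by rewrite [duhamel_const T * (_ * _)]mulrA.
Qed.

Let m_sqr : 8 * (K * m ^+ 2) <= m.
Proof. by have := ler_wpM2r m_ge0 m_small; rewrite mul1r expr2 !mulrA. Qed.

Fixpoint picard n : R * R -> R[i] :=
  if n is n'.+1 then fun z => L z + duhamel_sqr (picard n') z else L.

Lemma picardS n z : picard n.+1 z = L z + duhamel_sqr (picard n) z.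
Proof. by []. Qed.

Lemma path_boundedW A B (U : R * R -> R[i]) : A <= B -> path_bounded A U -> path_bounded B U.
Proof.
move=> AB [mU UA]; split => // z; rewrite (le_trans (UA z))// ler_wpM2r//.
by rewrite exprn_ge0// wt_ge0.
Qed.

Lemma path_boundedD A B (U V : R * R -> R[i]) : path_bounded A U -> path_bounded B V ->
  path_bounded (A + B) (fun z => U z + V z).
Proof.
move=> [mU UA] [mV VB]; split; first exact: cmfunD.
by move=> z; rewrite (le_trans (normcD _ _))// mulrDl lerD.
Qed.

Lemma picard_bounded n : path_bounded (2 * m) (picard n).
Proof.
elim: n => [|n IH].
  by apply: path_boundedW L_bounded; rewrite ler_peMl// ler1n.
apply: path_boundedW (path_boundedD L_bounded (duhamel_sqr_bounded IH)).
rewrite (_ : K * (2 * m) ^+ 2 = 4 * (K * m ^+ 2)); last by ring.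
by have := m_sqr; have := m_ge0; set k := K * m ^+ 2; move=> *; lra.
Qed.

(** On the ball of radius [2 m] that contains the iterates, the quadratic term has Lipschitz
    constant [4 K m <= 1/2]. The weight stays in the estimate, so convergence is measured relative
    to it. *)
Lemma picard_step n z : normc (picard n.+1 z - picard n z) <= m * wt z.2 ^+ 3 / 2 ^+ n.
Proof.
suff H : normc (picard n.+1 z - picard n z) <= m / 2 ^+ n * wt z.2 ^+ 3.
  by rewrite mulrAC.
elim: n z => [|n IH] z.
  rewrite /= addrC addKr expr0 divr1.
  apply: le_trans ((duhamel_sqr_bounded L_bounded).2 z) _.
  rewrite ler_wpM2r ?exprn_ge0 ?wt_ge0//.
  by have := m_sqr; have := m_ge0; set k := K * m ^+ 2; move=> *; lra.
rewrite (picardS n.+1) [X in _ - X](picardS n) opprD addrACA subrr add0r.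
apply: le_trans (duhamel_sqr_diff (picard_bounded n.+1) (picard_bounded n) IH z) _.
rewrite ler_wpM2r ?exprn_ge0 ?wt_ge0// exprS invfM.
set q := (2 ^+ n)^-1; have q0 : 0 <= m * q by rewrite mulr_ge0// invr_ge0 exprn_ge0.
have := ler_wpM2r q0 m_small; rewrite mul1r; lra.
Qed.

Definition picard_limit z : R[i] :=
  geometric_limit (fun n => Rec (picard n z)) (m * wt z.2 ^+ 3) +i*
  geometric_limit (fun n => Imc (picard n z)) (m * wt z.2 ^+ 3).

Lemma picard_limit_dist n z :
  normc (picard n z - picard_limit z) <= 4 * m / 2 ^+ n * wt z.2 ^+ 3.
Proof.
rewrite (le_trans (normc_le_ReIm _))// ReB ImB.
have h1 := @geometric_limitP R (fun n => Rec (picard n z)) (m * wt z.2 ^+ 3) _ n.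
have h2 := @geometric_limitP R (fun n => Imc (picard n z)) (m * wt z.2 ^+ 3) _ n.
rewrite (_ : 4 * m / 2 ^+ n * wt z.2 ^+ 3 = 2 * (m * wt z.2 ^+ 3) / 2 ^+ n +
  2 * (m * wt z.2 ^+ 3) / 2 ^+ n); last by ring.
apply: lerD; [apply: h1|apply: h2] => k; apply: le_trans (picard_step k z).
  by rewrite -ReB Re_le_normc.
by rewrite -ImB Im_le_normc.
Qed.

(** [2 m] bounds an iterate and [4 m] its distance to the limit; measurability passes to pointwise
    limits. *)
Lemma picard_limit_bounded : path_bounded (6 * m) picard_limit.
Proof.
split.
  split.
    apply: (@measurable_fun_cvg _ _ _ setT (fun n z => Rec (picard n z))).
      by move=> n; case: (picard_bounded n) => -[].
    move=> z _; apply: geometric_limit_cvg => k; apply: le_trans (picard_step k z).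
    by rewrite -ReB Re_le_normc.
  apply: (@measurable_fun_cvg _ _ _ setT (fun n z => Imc (picard n z))).
    by move=> n; case: (picard_bounded n) => -[].
  move=> z _; apply: geometric_limit_cvg => k; apply: le_trans (picard_step k z).
  by rewrite -ImB Im_le_normc.
move=> z; rewrite -[picard_limit z](subKr (picard 0 z)) (le_trans (normcB _ _))//.
have := picard_limit_dist 0 z; have := (picard_bounded 0).2 z.
rewrite expr0 divr1; lra.
Qed.

Lemma picard_limit_fixed z : picard_limit z = L z + duhamel_sqr picard_limit z.
Proof.
apply/eqP; rewrite -subr_eq0; apply/eqP; apply: normc0_eq.
apply: (@le0_geometric _ _ ((4 * m + K * (2 * (6 * m) * (4 * m))) * wt z.2 ^+ 3)) => n.
have P6 : path_bounded (6 * m) (picard n).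
  by apply: path_boundedW (picard_bounded n); rewrite ler_wpM2r// ler_nat.
have := picard_limit_dist n.+1 z; rewrite picardS => h1.
have h2 := duhamel_sqr_diff P6 picard_limit_bounded (picard_limit_dist n) z.
set a := duhamel_sqr picard_limit z in h2 *; set b := duhamel_sqr (picard n) z in h1 h2.
set p := picard_limit z in h1 *; set l := L z in h1 *.
have -> : p - (l + a) = (b - a) - (l + b - p) by ring.
apply: le_trans (normcB _ _) _; apply: le_trans (lerD h2 h1) _.
set w := wt z.2 ^+ 3; set q := 2 ^+ n.
have w0 : 0 <= w by rewrite exprn_ge0// wt_ge0.
have q0 : 0 < q by rewrite exprn_gt0.
rewrite exprS -/q [leRHS]mulrAC mulrDl addrC [X in _ <= X * _]mulrDl [leRHS]mulrDl.
apply: lerD; last by rewrite le_eqVlt; apply/orP; left; apply/eqP; field; rewrite gt_eqF.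
rewrite ler_wpM2r// invfM mulrA ler_wpM2r ?invr_ge0 ?(ltW q0)//.
by have := m_ge0; move=> *; lra.
Qed.

Lemma picard_limit_sym : (forall t xi, L (t, - xi) = conjc (L (t, xi))) ->
  forall t xi, picard_limit (t, - xi) = conjc (picard_limit (t, xi)).
Proof.
move=> LS t xi.
have PS n s eta : picard n (s, - eta) = conjc (picard n (s, eta)).
  elim: n s eta => [|n IH] s eta; first exact: LS.
  rewrite !picardS.
  have cb := conv_bounded (picard_bounded n) (picard_bounded n).
  have -> : duhamel_sqr (picard n) (s, - eta) = conjc (duhamel_sqr (picard n) (s, eta)).
    apply: duhamel_sym cb _ => tau; apply: conv_sym.
    - by case: (picard_bounded n).
    - exact: IH.
    - exact: (conv_kernel_integrable _ (picard_bounded n) (picard_bounded n)).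
  by rewrite LS; apply: complex_eq; rewrite !reimE ?opprD.
apply/eqP; rewrite -subr_eq0; apply/eqP; apply: normc0_eq.
apply: (@le0_geometric _ _ (8 * m * wt xi ^+ 3)) => n.
have h1 := picard_limit_dist n (t, - xi); have h2 := picard_limit_dist n (t, xi).
move: h1 h2; rewrite -[(t, - xi).2]/(- xi) -[(t, xi).2]/xi wtN => h1 h2.
move: h1 h2; rewrite PS; set p := picard n (t, xi); set q := picard_limit (t, xi).
set r := picard_limit (t, - xi) => h1 h2.
have -> : r - conjc q = conjc (p - q) - (conjc p - r).
  by apply: complex_eq; rewrite !reimE; ring.
rewrite (le_trans (normcB _ _))// normc_conj.
by move: h1 h2; lra.
Qed.

(** The fixed point differs from [L] by at most [K (6 m)^2]; inserted in the Lipschitz bound at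
    radius [6 m] this gives [12 * 36 = 432]. *)
Lemma picard_limit_expansion z :
  normc (picard_limit z - L z - duhamel_sqr L z) <= 432 * K ^+ 2 * m ^+ 3 * wt z.2 ^+ 3.
Proof.
have L6 : path_bounded (6 * m) L.
  by apply: path_boundedW L_bounded; rewrite ler_peMl// ler1n.
have h1 y : normc (picard_limit y - L y) <= K * (6 * m) ^+ 2 * wt y.2 ^+ 3.
  rewrite {1}picard_limit_fixed addrC addKr.
  exact: (duhamel_sqr_bounded picard_limit_bounded).2.
rewrite {1}picard_limit_fixed [L z + _]addrC addrK.
apply: le_trans (duhamel_sqr_diff picard_limit_bounded L6 h1 z) _.
rewrite ler_wpM2r ?exprn_ge0 ?wt_ge0// le_eqVlt; apply/orP; left; apply/eqP; ring.
Qed.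

End Picard.

(** * The Duhamel integral tested against Schwartz functions *)

Section TestedDuhamel.
Variables (R : realType) (T : R).
Hypothesis T_ge0 : 0 <= T.
Let mu := @lebesgue_measure R.
Implicit Types (t tau xi D : R) (f : R * R -> R[i]) (g : R -> R[i]).

Lemma imagE (x : R) : imag x = imag 1 * x%:C.
Proof. by apply: complex_eq; rewrite !reimE; ring. Qed.

Lemma schwartz_imag g : schwartz g -> schwartz (fun x => imag x * g x).
Proof.
move=> S; rewrite (_ : (fun _ => _) = fun x => imag 1 * (x%:C * g x)).
  exact/schwartzZ/schwartzX.
by apply/funext => x; rewrite imagE mulrA.
Qed.

Definition duhamel_pairing f g t tau : R[i] := cintegral setT (fun xi =>
  (((2 * pi)^-1)%:C * f (tau, xi)) * (imag xi * (kdvb_symbol (t - tau) xi * g xi))).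

Lemma wt_boundedZ k M (c : R -> R[i]) (z : R[i]) : wt_bounded k M c ->
  wt_bounded k (normc z * M) (fun x => z * c x).
Proof.
move=> [mc cM]; split; first by apply: cmfunM => //; exact: cmfun_cst.
by move=> x; rewrite Normc.normcM -mulrA ler_wpM2l ?normc_ge0.
Qed.

Lemma duhamel_pairing_integrable D f g t : path_bounded D f -> schwartz g -> 0 <= t ->
  cintegrable `[0, t]%classic (duhamel_pairing f g t).
Proof.
move=> fD Sg t0.
have [N N0 HN] := schwartz_bounded (schwartz_imag Sg).
pose C := 2 * (normc ((2 * pi)^-1)%:C * D * N * wt_mass R).
apply: (cintegrable_dom (h := cst C)) => //.
- apply: (@cmfun_cintegral R _ _ (fun z => (((2 * pi)^-1)%:C * f (z.1, z.2)) *
     (imag z.2 * (kdvb_symbol (t - z.1) z.2 * g z.2)))) => //.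
  apply: cmfunM.
    apply: cmfunM; first exact: cmfun_cst.
    by apply: cmfun_comp fD.1 _; exact: measurable_fun_pair.
  apply: cmfunM; first exact: cmfun_imag.
  apply: cmfunM; last by apply: cmfun_comp (schwartz_cmfun Sg) _.
  by apply: cmfun_symbol => //; exact: measurable_funB.
- apply: measurable_bounded_integrable => //.
    by rewrite /= lebesgue_measure_itv/=; case: ifPn => _; rewrite -?EFinB ltry.
  exists `|C|; split; first exact: num_real.
  by move=> x Cx y _ /=; rewrite ltW.
- move=> tau taut0; have /andP[tau0 taut] : 0 <= tau <= t by have := taut0; rewrite /= in_itv.
  have tt : 0 <= t - tau by rewrite subr_ge0.
  have b1 := wt_boundedZ ((2 * pi)^-1)%:C (path_bounded_slice tau fD).
  apply: (@wt_bounded_cintegral_le R 2).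
  apply: wt_boundedM b1 _ _.
    apply: cmfunM; first exact: cmfun_imag.
    by apply: cmfunM; [exact: cmfun_symbol|exact: schwartz_cmfun].
  move=> xi; rewrite mulrCA Normc.normcM; apply: le_trans (HN xi).
  by rewrite ler_piMl ?normc_ge0// normc_symbol_le1.
Qed.

Lemma abs_wt_le1 (x : R) : `|x| * wt x <= 1.
Proof.
rewrite ler_pdivrMr ?oneD_sqr_gt0// mul1r -[x ^+ 2]real_normK ?num_real//.
by have := normr_ge0 x; nra.
Qed.

(** [duhamel] integrates in time after the pairing, [duhamel_op] before it; Fubini reconciles the
    two. *)
Lemma duhamel_tested D f g t : path_bounded D f -> schwartz g -> 0 <= t <= T ->
  cintegral setT (fun xi => duhamel_op T f (t, xi) * g xi) =
  - (2^-1)%:C * cintegral `[0, t]%classic (duhamel_pairing f g t).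
Proof.
move=> fD Sg tT; have [t0 tT'] := andP tT; have D0 := path_bounded_ge0 fD.
have [N N0 HN] := schwartz_bounded Sg.
pose k : R[i] := (- (4 * pi)^-1)%:C.
pose F (z : R * R) := k * imag z.1 * g z.1 * duhamel_kernel T f ((t, z.1), z.2).
transitivity (cintegral setT (fun xi => cintegral setT (fun tau => F (xi, tau)))).
  apply: eq_cintegral => xi _; rewrite /F.
  rewrite -[RHS]/(cintegral setT (fun tau =>
    k * imag xi * g xi * duhamel_kernel T f ((t, xi), tau))).
  rewrite cintegralM//; last by exact: duhamel_kernel_integrable fD.
  by rewrite /duhamel_op /k -[(t, xi).2]/xi mulrAC.
pose C := (4 * pi)^-1 * N * D.
have C0 : 0 <= C by rewrite !mulr_ge0 ?fourpi_ge0.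
rewrite (@cfubini R F (fun xi tau => C * wt xi ^+ 1 * \1_(`[0, T]%classic) tau)
  (fun xi => C * T * wt xi ^+ 1)).
- rewrite -cintegralM//; last exact: duhamel_pairing_integrable fD Sg t0.
  rewrite [RHS]cintegral_mkcond; apply: eq_cintegral => tau _.
  have [a|a] := boolP (0 <= tau <= t); last first.
    rewrite indicE memNset ?mul0r; last by rewrite /= in_itv /=; exact/negP.
    rewrite (_ : (fun _ => _) = cst 0).
      by apply: complex_eq; rewrite /= /Rintegral integral0.
    apply/funext => xi; rewrite /F /duhamel_kernel /causal /=.
    rewrite (_ : [&& _, _ & _] = false) ?mul0r ?mulr0//.
    by apply/negbTE/negP => /and3P[a1 a2 _]; move: a; rewrite a1 a2.
  have [a1 a2] := andP a.
  rewrite indicE mem_set ?rmorph1 ?mul1r; last by rewrite /= in_itv /= a1 a2.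
  rewrite /duhamel_pairing -cintegralM//; last first.
    have b1 := wt_boundedZ ((2 * pi)^-1)%:C (path_bounded_slice tau fD).
    apply: spectral_integrable b1 _; apply: schwartz_imag; apply: schwartz_symbol => //.
    by rewrite subr_ge0.
  apply: eq_cintegral => xi _; rewrite /F /duhamel_kernel /causal a1 a2 tT' /= rmorph1.
  have -> : k = - (2^-1)%:C * ((2 * pi)^-1)%:C.
    rewrite /k -rmorphN -rmorphM; congr (_%:C).
    by rewrite !invfM; move: (pi^-1) => w; field.
  by rewrite mul1r; ring.
- apply: cmfunM.
    apply: cmfunM; last by apply: cmfun_comp (schwartz_cmfun Sg) _.
    by apply: cmfunM; [exact: cmfun_cst|exact: cmfun_imag].
  apply: cmfun_comp (cmfun_duhamel_kernel T fD.1) _.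
  by apply: measurable_fun_pair => //; exact: measurable_fun_pair.
- exact: integrable_cst_wt.
- by move=> xi; apply: integrable_scale; exact: (integrable_indic_itv 0 T true).
- move=> xi tau; rewrite /F -[(xi, tau).1]/xi -[(xi, tau).2]/tau.
  have h1 := normc_duhamel_kernel T t xi tau fD.
  move: (duhamel_kernel T f _) h1 => d h1; rewrite !Normc.normcM.
  rewrite [normc k]normc_real normrN (ger0_norm (fourpi_ge0 R)) normc_imag.
  have h2 : D * wt xi ^+ 3 * heat_weight T t xi tau <= D * wt xi ^+ 3 * \1_(`[0, T]%classic) tau.
    by rewrite ler_wpM2l ?heat_weight_le// mulr_ge0 ?exprn_ge0 ?wt_ge0.
  have h3 := le_trans h1 h2.
  set i := \1_(`[0, T]%classic) tau in h2 h3 *.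
  have i0 : 0 <= i by rewrite /i indicE.
  apply: (@le_trans _ _ ((4 * pi)^-1 * `|xi| * N * (D * wt xi ^+ 3 * i))).
    by rewrite ler_pM ?mulr_ge0 ?normc_ge0 ?fourpi_ge0// ler_pM ?mulr_ge0 ?normc_ge0 ?fourpi_ge0.
  (* Of the three powers of the weight, one absorbs [|xi|], one is bounded by 1 and one is kept for
     integrability. *)
  rewrite [leLHS](_ : _ = C * wt xi ^+ 1 * i * ((`|xi| * wt xi) * wt xi)); last by rewrite /C; ring.
  rewrite ler_piMr ?mulr_ge0 ?exprn_ge0 ?wt_ge0 ?fourpi_ge0//.
  by rewrite mulr_ile1 ?mulr_ge0 ?wt_ge0 ?wt_le1 ?abs_wt_le1.
- move=> xi; rewrite RintegralZl//; last exact: (integrable_indic_itv 0 T true).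
  rewrite (@Rintegral_indic_itv R 0 T true)// subr0; lra.
Qed.

End TestedDuhamel.

(** * The fixed point solves the equation *)

Section Solution.
Variables (R : realType) (T : R).
Hypothesis T_ge0 : 0 <= T.
Variables (c : R -> R[i]) (m : R).
Hypothesis c_bounded : wt_bounded 3 m c.
Let K := duhamel_const T * conv_const R.
Hypothesis m_small : 8 * K * m <= 1.
Let mu := @lebesgue_measure R.
Implicit Types (t xi : R).

Let m_ge0 : 0 <= m. Proof. exact: wt_bounded_ge0 c_bounded. Qed.

(** At [tau = 0] the cut-off [causal] is the indicator function of [0 <= t <= T]. *)
Definition free_path (z : R * R) : R[i] :=
  (causal T z.1 0)%:C * (kdvb_symbol z.1 z.2 * c z.2).

Lemma free_pathE t xi : 0 <= t <= T -> free_path (t, xi) = kdvb_symbol t xi * c xi.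
Proof. by move=> /andP[t0 tT]; rewrite /free_path /causal /= lexx t0 tT rmorph1 mul1r. Qed.

Lemma free_path_bounded : path_bounded m free_path.
Proof.
case: c_bounded => mc cm; split.
  apply: cmfunM; first by apply: cmfun_real; apply: measurable_causal => //; exact: measurable_cst.
  apply: cmfunM; first exact: cmfun_symbol.
  exact: cmfun_comp mc _.
move=> [t xi]; rewrite /free_path /causal -[(t, xi).2]/xi -[(t, xi).1]/t.
case: ifPn => [/and3P[_ t0 _]|_]; last first.
  rewrite mul0r normcE /= expr0n addr0 sqrtr0 mulr_ge0 ?exprn_ge0 ?wt_ge0//.
rewrite rmorph1 mul1r Normc.normcM; apply: le_trans (cm xi).
by rewrite ler_piMl ?normc_ge0 ?normc_symbol_le1.
Qed.

Definition solution_path : R * R -> R[i] := picard_limit T free_path m.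

Let sol := solution_path.

Lemma solution_path_bounded : path_bounded (6 * m) sol.
Proof. exact: (picard_limit_bounded T_ge0 free_path_bounded m_small). Qed.

Lemma solution_pathE t xi : 0 <= t <= T ->
  sol (t, xi) = kdvb_symbol t xi * c xi + duhamel_op T (conv sol sol) (t, xi).
Proof.
move=> tT; rewrite -free_pathE//.
exact: (picard_limit_fixed T_ge0 free_path_bounded m_small).
Qed.

Lemma solution_path_sym : (forall xi, c (- xi) = conjc (c xi)) ->
  forall t xi, sol (t, - xi) = conjc (sol (t, xi)).
Proof.
move=> cs; apply: (picard_limit_sym T_ge0 free_path_bounded m_small) => t xi.
rewrite /free_path /= conjcM conjc_ofreal [conjc (kdvb_symbol _ _ * _)]conjcM.
by rewrite symbol_conj cs.
Qed.

Let sol_conv := conv_bounded solution_path_bounded solution_path_bounded.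

Lemma solution_path_expansion t xi :
  normc (sol (t, xi) - free_path (t, xi) - duhamel_op T (conv free_path free_path) (t, xi)) <=
  432 * K ^+ 2 * m ^+ 3 * wt xi ^+ 3.
Proof. exact: (picard_limit_expansion T_ge0 free_path_bounded m_small (t, xi)). Qed.

Definition solution t : distr R := spectral (fun xi => sol (t, xi)).

Lemma eq_cintegrable (D : set R) (f g : R -> R[i]) : measurable D ->
  (forall x, D x -> f x = g x) -> cintegrable D f -> cintegrable D g.
Proof.
move=> mD fg [f1 f2]; split.
  by apply: eq_integrable f1 => // x /set_mem Dx; rewrite fg.
by apply: eq_integrable f2 => // x /set_mem Dx; rewrite fg.
Qed.

Lemma solution_duhamel : duhamel T (spectral c) solution.
Proof.
exists (fun t => spectral (fun xi => ((2 * pi)^-1)%:C * conv sol sol (t, xi))).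
have wb t := wt_boundedZ ((2 * pi)^-1)%:C (path_bounded_slice t sol_conv).
split.
  apply: aeW => t _; exists (ifourier (fun xi => sol (t, xi))); split.
    exact: spectral_is_fun (path_bounded_slice t solution_path_bounded).
  rewrite (_ : (fun x => ifourier _ x ^+ 2) =
    ifourier (fun xi => ((2 * pi)^-1)%:C * conv sol sol (t, xi))).
    exact: spectral_is_fun (wb t).
  by apply/funext => x; exact: ifourier_sqr solution_path_bounded.
move=> t phi; rewrite in_itv /= => tT S; have [t0 tT'] := andP tT.
have Sg := schwartz_ifourier S.
have E tau : `[0, t]%classic tau ->
    duhamel_pairing (conv sol sol) (ifourier phi) t tau =
    kdvb_semigroup (t - tau) (distr_dx (spectral (fun xi =>
      ((2 * pi)^-1)%:C * conv sol sol (tau, xi)))) phi.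
  rewrite /= in_itv /= => /andP[_ taut].
  by rewrite (spectral_semigroup_dx (wb tau))// subr_ge0.
have ip := duhamel_pairing_integrable sol_conv Sg t0.
split; first exact: eq_cintegrable E ip.
rewrite -(eq_cintegral E) spectral_semigroup// -mulNr.
rewrite -(duhamel_tested T_ge0 sol_conv Sg tT) /solution /spectral -cintegralD//.
- by apply: eq_cintegral => xi _; rewrite solution_pathE// mulrDl; ring.
- exact: spectral_integrable c_bounded (schwartz_symbol t0 Sg).
- exact: spectral_integrable (path_bounded_slice t (duhamel_bounded T_ge0 sol_conv)) Sg.
Qed.

(** This is where the third power of the weight matters: the left polynomial bounds the increment of
    the symbol, its cubic part comes from the dispersion, and two powers would leave decay like
    [1 / |x|] only. *)
Lemma wt_absorb (x : R) : (x ^+ 2 + 2 * `|x| ^+ 3) * wt x ^+ 3 <= 3 * wt x.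
Proof.
have w0 := wt_ge0 x; have w1 := wt_le1 x; have a1 := abs_wt_le1 x.
have b1 : x ^+ 2 * wt x <= 1 by rewrite ler_pdivrMr ?oneD_sqr_gt0// mul1r lerDr.
have b0 : 0 <= x ^+ 2 * wt x by rewrite mulr_ge0// sqr_ge0.
have a0 : 0 <= `|x| * wt x by rewrite mulr_ge0.
rewrite (_ : _ * wt x ^+ 3 = ((x ^+ 2 * wt x) * wt x + 2 * ((x ^+ 2 * wt x) * (`|x| * wt x))) * wt x); last first.
  by rewrite -[x ^+ 2]real_normK ?num_real//; ring.
rewrite ler_wpM2r//.
have : (x ^+ 2 * wt x) * wt x <= 1 by rewrite mulr_ile1.
have : (x ^+ 2 * wt x) * (`|x| * wt x) <= 1 by rewrite mulr_ile1.
lra.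
Qed.

Lemma solution_path_lipschitz : exists2 C : R, 0 <= C &
  forall t t' xi, 0 <= t <= T -> 0 <= t' <= T ->
  normc (sol (t', xi) - sol (t, xi)) <= C * `|t' - t| * wt xi.
Proof.
set D := conv_const R * (6 * m * (6 * m)).
have D0 : 0 <= D by exact: path_bounded_ge0 sol_conv.
pose C := 18 * m + (4 * pi)^-1 * 2 * D.
have C0 : 0 <= C.
  apply: addr_ge0; first by rewrite mulr_ge0.
  by apply: mulr_ge0 D0; rewrite mulr_ge0 ?fourpi_ge0.
exists C => // t t' xi.
wlog tt' : t t' / t <= t'.
  move=> H; have [|/ltW] := leP t t'; first exact: H.
  move=> h tT t'T; rewrite -normcN opprB distrC; exact: H.
move=> tT t'T; have [t0 tT'] := andP tT; have [t'0 t'T'] := andP t'T.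
have h0 : 0 <= t' - t by rewrite subr_ge0.
have st := duhamel_step xi sol_conv t0 tt' t'T'.
rewrite !solution_pathE//; move: st.
set b' := duhamel_op T _ (t', xi); set b := duhamel_op T _ (t, xi) => st.
have -> : kdvb_symbol t' xi = kdvb_symbol (t' - t) xi * kdvb_symbol t xi.
  by rewrite -symbolD subrK.
set s := kdvb_symbol (t' - t) xi in st *; set r := kdvb_symbol t xi.
(* Restarting at time [t]: the increment is the action of [s - 1] on the solution at [t], plus the
   source between [t] and [t']. *)
have -> : s * r * c xi + b' - (r * c xi + b) = (s - 1) * (r * c xi + b) + (b' - s * b) by ring.
rewrite (le_trans (normcD _ _))// (ger0_norm h0) /C [_ * (t' - t)]mulrDl [leRHS]mulrDl lerD//.
  rewrite Normc.normcM /r /b -solution_pathE//.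
  have := ler_pM (normc_ge0 _) (normc_ge0 _) (symbol_sub1 xi h0) (solution_path_bounded.2 (t, xi)).
  rewrite -/s -[(t, xi).2]/xi => /le_trans; apply.
  have := ler_wpM2l (mulr_ge0 h0 m_ge0) (wt_absorb xi); lra.
apply: (le_trans st); rewrite (_ : wt xi ^+ 3 = wt xi * wt xi * wt xi); last by ring.
rewrite [leLHS](_ : _ = (4 * pi)^-1 * 2 * D * (t' - t) * wt xi * ((`|xi| * wt xi) * wt xi)); last by rewrite /D; ring.
rewrite ler_piMr ?mulr_ge0 ?fourpi_ge0 ?wt_ge0 ?wt_mass_ge0//.
by rewrite mulr_ile1 ?mulr_ge0 ?wt_ge0 ?wt_le1 ?abs_wt_le1.
Qed.

End Solution.

(** * The amalgam norm *)

Section LnormBounds.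
Context d {X : measurableType d} {R : realType}.
Variable m : {measure set X -> \bar R}.
Local Open Scope ereal_scope.
Implicit Types (f : X -> R).

Lemma le_poweR (r : R) (x y : \bar R) : (0 <= r)%R -> 0 <= x -> x <= y -> x `^ r <= y `^ r.
Proof.
move=> r0 x0 xy; apply: gt0_ler_poweR => //; rewrite in_itv/= leey andbT//.
exact: le_trans xy.
Qed.

Lemma poweR_root (r : R) (x : \bar R) (s : R) : (1 <= r)%R -> (0 <= s)%R -> 0 <= x ->
  x <= (s `^ r)%:E -> x `^ r^-1 <= s%:E.
Proof.
move=> r1 s0 x0 h; have r0 : (0 < r)%R by exact: lt_le_trans r1.
have -> : s%:E = (s `^ r)%:E `^ r^-1.
  by rewrite poweR_EFin -powRrM mulfV ?gt_eqF// powRr1.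
by apply: le_poweR => //; rewrite invr_ge0 ltW.
Qed.

Lemma powR_pred (r x : R) : (0 <= x -> 1 <= r -> x `^ r = x `^ (r - 1) * x)%R.
Proof.
move=> x0 r1; rewrite -[X in (_ * X)%R](powRr1 x0) -powRD ?subrK//.
by rewrite gt_eqF// (lt_le_trans _ r1).
Qed.

Lemma integralZl_EFin f (c : R) : measurable_fun setT f -> (forall x, 0 <= f x)%R ->
  (0 <= c)%R -> \int[m]_x (c%:E * (f x)%:E) = c%:E * \int[m]_x (f x)%:E.
Proof.
move=> mf f0 c0; rewrite ge0_integralZl// => [|x _].
- exact/measurable_EFinP.
- by rewrite lee_fin.
Qed.

(** The embedding of l^1 into l^q: a function bounded by its own integral [S], as every summable
    function on the integers is, satisfies [f^r <= S^(r - 1) f]. *)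
Lemma Lnorm_le_integral (q : \bar R) f : measurable_fun setT f ->
  (forall x, 0 <= f x)%R -> (forall x, (f x)%:E <= \int[m]_y (f y)%:E) -> 1 <= q ->
  Lnorm m q (EFin \o f) <= \int[m]_y (f y)%:E.
Proof.
move=> mf f0 fS q1; have f0e x : 0 <= (f x)%:E by rewrite lee_fin.
set S := \int[m]_y (f y)%:E.
have [->|Sy] := eqVneq S +oo; first exact: leey.
have S0 : 0 <= S by apply: integral_ge0 => x _; rewrite lee_fin.
have /fineK Sf : S \is a fin_num by rewrite ge0_fin_numE// ltey.
set s := fine S in Sf; have s0 : (0 <= s)%R by exact: fine_ge0.
have fs x : (f x <= s)%R by rewrite -lee_fin Sf fS.
rewrite -Sf unlock; case: q q1 => [r||] //.
- rewrite lee_fin => r1; have r0 : (0 < r)%R by exact: lt_le_trans r1.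
  apply: poweR_root => //; first by apply: integral_ge0 => x _; exact: poweR_ge0.
  have -> : (s `^ r)%:E = \int[m]_x ((s `^ (r - 1))%:E * (f x)%:E).
    rewrite integralZl_EFin ?powR_ge0// -/S -Sf -EFinM.
    by rewrite -powR_pred.
  apply: ge0_le_integral => //.
  + by move=> x _; exact: poweR_ge0.
  + apply: (@measurableT_comp _ _ _ _ _ _ (fun y : \bar R => y `^ r)) => //.
      exact: measurable_poweR.
    by apply: measurableT_comp => //; exact/measurable_EFinP.
  + by under eq_fun do rewrite -EFinM; apply/measurable_EFinP; exact: measurable_funM.
  + move=> x _; rewrite /comp gee0_abs ?f0e// poweR_EFin -EFinM lee_fin.
    rewrite (powR_pred (f0 x) r1) ler_wpM2r// ge0_ler_powR ?nnegrE//.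
    by rewrite subr_ge0.
- move=> _; case: ifPn => [m0|_]; last by rewrite lee_fin.
  apply/ess_supP; apply: aeW => x /=; rewrite ger0_norm// lee_fin; exact: fs.
Qed.

Lemma Lnorm_indic_le (p : \bar R) (B : set X) f (M : R) : measurable B -> m B = 1 ->
  measurable_fun setT f -> (forall x, 0 <= f x)%R -> (forall x, B x -> f x <= M)%R ->
  (0 <= M)%R -> 1 <= p -> Lnorm m p (fun x => (\1_B x * f x)%:E) <= M%:E.
Proof.
move=> mB B1 mf f0 fM M0 p1; rewrite unlock; case: p p1 => [r||] //.
- rewrite lee_fin => r1; have r0 : (0 < r)%R by exact: lt_le_trans r1.
  apply: poweR_root => //; first by apply: integral_ge0 => x _; exact: poweR_ge0.
  have -> : (M `^ r)%:E = \int[m]_x ((M `^ r)%:E * (\1_B x)%:E).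
    by rewrite integralZl_EFin ?powR_ge0// integral_indic// setIT B1 mule1.
  apply: ge0_le_integral => //.
  + by move=> x _; exact: poweR_ge0.
  + apply: (@measurableT_comp _ _ _ _ _ _ (fun y : \bar R => y `^ r)) => //.
      exact: measurable_poweR.
    by apply: measurableT_comp => //; apply/measurable_EFinP; exact: measurable_funM.
  + by under eq_fun do rewrite -EFinM; apply/measurable_EFinP; exact: measurable_funM.
  + move=> x _; rewrite gee0_abs; last (by rewrite lee_fin mulr_ge0); rewrite poweR_EFin -EFinM lee_fin indicE.
    have [/set_mem Bx|_] := boolP (x \in B); last first.
      by rewrite mul0r mulr0 powR0 ?gt_eqF.
    rewrite mul1r mulr1 ge0_ler_powR ?nnegrE ?(ltW r0)//; exact: fM.
- move=> _; case: ifPn => [m0|_]; last by rewrite lee_fin.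
  apply/ess_supP; apply: aeW => x /=; rewrite ger0_norm ?mulr_ge0// lee_fin indicE.
  have [/set_mem Bx|_] := boolP (x \in B); last by rewrite mul0r.
  by rewrite mul1r fM.
Qed.

Lemma measure_setT_gt0 (B : set X) : measurable B -> m B = 1 -> 0 < m setT.
Proof.
move=> mB B1; apply: (@lt_le_trans _ _ (m B)); first by rewrite B1 lte_fin.
by apply: le_measure; rewrite ?inE.
Qed.

(* The integrand is at most [l + l (f / l)^r] at any level [l]; take [l] to be the norm. *)
Lemma integral_indic_le_Lnorm (p : \bar R) (B : set X) f : measurable B -> m B = 1 ->
  measurable_fun setT f -> (forall x, 0 <= f x)%R -> 1 <= p ->
  \int[m]_x (\1_B x * f x)%:E <= 2%:E * Lnorm m p (fun x => (\1_B x * f x)%:E).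
Proof.
move=> mB B1 mf f0 p1; set g := fun x => (\1_B x * f x)%R.
have g0 x : (0 <= g x)%R by rewrite mulr_ge0.
have mg : measurable_fun setT g by exact: measurable_funM.
have g0e x : 0 <= (g x)%:E by rewrite lee_fin.
rewrite -[fun x => (\1_B x * f x)%:E]/(EFin \o g).
set L := Lnorm m p _; have L0 : 0 <= L by exact: Lnorm_ge0.
have [Ly|Ly] := eqVneq L +oo; first by rewrite Ly gt0_muley ?leey// lte_fin.
have [l l0 Lf] : exists2 l : R, (0 <= l)%R & L = l%:E.
  exists (fine L); first exact: fine_ge0.
  by rewrite fineK// ge0_fin_numE// ltey.
case: p p1 @L L0 Ly Lf => [r||] //.
- rewrite lee_fin => r1 L L0 Ly Lf.
  have r0 : (0 < r)%R by exact: lt_le_trans r1.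
  (* At level 0 the majorant degenerates, but then the integrand vanishes almost everywhere. *)
  have [l00|ln0] := eqVneq l 0%R.
    have : L = 0 by rewrite Lf l00.
    move=> /Lnorm_eq0_eq0; rewrite lte_fin => /(_ _ r0) ae0.
    rewrite (ae_eq_integral (cst 0)) ?integral0 ?mule_ge0//.
    - exact/measurable_EFinP.
    - by apply: ae0; exact/measurable_EFinP.
  have lgt : (0 < l)%R by rewrite lt_neqAle eq_sym ln0.
  have mp : measurable_fun setT (fun x => g x `^ r)%R.
    by apply: (@measurableT_comp _ _ _ _ _ _ (fun y : R => y `^ r)%R).
  have p0 x : (0 <= g x `^ r)%R by exact: powR_ge0.
  have c0 : (0 <= l / l `^ r)%R by rewrite divr_ge0// powR_ge0.
  have Lr : \int[m]_x (g x `^ r)%:E = (l `^ r)%:E.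
    have := poweR_Lnorm m (EFin \o g) (lt0r_neq0 r0).
    rewrite -/L Lf poweR_EFin => ->; apply: eq_integral => x _.
    by rewrite /comp gee0_abs ?g0e// poweR_EFin.
  have -> : 2%:E * L = \int[m]_x ((l * \1_B x)%:E + (l / l `^ r)%:E * (g x `^ r)%:E).
    rewrite ge0_integralD => [|//|x _||x _|]; first last.
    - by under eq_fun do rewrite -EFinM; apply/measurable_EFinP; exact: measurable_funM.
    - by rewrite -EFinM lee_fin mulr_ge0.
    - by apply/measurable_EFinP; exact: measurable_funM.
    - by rewrite lee_fin mulr_ge0.
    rewrite [X in _ = _ + X]integralZl_EFin// Lr -EFinM mulfVK ?gt_eqF ?powR_gt0//.
    under eq_integral do rewrite EFinM.
    rewrite integralZl_EFin// integral_indic// setIT B1 mule1 Lf -EFinM -EFinD.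
    by rewrite mulr2n mulrDl mul1r.
  apply: ge0_le_integral => //.
  - exact/measurable_EFinP.
  - under eq_fun do rewrite -EFinM -EFinD; apply/measurable_EFinP.
    apply: measurable_funD; first exact: measurable_funM.
    exact: measurable_funM.
  - move=> x _; rewrite -EFinM -EFinD lee_fin /g indicE.
    have [_|_] := boolP (x \in B); last first.
      by rewrite mul0r mulr0 powR0 ?gt_eqF// mulr0 addr0.
    rewrite mul1r mulr1; have [fl|/ltW lf] := leP (f x) l.
      by rewrite (le_trans fl)// lerDl mulr_ge0// powR_ge0.
    have : (f x <= l / l `^ r * f x `^ r)%R.
      have flE : f x = (l * (f x / l))%R by rewrite mulrC divfK.
      have fl1 : (1 <= f x / l)%R by rewrite ler_pdivlMr// mul1r.
      rewrite [in leRHS]flE powRM ?divr_ge0// mulrA mulfVK ?gt_eqF ?powR_gt0//.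
      rewrite [leLHS]flE ler_wpM2l// -[leLHS]powRr1 ?divr_ge0//.
      exact: ler_powR.
    by move=> h; rewrite (le_trans h)// lerDr.
- move=> _ L L0 Ly Lf.
  have m0 := measure_setT_gt0 mB B1.
  have ae : {ae m, forall x, (g x)%:E <= l%:E}.
    have := @ess_sup_ge _ _ _ m (abse \o (EFin \o g)).
    rewrite -Lf /L unlock m0; apply: filterS => x /=; by rewrite ger0_norm.
  rewrite (@le_trans _ _ (\int[m]_x (l%:E * (\1_B x)%:E)))//.
    apply: ae_ge0_le_integral => //.
    - exact/measurable_EFinP.
    - by move=> x _; rewrite -EFinM lee_fin mulr_ge0.
    - by under eq_fun do rewrite -EFinM; apply/measurable_EFinP; exact: measurable_funM.
    apply: filterS ae => x + _; rewrite -EFinM !lee_fin /g indicE.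
    by case: (x \in B); rewrite ?mulr1 ?mul1r// !(mul0r, mulr0).
  rewrite integralZl_EFin//.
  by rewrite integral_indic// setIT B1 mule1 Lf -EFinM lee_fin ler_peMl// ler1n.
Qed.

(** A point of mass one is seen by every norm, even by the essential supremum, since no null set
    contains it. *)
Lemma le_Lnorm_point (q : \bar R) (f : X -> \bar R) x : measurable [set x] ->
  m [set x] = 1 -> measurable_fun setT f -> (forall x, 0 <= f x) -> 1 <= q ->
  f x <= Lnorm m q f.
Proof.
move=> mx x1 mf f0; rewrite unlock; case: q => [r||] //.
- rewrite lee_fin => r1; have r0 : (0 < r)%R by exact: lt_le_trans r1.
  have -> : f x = (f x `^ r) `^ r^-1.
    by rewrite -poweRrM mulfV ?gt_eqF// poweRe1.
  apply: le_poweR; rewrite ?invr_ge0 ?(ltW r0) ?poweR_ge0//.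
  have -> : f x `^ r = \int[m]_(y in [set x]) cst (f x `^ r) y.
    by rewrite integral_cst// x1 mule1.
  rewrite (@eq_integral _ _ _ _ _ (fun y => `|f y| `^ r)); last first.
    by move=> y /set_mem ->; rewrite gee0_abs.
  apply: ge0_subset_integral => //.
    apply: (@measurableT_comp _ _ _ _ _ _ (fun y : \bar R => y `^ r)) => //.
      exact: measurable_poweR.
    exact: measurableT_comp.
  by move=> y _; exact: poweR_ge0.
- move=> _; rewrite (measure_setT_gt0 mx x1).
  rewrite leNgt; apply/negP => h.
  have := ess_sup_ge m (abse \o f) => -[N [mN N0 HN]].
  have Nx : [set x] `<=` N.
    by move=> y ->; apply: HN; apply/negP; rewrite -ltNge (lt_le_trans h)//= gee0_abs.
  have : m [set x] <= m N by apply: le_measure; rewrite ?inE.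
  by rewrite N0 x1 lee_fin ler10.
Qed.

End LnormBounds.

(** * Unit blocks and sums over the integers *)

Section Blocks.
Variable R : realType.
Let mu := @lebesgue_measure R.
Local Open Scope ereal_scope.

(** The enumeration 0, -1, 1, -2, ...; integrals over the integers and over the blocks of the line
    become series with the same index. *)
Definition int_enum (k : nat) : int := if odd k then Negz k./2 else Posz k./2.

Lemma int_enum_inj : injective int_enum.
Proof.
move=> j k E; rewrite -(odd_double_half j) -(odd_double_half k); move: E; rewrite /int_enum.
by case: (odd j); case: (odd k) => // -[->].
Qed.

Lemma int_enum_surj (n : int) : exists k, int_enum k = n.
Proof.
case: n => n; first by exists n.*2; rewrite /int_enum odd_double doubleK.
by exists n.*2.+1; rewrite /int_enum /= odd_double /= uphalf_double.
Qed.

Lemma counting1 (n : int) : (counting [set n] : \bar R) = 1.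
Proof. by rewrite /counting/= asboolT// fset_set1 finmap.cardfs1. Qed.

Lemma integral_counting (f : int -> \bar R) : (forall n, 0 <= f n) ->
  \int[counting]_n f n = \sum_(k <oo) f (int_enum k).
Proof.
move=> f0; have -> : [set: int] = \bigcup_k [set int_enum k].
  by apply/seteqP; split => // n _; have [k kn] := int_enum_surj n; exists k.
rewrite ge0_integral_bigcup//.
  apply: eq_eseriesr => k _.
  rewrite (@eq_integral _ _ _ _ _ (cst (f (int_enum k)))); last by move=> n /set_mem ->.
  by rewrite integral_cst// [X in _ * X]counting1 mule1.
by apply/trivIsetP => j k _ _ jk; apply/seteqP; split => // n [-> /= /int_enum_inj/eqP]; rewrite (negbTE jk).
Qed.

Lemma block_mem (n : int) (x : R) :
  unit_block n x <-> (n%:~R - 2^-1 < x <= n%:~R + 2^-1)%R.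
Proof. by rewrite /unit_block /= in_itv. Qed.

Lemma measurable_block (n : int) : measurable (unit_block n : set R).
Proof. exact: measurable_itv. Qed.

Lemma measure_block (n : int) : mu (unit_block n) = 1.
Proof.
have : mu [set` `](n%:~R - 2^-1 : R)%R, (n%:~R + 2^-1)%R]] = 1.
  rewrite /mu lebesgue_measure_itv/= lte_fin ifT; last lra.
  by rewrite -EFinB; congr (_%:E); lra.
by [].
Qed.

Lemma block_exists (x : R) : exists n, unit_block n x.
Proof.
(* Blocks are open on the left and closed on the right, which calls for the ceiling of [x - 1/2]. *)
exists (Num.ceil (x - 2^-1)); apply/block_mem.
have := ceil_ge (x - 2^-1)%R; have := ceilB1_lt (x - 2^-1)%R.
rewrite intrD; move=> *; lra.
Qed.

Lemma block_uniq (m n : int) (x : R) : unit_block m x -> unit_block n x -> m = n.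
Proof.
move=> /block_mem mx /block_mem nx.
suff : (`|m - n| < 1)%R by case: (m - n)%R (subrK n m) => [[|//]|//] <- _; rewrite add0r.
rewrite ltr_norml -!(ltr_int R) intrD !mulrNz; lra.
Qed.

Lemma integral_blocks (f : R -> \bar R) : measurable_fun setT f -> (forall x, 0 <= f x) ->
  \int[mu]_x f x = \sum_(k <oo) \int[mu]_(x in unit_block (int_enum k)) f x.
Proof.
move=> mf f0.
have U : [set: R] = \bigcup_k (unit_block (int_enum k)).
  apply/seteqP; split => // x _; have [n nx] := block_exists x.
  by have [k kn] := int_enum_surj n; exists k => //; rewrite kn.
rewrite [in LHS]U ge0_integral_bigcup//.
- by move=> k; exact: measurable_block.
- by rewrite -U.
apply/trivIsetP => j k _ _ jk; apply/seteqP; split => // x [jx kx].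
by have /int_enum_inj/eqP := block_uniq jx kx; rewrite (negbTE jk).
Qed.

Lemma wt_block (n : int) (x : R) : unit_block n x ->
  (wt x <= 3 * wt n%:~R /\ wt n%:~R <= 3 * wt x)%R.
Proof.
move=> /block_mem; set y := n%:~R => xy.
have H (a b : R) : (`|a - b| <= 2^-1 -> wt a <= 3 * wt b)%R.
  move=> ab; rewrite /wt ler_pdivlMr ?oneD_sqr_gt0// mulrC ler_pdivrMr ?oneD_sqr_gt0//.
  have d2 : ((a - b) ^+ 2 <= 4^-1)%R.
    rewrite -real_normK ?num_real// (_ : 4^-1 = 2^-1 ^+ 2)%R; last by field.
    by rewrite lerXn2r ?nnegrE ?invr_ge0.
  by have := sqr_ge0 (2 * a - b)%R; have := sqr_ge0 a; nra.
by split; apply: H; rewrite ler_norml; lra.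
Qed.

(** An integral test: [wt n] is at most three times [wt] on the whole block around [n]. *)
Lemma sum_wt : \int[counting]_n (wt (n%:~R : R))%:E <= (3 * wt_mass R)%:E.
Proof.
rewrite integral_counting => [|n]; last by rewrite lee_fin wt_ge0.
have -> : (3 * wt_mass R)%:E = \int[mu]_x (3 * wt x)%:E.
  under eq_integral do rewrite EFinM.
  rewrite ge0_integralZl//; last by move=> x _; rewrite lee_fin wt_ge0.
    rewrite EFinM /wt_mass /Rintegral fineK//.
    exact: integrable_fin_num (integrable_wt R).
  by apply/measurable_EFinP; exact: measurable_wt.
rewrite integral_blocks => [|//|x]; last by rewrite lee_fin mulr_ge0 ?wt_ge0.
  apply: lee_nneseries => [k _ _|k _]; first by rewrite lee_fin wt_ge0.
  set n := int_enum k.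
  have -> : (wt (n%:~R : R))%:E = \int[mu]_(x in unit_block n) (cst (wt (n%:~R : R))%:E x).
    by rewrite integral_cst; [rewrite [X in _ * X]measure_block mule1|exact: measurable_block].
  apply: ge0_le_integral => //.
  - exact: measurable_block.
  - by move=> x _; rewrite lee_fin wt_ge0.
  - apply/measurable_EFinP; apply: measurable_funM => //.
    exact: measurable_funTS (@measurable_wt R).
  - by move=> x /wt_block[_ h]; rewrite lee_fin.
by apply/measurable_EFinP; apply: measurable_funM => //; exact: measurable_wt.
Qed.

Lemma japanese_ge1 (n : int) : (1 <= japanese R n)%R.
Proof. by rewrite /japanese -[leLHS]sqrtr1 ler_wsqrtr// lerDl sqr_ge0. Qed.

Lemma japanese_sqr (n : int) : (japanese R n ^+ 2 = 1 + n%:~R ^+ 2)%R.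
Proof. by rewrite sqr_sqrtr// ltW// oneD_sqr_gt0. Qed.

(** At an integer [wt] is the bracket to the power [-2], so any [k] with [2 k >= - s] is
    suitable. *)
Lemma wt_le_japanese (s : R) : exists k, forall n : int,
  (wt (n%:~R : R) ^+ k <= japanese R n `^ s)%R.
Proof.
exists (Num.bound `|s|) => n; set k := Num.bound `|s|.
have J1 := japanese_ge1 n; have J0 : (0 < japanese R n)%R by exact: lt_le_trans J1.
have sk : (- (2 * k)%:R <= s)%R.
  rewrite lerNl (le_trans (ler_norm _))// normrN (le_trans (ltW (archi_boundP (normr_ge0 s))))//.
  by rewrite ler_nat leq_pmull.
apply: le_trans (ler_powR J1 sk); rewrite powRN powR_mulrn ?(ltW J0)//.
by rewrite /wt -japanese_sqr exprVn exprM.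
Qed.

End Blocks.

(** * Upper bounds and duality for the amalgam norm *)

Section AmalgamNorm.
Variables (R : realType) (p q : \bar R) (s : R).
Hypotheses (p_ge1 : (1%:E <= p)%E) (q_ge1 : (1%:E <= q)%E).
Let mu := @lebesgue_measure R.
Local Open Scope ereal_scope.

Lemma integral_ge_point (f : int -> \bar R) n : (forall n, 0 <= f n) ->
  f n <= \int[counting]_n f n.
Proof.
move=> f0; have -> : f n = \int[counting]_(k in [set n]) cst (f n) k.
  by rewrite integral_cst// [X in _ * X]counting1 mule1.
rewrite (@eq_integral _ _ _ _ _ f); last by move=> k /set_mem ->.
exact: ge0_subset_integral.
Qed.

(** On blocks of measure one the supremum dominates every L^p norm, and l^1 dominates every l^q: the
    bound is free of [p] and [q]. *)
Lemma amalgam_norm_le (g : R -> R[i]) (B : int -> R) : cmfun g ->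
  (forall n xi, unit_block n xi -> normc (g xi) <= B n)%R -> (forall n, 0 <= B n)%R ->
  amalgam_norm p q s g <= \int[counting]_n (B n * japanese R n `^ s)%:E.
Proof.
move=> mg gB B0.
have mf := measurable_normc mg.
have f0 x : (0 <= normc (g x))%R by exact: normc_ge0.
pose L n := Lnorm mu p (fun xi => (\1_(unit_block n) xi * normc (g xi))%:E).
have L0 n : 0 <= L n by exact: Lnorm_ge0.
have LB n : L n <= (B n)%:E.
  exact: (@Lnorm_indic_le _ _ R mu p _ _ _ (measurable_block n) (measure_block R n) mf f0 (gB n)).
have Lf n : (fine (L n))%:E = L n.
  by rewrite fineK// ge0_fin_numE// (le_lt_trans (LB n))// ltry.
pose t n : R := (fine (L n) * japanese R n `^ s)%R.
have t0 n : (0 <= t n)%R by rewrite mulr_ge0 ?powR_ge0// fine_ge0.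
rewrite (_ : amalgam_norm p q s g = Lnorm counting q (EFin \o t)); last first.
  by rewrite /amalgam_norm; congr Lnorm; apply/funext => n; rewrite /t /= EFinM Lf.
have t0e n : 0 <= (t n)%:E by rewrite lee_fin.
apply: (@le_trans _ _ (\int[counting]_n (t n)%:E)).
  by apply: Lnorm_le_integral => // n; exact: (integral_ge_point n t0e).
apply: ge0_le_integral => // n _; rewrite lee_fin ler_wpM2r ?powR_ge0//.
by rewrite -lee_fin Lf.
Qed.

Lemma fa_norm_le (f : distr R) (g : R -> R[i]) :
  distr_is_fun (distr_fourier f) g -> fa_norm p q s f <= amalgam_norm p q s g.
Proof. by move=> fg; apply: ereal_inf_lbound; exists g. Qed.

(** For [s <= 0] the bracket factor is at most 1. One factor 3 compares the weight on a block with
    its value at the centre, the other comes from [sum_wt]. *)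
Lemma wt_bounded_amalgam_norm (M : R) (g : R -> R[i]) : (s <= 0)%R ->
  wt_bounded 1 M g -> amalgam_norm p q s g <= (9 * wt_mass R * M)%:E.
Proof.
move=> s0 gM; have M0 := wt_bounded_ge0 gM; have [mg gb] := gM.
have b0 (n : int) : (0 <= 3 * M * wt (n%:~R : R))%R by rewrite !mulr_ge0// wt_ge0.
apply: le_trans (amalgam_norm_le mg _ b0) _.
  move=> n xi /wt_block[h _]; apply: le_trans (gb xi) _.
  by rewrite expr1 [leRHS]mulrAC [leRHS]mulrC ler_wpM2l.
apply: (@le_trans _ _ (\int[counting]_n ((3 * M)%:E * (wt (n%:~R : R))%:E))).
  apply: ge0_le_integral => //.
    by move=> n _; rewrite lee_fin mulr_ge0 ?powR_ge0.
  move=> n _; rewrite -EFinM lee_fin ler_piMr//.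
  by rewrite -(powRr0 (japanese R n)) ler_powR ?japanese_ge1.
rewrite integralZl_EFin//; last 2 first.
- by move=> n; exact: wt_ge0.
- by rewrite mulr_ge0.
apply: le_trans (lee_wpmul2l _ (sum_wt R)) _; first by rewrite lee_fin mulr_ge0.
by rewrite -EFinM lee_fin; lra.
Qed.

(** Continuity of the pairing without sharp Hoelder inequalities: on each block L^1 is at most twice
    L^p, and one weighted block norm is at most the whole norm. Of the [k + 1] powers of [wt] that
    bound [eta], [k] compensate the bracket to the power [s] and one sums over the blocks. *)
Lemma fa_norm_pairing (eta : R -> R[i]) : schwartz eta ->
  exists2 C : R, (0 < C)%R & forall f : distr R,
    (normc (f (fourier eta)))%:E <= C%:E * fa_norm p q s f.
Proof.
move=> Se; have [k Hk] := wt_le_japanese s.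
have [M M0 HM] := schwartz_wtX_bound k Se.
pose c := (M * 3 ^+ k.+1)%R; have c0 : (0 <= c)%R by rewrite mulr_ge0// exprn_ge0.
have w0 := wt_mass_ge0 R.
pose C := (2 * (2 * c * (3 * wt_mass R)) + 1)%R.
have C0 : (0 < C)%R by rewrite ltr_wpDl// !mulr_ge0.
(* [C] is positive, so it can be divided out and each representative [g] treated separately; without
   any representative the norm is [+oo]. *)
exists C => // f; rewrite -lee_pdivrMl//; apply: le_ereal_inf_tmp => _ [g fg <-].
rewrite lee_pdivrMl//.
have [mg /(_ _ Se)[ig]] := fg; rewrite {1}/distr_fourier => ->.
have A0 : 0 <= amalgam_norm p q s g by exact: Lnorm_ge0.
have [->|Ay] := eqVneq (amalgam_norm p q s g) +oo.
  by rewrite gt0_muley ?leey// lte_fin.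
have [a a0 aE] : exists2 a, (0 <= a)%R & amalgam_norm p q s g = a%:E.
  exists (fine (amalgam_norm p q s g)); first exact: fine_ge0.
  by rewrite fineK// ge0_fin_numE// ltey.
have mf := measurable_normc mg.
have f0 x : (0 <= normc (g x))%R by exact: normc_ge0.
have me := measurable_normc (schwartz_cmfun Se).
pose L n := Lnorm mu p (fun xi => (\1_(unit_block n) xi * normc (g xi))%:E).
have L0 n : 0 <= L n by exact: Lnorm_ge0.
have La n : L n * (japanese R n `^ s)%:E <= a%:E.
  rewrite -aE; apply: (le_Lnorm_point _ (counting1 R n)) => // j.
  by apply: mule_ge0; [exact: (L0 j)|rewrite lee_fin powR_ge0].
have Bl n : \int[mu]_(x in unit_block n) (normc (g x))%:E <= 2%:E * L n.
  apply: le_trans (@integral_indic_le_Lnorm _ _ R mu p _ _ (measurable_block n) (measure_block R n) mf f0 p_ge1).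
  rewrite [X in X <= _]integral_mkcond le_eqVlt; apply/orP; left; apply/eqP.
  by apply: eq_integral => x _; rewrite patchE indicE; case: ifP => _; rewrite ?mul1r ?mul0r.
pose h x := normc (g x * eta x)%R.
have mh : measurable_fun setT h by apply: measurable_normc; exact: cmfunM (schwartz_cmfun Se).
have h0 x : (0 <= h x)%R by exact: normc_ge0.
have hb n x : unit_block n x ->
    (h x <= c * wt (n%:~R : R) * japanese R n `^ s * normc (g x))%R.
  move=> /wt_block[nx _]; rewrite /h Normc.normcM mulrC ler_wpM2r//.
  rewrite (le_trans (HM x))// /c -!mulrA ler_wpM2l//.
  apply: (@le_trans _ _ ((3 * wt (n%:~R : R)) ^+ k.+1)%R).
    by rewrite lerXn2r ?nnegrE ?mulr_ge0 ?wt_ge0.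
  by rewrite exprMn ler_wpM2l ?exprn_ge0// exprS ler_wpM2l ?wt_ge0//.
have ih : \int[mu]_x (h x)%:E <= (2 * c * (3 * wt_mass R))%:E * a%:E.
  rewrite integral_blocks => [||x]; last by rewrite lee_fin.
    apply: (@le_trans _ _ (\sum_(j <oo) ((2 * c * a)%:E * (wt ((int_enum j)%:~R : R))%:E))).
      apply: lee_nneseries => [j _ _|j _].
        by apply: integral_ge0 => x _; rewrite lee_fin.
      set n := int_enum j.
      have b0 : (0 <= c * wt (n%:~R : R) * japanese R n `^ s)%R.
        by rewrite !mulr_ge0 ?wt_ge0 ?powR_ge0.
      apply: (@le_trans _ _ (\int[mu]_(x in unit_block n)
          ((c * wt (n%:~R : R) * japanese R n `^ s)%:E * (normc (g x))%:E))).
        apply: ge0_le_integral => //.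
        - exact: measurable_block.
        - by move=> x _; rewrite lee_fin.
        - by apply/measurable_EFinP; exact: measurable_funTS.
        - under eq_fun do rewrite -EFinM; apply/measurable_EFinP.
          by apply: measurable_funM => //; exact: measurable_funTS.
        - by move=> x nx; rewrite -EFinM lee_fin hb.
      rewrite ge0_integralZl//; last 3 first.
      - exact: measurable_block.
      - by apply/measurable_EFinP; exact: measurable_funTS.
      - by move=> x _; rewrite lee_fin.
      apply: le_trans (lee_wpmul2l _ (Bl n)) _; first by rewrite lee_fin.
      have -> : (2 * c * a)%:E * (wt (n%:~R : R))%:E = (2 * c * wt (n%:~R : R))%:E * a%:E.
        by rewrite -!EFinM; congr (_%:E); rewrite mulrAC.
      apply: le_trans (lee_wpmul2l _ (La n)); last by rewrite lee_fin !mulr_ge0 ?wt_ge0.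
      rewrite !muleA -!EFinM [X in _ <= X]muleC muleA -EFinM lee_wpmul2r// lee_fin.
      by rewrite le_eqVlt; apply/orP; left; apply/eqP; ring.
    rewrite nneseriesZl; last by move=> j _; rewrite lee_fin wt_ge0.
    rewrite -(integral_counting (f := fun n => (wt (n%:~R : R))%:E)); last first.
      by move=> n; rewrite lee_fin wt_ge0.
    apply: le_trans (lee_wpmul2l _ (sum_wt R)) _; first by rewrite lee_fin !mulr_ge0.
    by rewrite -!EFinM lee_fin; lra.
  exact/measurable_EFinP.
have hi : mu.-integrable setT (EFin \o h).
  apply/integrableP; split; first exact/measurable_EFinP.
  under eq_integral do rewrite /= ger0_norm//.
  by apply: le_lt_trans ih _; rewrite -EFinM ltry.
rewrite aE -EFinM lee_fin.
apply: le_trans (normc_cintegral_le measurableT (cmfunM mg (schwartz_cmfun Se)) hi _) _ => //.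
have : (\int[mu]_x h x <= 2 * c * (3 * wt_mass R) * a)%R.
  rewrite -lee_fin /Rintegral fineK; last exact: integrable_fin_num hi.
  by rewrite EFinM.
by rewrite /C; move: a0; lra.
Qed.

End AmalgamNorm.

(** * Second differences of C^2 maps *)

Section SecondDifference.
Variable R : realType.

Lemma is_derive_approx (f : R -> R) (x D : R) :
  (forall e : R, 0 < e -> exists2 d : R, 0 < d &
    forall y, `|y| < d -> `|f (x + y) - f x - y * D| <= e * `|y|) ->
  is_derive x 1 f D.
Proof.
move=> H.
have cv : h^-1 *: ((f \o shift x) (h *: 1) - f x) @[h --> (0 : R)^'] --> D.
  apply/cvgrPdist_le => e e0; have [d d0 Hd] := H e e0.
  near=> h; have h0 : h != 0 by near: h; exact: nbhs_dnbhs_neq.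
  have hd : `|h| < d.
    near: h; apply: dnbhs0_lt; exact: d0.
  have := Hd h hd; rewrite /= /shift /= scaler1 [h + x]addrC => hh.
  rewrite distrC -(ler_pM2r (x := `|h|)) ?normr_gt0// -normrM.
  by rewrite mulrBl /GRing.scale /= mulrAC mulVf// mul1r [D * h]mulrC.
apply: DeriveDef; first by apply/cvg_ex; exists D.
by apply: cvg_lim cv => //; exact: Rhausdorff.
Unshelve. all: by end_near. Qed.

(** The mean value theorem for [g x = f x + f (- x) - 2 f 0], whose derivative [D x - D (- x)] is
    controlled by comparing both terms with [D 0]. *)
Lemma second_difference_le (f D : R -> R) (M d : R) :
  (forall x : R, `|x| < d -> is_derive x 1 f (D x)) ->
  (forall x, `|x| < d -> `|D x - D 0| <= M * `|x|) ->
  forall e, 0 <= e < d -> `|f e + f (- e) - 2 * f 0| <= 2 * M * e ^+ 2.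
Proof.
move=> fD DM e /andP[e0 ed].
have [->|en0] := eqVneq e 0.
  by rewrite oppr0 expr0n mulr0 -mulr2n mulr_natl subrr normr0.
have eg : 0 < e by rewrite lt_neqAle eq_sym en0.
have M0 : 0 <= M.
  by have := le_trans (normr_ge0 _) (DM e _); rewrite ger0_norm// pmulr_lge0//; apply.
pose g x := f x + f (- x) - 2 * f 0.
have lt_d x : 0 <= x <= e -> `|x| < d.
  by move=> /andP[x0 xe]; rewrite ger0_norm// (le_lt_trans xe).
have dg (x : R) : `|x| < d -> is_derive x 1 g (D x - D (- x)).
  move=> xd; have fx := fD x xd.
  have fNx : is_derive (- x) 1 f (D (- x)) by apply: fD; rewrite normrN.
  have h : is_derive x 1 (f \o -%R) (D (- x) * -1).
    by apply: is_derive1_comp.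
  rewrite [X in is_derive _ _ _ X](_ : _ = D x + (D (- x) * -1) - 0); last by ring.
  apply: is_deriveB; exact: is_deriveD.
have [x xe] : exists2 x, x \in `]0, e[ & g e - g 0 = (D x - D (- x)) * (e - 0).
  apply: MVT => //.
    by move=> x; rewrite in_itv /= => /andP[/ltW x0 /ltW xe]; apply: dg; apply: lt_d; rewrite x0.
  apply: derivable_within_continuous => x; rewrite in_itv /= => xe.
  by have [] := dg x (lt_d x xe).
have g0 : g 0 = 0 by rewrite /g oppr0; ring.
rewrite g0 !subr0 -/(g e) => ->; move: xe; rewrite in_itv /= => /andP[x0 xe].
have xd : `|x| < d by apply: lt_d; rewrite !ltW.
have h1 := DM x xd; have h2 : `|D (- x) - D 0| <= M * `|- x| by apply: DM; rewrite normrN.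
rewrite normrN in h2.
have h3 : `|D x - D (- x)| <= 2 * (M * `|x|).
  rewrite (_ : D x - D (- x) = (D x - D 0) - (D (- x) - D 0)); last by ring.
  by rewrite (le_trans (ler_normB _ _))// mulr2n mulrDl mul1r lerD.
rewrite normrM (ger0_norm e0) expr2 mulrA ler_wpM2r// (le_trans h3)//.
by rewrite -mulrA ler_wpM2l// ler_wpM2l// ger0_norm ltW.
Qed.

Section NormedSpaces.
Variables (V W : lmodType R[i]) (X : nspace V) (Y : nspace W) (F : V -> W).
Hypotheses (X0 : carrier X 0) (norm0 : (nnorm X 0 <= 0)%E).

(* [K] and [d] are uniform in [l] and [h]: this is what makes the bound independent
   of the frequency of the data and of the time of observation. *)
Lemma C2_second_difference : C2_at_zero X Y F ->
  exists2 K : R, 0 <= K & exists2 d : R, 0 < d &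
  forall (l : W -> R) (C : R) (h : V), 0 <= C ->
    (forall x y, l (x + y) = l x + l y) -> (forall (a : R) x, l (a%:C *: x) = a * l x) ->
    (forall y, (`|l y|%:E <= C%:E * nnorm Y y)%E) ->
    (forall a : R, carrier X (a%:C *: h) /\
      (0 <= nnorm X (a%:C *: h) /\ nnorm X (a%:C *: h) <= `|a|%:E)%E) ->
    forall e, 0 <= e < d ->
      `|l (F (e%:C *: h)) + l (F ((- e)%:C *: h)) - 2 * l (F 0)| <= C * K * e ^+ 2.
Proof.
move=> [r [DF [D2F [r0 Hd _]]]].
have [_ [[_ _ [K0 HK]] fre]] := Hd 0 X0 (le_lt_trans norm0 (r0 : (0 < r%:E)%E)).
(* Tolerance 1 in the differentiability of [DF] at 0, together with the bound [K0] on [D2F 0], gives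
   [DF] a Lipschitz bound at 0 with constant [|K0| + 1]. *)
have [d d0 H1] := fre 1 ltr01.
exists (2 * (`|K0| + 1)); first by rewrite mulr_ge0// addr_ge0.
exists (Order.min r d); first by rewrite lt_min r0 d0.
move=> l C h C0 lD lZ lC Hh.
have l0 : l 0 = 0 by apply: (addrI (l 0)); rewrite -lD !addr0.
have lN x : l (- x) = - l x by apply: (addrI (l x)); rewrite -lD !subrr.
have lB x y : l (x - y) = l x - l y by rewrite lD lN.
have h1 : carrier X h /\ (nnorm X h <= 1)%E.
  by have := Hh 1; rewrite rmorph1 scale1r normr1 => -[? []].
have hd (x : R) : `|x| < Order.min r d -> [/\ carrier X (x%:C *: h),
    (nnorm X (x%:C *: h) < r%:E)%E & (nnorm X (x%:C *: h) < d%:E)%E].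
  rewrite lt_min => /andP[xr xd]; have [cx [_ nx]] := Hh x.
  by split => //; apply: (le_lt_trans nx).
have blin_le L : (`|l (L h)|%:E <= C%:E * nnorm (blin_space X Y) L)%E.
  apply: (le_trans (lC _)); apply: lee_wpmul2l; first by rewrite lee_fin.
  by apply: ereal_sup_ubound; exists h.
(* By the chain rule, [D] is the derivative of [l] composed with [F] along the line spanned by
   [h]. *)
pose D x := l (DF (x%:C *: h) h).
move=> e ed.
have -> : C * (2 * (`|K0| + 1)) * e ^+ 2 = 2 * (C * (`|K0| + 1)) * e ^+ 2 by ring.
rewrite -(scale0r h) -[0 : R[i]]/(0%:C).
apply: (@second_difference_le (fun x => l (F (x%:C *: h))) D _ (Order.min r d)) => // x xd.
  have [cx xr _] := hd x xd; have [[[_ lin _] dF] _] := Hd _ cx xr.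
  have DF0 : DF (x%:C *: h) 0 = 0.
    have := lin 1 0 0 X0 X0; rewrite rmorph1 !scale1r addr0 => /eqP.
    by rewrite -subr_eq subrr => /eqP.
  have DFZ a : DF (x%:C *: h) (a%:C *: h) = a%:C *: DF (x%:C *: h) h.
    by have := lin a h 0 h1.1 X0; rewrite !addr0 DF0 addr0.
  apply: is_derive_approx => a a0.
  (* The tolerance is divided by [C + 1] rather than by [C], which may be 0. *)
  have a1 : 0 < a / (C + 1) by rewrite divr_gt0// ltr_wpDl.
  have [b b0 Hb] := dF _ a1; exists b => // y; rewrite -lte_fin => yb.
  have [cy [ny0 ny]] := Hh y.
  have := Hb _ cy (le_lt_trans ny yb).
  rewrite -scalerDl -rmorphD /= => Hy.
  rewrite (_ : _ - _ = l (F ((x + y)%:C *: h) - F (x%:C *: h) -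
    DF (x%:C *: h) (y%:C *: h))); last by rewrite !lB DFZ lZ.
  rewrite -lee_fin; apply: (le_trans (lC _)).
  apply: le_trans (lee_wpmul2l _ Hy) _; first by rewrite lee_fin.
  rewrite muleA -EFinM.
  apply: le_trans (lee_wpmul2l _ ny) _; first by rewrite lee_fin mulr_ge0// ltW.
  rewrite -EFinM lee_fin ler_wpM2r// mulrCA ler_piMr ?(ltW a0)//.
  by rewrite ler_pdivrMr ?ltr_wpDl// mul1r lerDl.
have [cx xr xd'] := hd x xd; have [_ [nx0 nx]] := Hh x.
have := H1 _ cx xd'; rewrite add0r mul1e => Hx.
rewrite /D scale0r.
rewrite (_ : _ - _ = l ((DF (x%:C *: h) - DF 0 - D2F 0 (x%:C *: h)) h) + l (D2F 0 (x%:C *: h) h)); last first.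
  by rewrite -lD -lB; congr l; rewrite !fctE subrK.
have b1 : `|l ((DF (x%:C *: h) - DF 0 - D2F 0 (x%:C *: h)) h)| <= C * `|x|.
  rewrite -lee_fin; apply: (le_trans (blin_le _)).
  by rewrite EFinM lee_wpmul2l ?lee_fin// (le_trans Hx).
have b2 : `|l (D2F 0 (x%:C *: h) h)| <= C * (`|K0| * `|x|).
  rewrite -lee_fin; apply: (le_trans (blin_le _)).
  rewrite EFinM lee_wpmul2l ?lee_fin// (le_trans (HK _ cx))// EFinM.
  apply: le_trans (lee_wpmul2l _ nx); last by rewrite lee_fin.
  by apply: lee_wpmul2r => //; rewrite lee_fin ler_norm.
rewrite (le_trans (ler_normD _ _))// (_ : _ * _ = C * `|x| + C * (`|K0| * `|x|)); last by ring.
exact: lerD.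
Qed.

End NormedSpaces.
End SecondDifference.

(** * Solutions with small data *)

Section DistrEq.
Variable R : realType.
Implicit Types (f g : distr R).

Lemma has_cderiv_conj (f : R -> R[i]) x d : has_cderiv f x d ->
  has_cderiv (fun y => conjc (f y)) x (conjc d).
Proof.
move=> [f1 f2]; split.
  by under eq_fun do rewrite Re_conj; rewrite Re_conj.
by under eq_fun do rewrite Im_conj; rewrite Im_conj; exact: is_deriveN.
Qed.

Lemma schwartz_conj (phi : R -> R[i]) : schwartz phi -> schwartz (fun x => conjc (phi x)).
Proof.
move=> S; pose K h := exists2 f, schwartz f & h = fun x : R => conjc (f x).
apply: (@schwartz_coind R K); last by exists phi.
  move=> _ [u Su ->]; exists (fun x => conjc (cderiv 1 u x)).
    by exists (cderiv 1 u) => //; exact: schwartz_deriv.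
  by move=> x; apply: has_cderiv_conj; exact: schwartz_has_cderiv.
move=> _ [u Su ->] k; have [M HM] := schwartz_bound k Su.
by exists M => x; rewrite normc_conj.
Qed.

Lemma distr_eq_sym f g : distr_eq f g -> distr_eq g f.
Proof. by move=> fg phi S; rewrite fg. Qed.

Lemma tempered_eq f g : distr_eq f g -> tempered f -> tempered g.
Proof.
move=> fg [lin [k [K HK]]]; split.
  move=> a phi psi S S'; rewrite -!fg//; first exact: lin.
  exact: schwartzD (schwartzZ a S) S'.
by exists k, K => phi M S H; rewrite -fg//; exact: HK.
Qed.

Lemma real_valued_eq f g : distr_eq f g -> real_valued f -> real_valued g.
Proof. by move=> fg rf phi S; rewrite -!fg//; [exact: rf|exact: schwartz_conj]. Qed.

Lemma distr_fourier_is_fun_eq f g c : distr_eq f g ->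
  distr_is_fun (distr_fourier f) c -> distr_is_fun (distr_fourier g) c.
Proof.
move=> fg [mc H]; split => // phi S; have [h1 h2] := H phi S; split => //.
by rewrite -h2 /distr_fourier fg//; exact: schwartz_fourier.
Qed.

Lemma fa_norm_eq p q s f g : distr_eq f g -> fa_norm p q s f = fa_norm p q s g.
Proof.
move=> fg; congr ereal_inf; apply/seteqP; split => _ [c Hc <-]; exists c => //.
  exact: distr_fourier_is_fun_eq Hc.
by apply: distr_fourier_is_fun_eq Hc; exact: distr_eq_sym.
Qed.

Lemma carrier_eq p q s f g : distr_eq f g ->
  carrier (real_fourier_amalgam p q s) f -> carrier (real_fourier_amalgam p q s) g.
Proof.
move=> fg [[tf nf] rf]; split; last exact: real_valued_eq rf.
by split; [exact: tempered_eq tf|rewrite -(fa_norm_eq p q s fg)].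
Qed.

Lemma duhamel_eq T f g u : distr_eq f g -> duhamel T f u -> duhamel T g u.
Proof.
move=> fg [w [Hw H]]; exists w; split => // t phi tT S.
have [h1 h2] := H t phi tT S; split => //; rewrite h2; congr (_ - _).
rewrite /kdvb_semigroup /distr_ifourier /distr_mul /distr_fourier fg//.
apply/schwartz_fourier/schwartz_symbol; last exact: schwartz_ifourier.
by move: tT; rewrite in_itv /= => /andP[].
Qed.

(** The identity is only available on Schwartz functions, where the integrals converge; hence the
    transport of all notions along [distr_eq]. *)
Lemma spectralZ k M (c : R -> R[i]) (a : R[i]) : wt_bounded k.+1 M c ->
  distr_eq (spectral (fun xi => a * c xi)) (a *: spectral c).
Proof.
move=> cM phi S; rewrite -[RHS]/(a * spectral c phi) /spectral -cintegralM//.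
  by apply: eq_cintegral => xi _; rewrite mulrA.
exact: spectral_integrable cM (schwartz_ifourier S).
Qed.

End DistrEq.

(** * The solutions as paths in the amalgam space *)

Section SolutionSpace.
Variables (R : realType) (p q : \bar R) (s : R).
Hypotheses (p_ge1 : (1%:E <= p)%E) (q_ge1 : (1%:E <= q)%E) (s_le0 : s <= 0).
Let X := real_fourier_amalgam p q s.

Lemma wt_bounded_fa_norm f c M : wt_bounded 1 M c ->
  distr_is_fun (distr_fourier f) c -> (fa_norm p q s f <= (9 * wt_mass R * M)%:E)%E.
Proof.
move=> cM fc; apply: le_trans (fa_norm_le p q s fc) _.
exact: wt_bounded_amalgam_norm.
Qed.

Lemma spectral_carrier k M c : wt_bounded k.+1 M c ->
  (forall xi, c (- xi) = conjc (c xi)) -> carrier X (spectral c).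
Proof.
move=> cM cs; split; last exact: spectral_real_valued cM cs.
split; first exact: spectral_tempered cM.
have cM1 : wt_bounded 1 M c by exact: wt_boundedW cM.
by rewrite (le_lt_trans (wt_bounded_fa_norm cM1 (spectral_fourier_is_fun cM1)))// ltry.
Qed.

Section Path.
Variables (T m : R) (c : R -> R[i]).
Hypotheses (T_ge0 : 0 <= T) (c_bounded : wt_bounded 3 m c).
Hypothesis m_small : 8 * (duhamel_const T * conv_const R) * m <= 1.
Hypothesis c_sym : forall xi, c (- xi) = conjc (c xi).
Let sol := solution_path T c m.

Lemma solution_carrier : carrier (path_space T X) (solution T c m).
Proof.
have sb t := path_bounded_slice t (solution_path_bounded T_ge0 c_bounded m_small).
split.
  move=> t _; apply: spectral_carrier (sb t) _ => xi.
  exact: (solution_path_sym T_ge0 c_bounded m_small c_sym).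
move=> t; rewrite in_itv /= => tT e e0.
have [C C0 HC] := solution_path_lipschitz T_ge0 c_bounded m_small.
have w0 := wt_mass_ge0 R.
have k0 : 0 < 9 * wt_mass R * C + 1 by rewrite ltr_wpDl// !mulr_ge0.
exists (e / (9 * wt_mass R * C + 1)); first exact: divr_gt0.
move=> t'; rewrite in_itv /= ltr_pdivlMr// => t'T tt'.
have db : wt_bounded 1 (C * `|t' - t|) (fun xi => sol (t', xi) - sol (t, xi)).
  split; first by apply: cmfunB; [case: (sb t')|case: (sb t)].
  by move=> xi; rewrite expr1; exact: HC.
apply: le_trans (wt_bounded_fa_norm db _) _.
  split; first by case: db.
  move=> phi S; split; first exact: spectral_integrable db S.
  rewrite /distr_fourier -[LHS]/(solution T c m t' (fourier phi) - solution T c m t (fourier phi)).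
  rewrite /solution !spectral_fourier// -cintegralB//.
  - by apply: eq_cintegral => xi _; rewrite mulrBl.
  - exact: spectral_integrable (sb t') S.
  - exact: spectral_integrable (sb t) S.
rewrite lee_fin; apply: le_trans (ltW tt').
by have := normr_ge0 (t' - t); lra.
Qed.

Lemma solution_kdvb : kdvb_solution p q s T (spectral c) (solution T c m).
Proof. by split; [exact: solution_carrier|exact: solution_duhamel]. Qed.

End Path.

End SolutionSpace.

Lemma cintegrableB (R : realType) (D : set R) (f g : R -> R[i]) : measurable D ->
  cintegrable D f -> cintegrable D g -> cintegrable D (fun x => f x - g x).
Proof.
move=> mD cf cg; have cN := cintegrableM (-1) mD cg.
rewrite (_ : (fun x => _) = fun x => f x + -1 * g x); first exact: cintegrableD.
by apply/funext => x; rewrite mulN1r.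
Qed.

(** * Expansion of the solution in the size of the data *)

Section Expansion.
Variables (R : realType) (T m : R) (c eta : R -> R[i]).
Hypotheses (T_ge0 : 0 <= T) (c_bounded : wt_bounded 3 m c) (eta_schwartz : schwartz eta).
Let K := duhamel_const T * conv_const R.

Lemma duhamel_sqrZ (L : R * R -> R[i]) D (a : R[i]) z : path_bounded D L ->
  duhamel_op T (conv (fun z => a * L z) (fun z => a * L z)) z =
  a ^+ 2 * duhamel_op T (conv L L) z.
Proof.
move=> LD.
have -> : conv (fun z => a * L z) (fun z => a * L z) = fun w => a ^+ 2 * conv L L w.
  apply/funext => w; rewrite /conv -cintegralM//; last exact: (conv_kernel_integrable _ LD LD).
  by apply: eq_cintegral => xi _; rewrite /conv_kernel; ring.
rewrite /duhamel_op [RHS]mulrCA; congr (_ * _); rewrite -cintegralM//.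
  by apply: eq_cintegral => tau _; rewrite /duhamel_kernel; ring.
exact: (duhamel_kernel_integrable _ _ (conv_bounded LD LD)).
Qed.

(** The data [e c] have size [|e| m], so the cubic remainder of the fixed point scales like [|e|^3].
    Neither [a] nor [M] depends on [e]; both may depend on [t] and on the frequency of [c]. *)
Lemma solution_pairing_expansion t : exists a M, forall e : R, 8 * K * (`|e| * m) <= 1 ->
  normc (solution T (fun xi => e%:C * c xi) (`|e| * m) t (fourier eta) - e%:C * a -
    (e ^+ 2)%:C * cintegral setT (fun xi =>
      duhamel_op T (conv (free_path T c) (free_path T c)) (t, xi) * eta xi))
  <= M * `|e| ^+ 3.
Proof.
pose L := free_path T c; have LD : path_bounded m L by exact: free_path_bounded.
have [N N0 HN] := schwartz_bounded eta_schwartz.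
exists (cintegral setT (fun xi => L (t, xi) * eta xi)).
exists (2 * (432 * K ^+ 2 * m ^+ 3 * N * wt_mass R)) => e em.
have eb : wt_bounded 3 (`|e| * m) (fun xi => e%:C * c xi).
  by rewrite -normc_real; exact: wt_boundedZ.
have eL z : free_path T (fun xi => e%:C * c xi) z = e%:C * L z.
  by rewrite /L /free_path; ring.
have sb := path_bounded_slice t (solution_path_bounded T_ge0 eb em).
have Lb := path_bounded_slice t LD.
have Db := path_bounded_slice t (duhamel_bounded T_ge0 (conv_bounded LD LD)).
rewrite /solution spectral_fourier// -cintegralM//; last exact: spectral_integrable Lb eta_schwartz.
rewrite -cintegralM//; last exact: spectral_integrable Db eta_schwartz.
have i1 := spectral_integrable sb eta_schwartz.
have i2 := cintegrableM e%:C measurableT (spectral_integrable Lb eta_schwartz).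
have i3 := cintegrableM (e ^+ 2)%:C measurableT (spectral_integrable Db eta_schwartz).
rewrite -cintegralB// -cintegralB//; last exact: cintegrableB.
pose U := solution_path T (fun xi => e%:C * c xi) (`|e| * m).
pose V xi := U (t, xi) - e%:C * L (t, xi) - (e ^+ 2)%:C * duhamel_op T (conv L L) (t, xi).
have VM : wt_bounded 3 (432 * K ^+ 2 * (`|e| * m) ^+ 3) V.
  split.
    apply: cmfunB; last by apply: cmfunM; [exact: cmfun_cst|case: Db].
    by apply: cmfunB; [case: sb|apply: cmfunM; [exact: cmfun_cst|case: Lb]].
  move=> xi; have := solution_path_expansion T_ge0 eb em t xi.
  by rewrite (funext eL) (duhamel_sqrZ e%:C (t, xi) LD) -rmorphXn.
have h := wt_bounded_cintegral_le (wt_boundedM VM (schwartz_cmfun eta_schwartz) HN).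
apply: le_trans (le_trans _ h) _.
  rewrite le_eqVlt; apply/orP; left; apply/eqP; congr normc.
  by apply: eq_cintegral => xi _; rewrite /V !mulrBl !mulrA.
by rewrite exprMn; have := exprn_ge0 3 (normr_ge0 e); lra.
Qed.

End Expansion.

(** * Resonant data *)

Section ResonantData.
Variable R : realType.
Let mu := @lebesgue_measure R.
Implicit Types (t tau xi a b x theta : R).

Lemma integrableD_EFin (f g : R -> R) : mu.-integrable setT (EFin \o f) ->
  mu.-integrable setT (EFin \o g) -> mu.-integrable setT (EFin \o (fun x => f x + g x)).
Proof. by move=> fi gi; have := integrableD measurableT fi gi. Qed.

Lemma Re_symbol_ge x theta : 0 <= x ->
  1 - x - 2 * `|theta| <= Rec ((expR (- x))%:C * expi theta).
Proof.
move=> x0; rewrite !reimE mul0r subr0.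
have c : 1 - 2 * `|theta| <= cos theta.
  have := le_trans (Re_le_normc _) (expi_lipschitz theta); rewrite !reimE.
  by rewrite ler_norml => /andP[h _]; lra.
have e1 : expR (- x) <= 1 by rewrite -expR0 ler_expR oppr_le0.
have e2 := expR_ge1Dx (- x); have c1 := cos_le1 theta.
have : (1 - expR (- x)) * cos theta <= 1 - expR (- x).
  by rewrite ler_piMr// subr_ge0.
lra.
Qed.

(** The factor with which the modes [a] and [xi - a], evolved freely until [tau] and multiplied
    there, reach frequency [xi] at time [t]. *)
Definition resonant_phase t tau xi a : R[i] :=
  kdvb_symbol (t - tau) xi * (kdvb_symbol tau a * kdvb_symbol tau (xi - a)).

Lemma resonant_phase_ge t tau xi a : 0 <= tau <= t ->
  - 1 <= Rec (resonant_phase t tau xi a).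
Proof.
move=> /andP[tau0 taut].
have : `|Rec (resonant_phase t tau xi a)| <= 1.
  apply: (le_trans (Re_le_normc _)).
  rewrite /resonant_phase Normc.normcM [normc (kdvb_symbol tau a * _)]Normc.normcM.
  have h1 := @normc_symbol_le1 R (t - tau) xi; have h2 := @normc_symbol_le1 R tau.
  rewrite mulr_ile1 ?mulr_ge0 ?normc_ge0 ?h1 ?subr_ge0//.
  by rewrite mulr_ile1 ?normc_ge0 ?h2.
by rewrite ler_norml => /andP[].
Qed.

(* The frequencies [a] and [xi - a] are opposite up to O(1), so that the cubic
   phase is only of size [tau * N ^ 2]. *)
Lemma resonant_phase_low (N : R) tau xi a : 1 <= N -> 0 <= tau <= (32 * N ^+ 2)^-1 ->
  `|xi| <= 2^-1 -> `|a| <= N + 4^-1 -> `|xi - a| <= N + 4^-1 ->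
  2^-1 <= Rec (resonant_phase (32 * N ^+ 2)^-1 tau xi a).
Proof.
move=> N1 tauN x1; set t := (32 * N ^+ 2)^-1 in tauN *; have [tau0 taut] := andP tauN.
set b := xi - a => aN bN.
have N2 : 0 < 32 * N ^+ 2 by rewrite mulr_gt0// exprn_gt0// (lt_le_trans _ N1).
have tN : t * N ^+ 2 = 32^-1.
  by rewrite /t invfM mulfVK// gt_eqF// exprn_gt0// (lt_le_trans _ N1).
have t0 : 0 <= t by rewrite invr_ge0 ltW.
have t32 : t <= 32^-1.
  by rewrite -tN ler_peMr// -[leLHS](expr1n _ 2) lerXn2r ?nnegrE// (le_trans _ N1).
(* Since [N >= 1], [N + 1/4] is at most [5 N / 4]. *)
have sq y : `|y| <= N + 4^-1 -> y ^+ 2 <= 25 / 16 * N ^+ 2.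
  move=> yN; rewrite -real_normK ?num_real//.
  apply: (@le_trans _ _ ((5 / 4 * N) ^+ 2)); last by rewrite exprMn; lra.
  by rewrite lerXn2r ?nnegrE//; lra.
have a2 := sq a aN; have b2 := sq b bN.
have x2 : xi ^+ 2 <= 4^-1.
  rewrite -real_normK ?num_real// (_ : 4^-1 = 2^-1 ^+ 2 :> R); last by field.
  by rewrite lerXn2r ?nnegrE ?invr_ge0.
have E : resonant_phase t tau xi a =
    (expR (- ((t - tau) * xi ^+ 2 + tau * (a ^+ 2 + b ^+ 2))))%:C *
    expi ((t - tau) * xi ^+ 3 + tau * (a ^+ 3 + b ^+ 3)).
  rewrite /resonant_phase /kdvb_symbol -/b mulrDr [tau * (a ^+ 3 + _)]mulrDr.
  rewrite !opprD !expRD !expiD !rmorphM; ring.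
have tt : 0 <= t - tau by rewrite subr_ge0.
have a0 := sqr_ge0 a; have b0 := sqr_ge0 b; have x0 := sqr_ge0 xi.
rewrite E; apply: le_trans (Re_symbol_ge _ _); last first.
  by apply: addr_ge0; apply: mulr_ge0 => //; exact: addr_ge0.
have h1 : (t - tau) * xi ^+ 2 + tau * (a ^+ 2 + b ^+ 2) <= t * (4^-1 + 25 / 8 * N ^+ 2).
  have : (t - tau) * xi ^+ 2 <= t * 4^-1 by apply: ler_pM => //; lra.
  have : tau * (a ^+ 2 + b ^+ 2) <= t * (25 / 8 * N ^+ 2).
    by apply: ler_pM => //; [exact: addr_ge0|lra].
  lra.
have ab : `|a ^+ 3 + b ^+ 3| <= 2^-1 * (75 / 16 * N ^+ 2).
  have -> : a ^+ 3 + b ^+ 3 = xi * (a ^+ 2 - a * b + b ^+ 2) by rewrite /b; ring.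
  rewrite normrM ler_pM// ler_norml.
  have := sqr_ge0 (a + b); have := sqr_ge0 (a - b).
  by move=> h2 h3; apply/andP; split; nra.
have x3 : `|xi ^+ 3| <= 8^-1.
  rewrite normrX (_ : 8^-1 = 2^-1 ^+ 3 :> R); last by field.
  by rewrite lerXn2r ?nnegrE ?invr_ge0.
have h2 : `|(t - tau) * xi ^+ 3 + tau * (a ^+ 3 + b ^+ 3)| <= t * (8^-1 + 75 / 32 * N ^+ 2).
  rewrite (le_trans (ler_normD _ _))// [leRHS]mulrDr lerD// normrM ger0_norm//.
    by apply: ler_pM => //; lra.
  by apply: ler_pM => //; lra.
(* With [t N^2 = 1/32] and [t <= 1/32], the damping plus twice the phase is about 0.26 at most,
   below the allowed 1/2: this is what the 32 is for. *)
have : t * (4^-1 + 25 / 8 * N ^+ 2) = t / 4 + 25 / 8 * (t * N ^+ 2) by ring.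
have : t * (8^-1 + 75 / 32 * N ^+ 2) = t / 8 + 75 / 32 * (t * N ^+ 2) by ring.
rewrite tN; lra.
Qed.

Variables (N A : R).
Hypotheses (N_ge1 : 1 <= N) (A_ge0 : 0 <= A).

(** The half-width 1/4 keeps each bump inside one unit block when [N] is an integer, and opposite
    bumps then interact into [|xi| <= 1/2]. *)
Definition bumps xi : R := if `| `|xi| - N| <= 4^-1 then A else 0.

Lemma bumps_ge0 xi : 0 <= bumps xi. Proof. by rewrite /bumps; case: ifP. Qed.

Lemma bumps_le xi : bumps xi <= A. Proof. by rewrite /bumps; case: ifP. Qed.

Lemma bumpsN xi : bumps (- xi) = bumps xi. Proof. by rewrite /bumps normrN. Qed.

Lemma bumps_in xi : N - 4^-1 <= `|xi| <= N + 4^-1 -> bumps xi = A.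
Proof. by move=> h; rewrite /bumps ifT// ler_norml; lra. Qed.

Lemma bumps_out xi : bumps xi != 0 -> N - 4^-1 <= `|xi| <= N + 4^-1.
Proof. by rewrite /bumps; case: ifPn => [|_ /eqP//]; rewrite ler_norml; lra. Qed.

Lemma measurable_bumps : measurable_fun setT bumps.
Proof.
apply: measurable_fun_ifT => //; apply: measurable_fun_ler => //.
by apply: measurableT_comp => //; apply: measurable_funB => //; exact: measurableT_comp.
Qed.

Lemma bumps_bounded : wt_bounded 3 (A * (1 + (N + 1) ^+ 2) ^+ 3) (fun xi => (bumps xi)%:C).
Proof.
split; first exact: cmfun_real measurable_bumps.
move=> xi; rewrite normc_real ger0_norm ?bumps_ge0//.
have [->|/bumps_out h] := eqVneq (bumps xi) 0.
  by rewrite !mulr_ge0// ?exprn_ge0 ?wt_ge0// ltW// oneD_sqr_gt0.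
apply: (le_trans (bumps_le xi)); rewrite -mulrA ler_peMr// -exprMn exprn_ege1//.
rewrite /wt ler_pdivlMr ?oneD_sqr_gt0// mul1r lerD2l -real_normK ?num_real//.
have n1 : 0 <= N + 1 by move: N_ge1; lra.
have h1 : `|xi| <= N + 1 by move: h => /andP[_ h]; rewrite (le_trans h)// lerD2l invf_le1// ler1n.
by rewrite lerXn2r ?nnegrE.
Qed.

Let t := (32 * N ^+ 2)^-1.

(** A minorant of the integrand of the second iterate. For [xi] in [[1/8, 1/4]] it retains only [a]
    in [[N, N + 1/4]], for which [xi - a] stays in the bump at [- N]. Other outputs below [N]
    contribute nonnegatively; beyond [N], where equal bumps interact, the phase is only bounded by
    1. *)
Definition resonant_lower xi : R -> R :=
  if 8^-1 <= xi <= 4^-1 then fun a => A ^+ 2 / 2 * \1_(`[N, N + 4^-1]%classic) a else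
  if `|xi| < N then fun=> 0 else
  fun a => - A ^+ 2 * (\1_(`[N - 4^-1, N + 4^-1]%classic) a + \1_(`[- N - 4^-1, - N + 4^-1]%classic) a).

Lemma indic_itvE (u v a : R) : \1_(`[u, v]%classic) a = if u <= a <= v then 1 else 0 :> R.
Proof.
rewrite indicE; case: ifPn => h; first by rewrite mem_set//= in_itv.
by rewrite memNset//= in_itv/=; exact/negP.
Qed.

Lemma resonant_lowerP tau xi a : 0 <= tau <= t ->
  resonant_lower xi a <= Rec (resonant_phase t tau xi a) * (bumps a * bumps (xi - a)).
Proof.
move=> taut; have N1 : 1 <= N := N_ge1; set b := xi - a; set P := Rec _.
have Q0 : 0 <= bumps a * bumps b by rewrite mulr_ge0 ?bumps_ge0.
have low : `|xi| <= 2^-1 -> 2^-1 * (bumps a * bumps b) <= P * (bumps a * bumps b).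
  move=> x1; have [->|] := eqVneq (bumps a * bumps b) 0; first by rewrite !mulr0.
  rewrite mulf_eq0 negb_or => /andP[/bumps_out/andP[_ ha] /bumps_out/andP[_ hb]].
  by rewrite ler_wpM2r//; exact: resonant_phase_low.
(* A nonzero product with [|xi| < N] forces [a] and [xi - a] to have opposite signs, since equal
   signs give [|xi| >= 2 N - 1/2]. Hence [|xi| <= 1/2] and [low] applies. *)
have pos : `|xi| < N -> 0 <= P * (bumps a * bumps b).
  move=> xN; have [->|ne0] := eqVneq (bumps a * bumps b) 0; first by rewrite !mulr0.
  apply: le_trans (low _); first by rewrite mulr_ge0.
  move: ne0; rewrite mulf_eq0 negb_or => /andP[/bumps_out ha /bumps_out hb].
  have : xi = a + b by rewrite /b; ring.
  move: ha hb xN; clear -N1 => + + + E; rewrite {}E.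
  have [a0|a0] := leP 0 a; have [b0|b0] := leP 0 b; rewrite ?(ger0_norm a0) ?(ltr0_norm a0);
    rewrite ?(ger0_norm b0) ?(ltr0_norm b0) ltr_norml ler_norml; lra.
rewrite /resonant_lower; case: ifPn => [x1|_].
  have x2 : `|xi| <= 2^-1 by rewrite ler_norml; lra.
  rewrite indic_itvE; case: ifPn => aN; last first.
    by rewrite mulr0; apply: pos; rewrite ltr_norml; lra.
  apply: le_trans (low x2); rewrite !bumps_in; first by rewrite expr2; lra.
    by rewrite /b ler0_norm; lra.
  by rewrite ger0_norm; lra.
case: ifPn => [/pos//|_].
have h1 : - (bumps a * bumps b) <= P * (bumps a * bumps b).
  by rewrite -mulN1r ler_wpM2r// resonant_phase_ge.
apply: le_trans h1; rewrite mulNr lerN2 expr2 -mulrA mulrC ler_pM ?bumps_ge0 ?bumps_le//.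
rewrite !indic_itvE.
have [->|/bumps_out] := eqVneq (bumps a) 0.
  by rewrite mulr_ge0// addr_ge0//; case: ifP.
have := bumps_le a.
have [a0|a0] := leP 0 a; rewrite ?(ger0_norm a0) ?(ltr0_norm a0) => h aN.
  rewrite [in X in A * (X + _)]ifT; last lra.
  by rewrite (le_trans h)// ler_peMr// lerDl; case: ifP.
rewrite [in X in A * (_ + X)]ifT; last lra.
by rewrite (le_trans h)// ler_peMr// lerDr; case: ifP.
Qed.

Definition resonant_low xi : R :=
  if 8^-1 <= xi <= 4^-1 then A ^+ 2 / 8 else if `|xi| < N then 0 else - A ^+ 2.

Lemma integrable_resonant_lower xi : mu.-integrable setT (EFin \o resonant_lower xi).
Proof.
rewrite /resonant_lower; case: ifP => _.
  by apply: integrable_scale; exact: (integrable_indic_itv N (N + 4^-1) true).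
case: ifP => _; first exact: integrable0.
apply: integrable_scale.
by apply: integrableD_EFin; exact: (integrable_indic_itv _ _ true).
Qed.

Lemma Rintegral_resonant_lower xi : \int[mu]_a resonant_lower xi a = resonant_low xi.
Proof.
have N1 : 1 <= N := N_ge1.
have i1 := @integrable_indic_itv R (N - 4^-1) (N + 4^-1) true.
have i2 := @integrable_indic_itv R (- N - 4^-1) (- N + 4^-1) true.
rewrite /resonant_lower /resonant_low; case: ifP => _.
  rewrite RintegralZl//; last exact: (integrable_indic_itv N (N + 4^-1) true).
  rewrite (@Rintegral_indic_itv R N (N + 4^-1) true) ?lerDl ?invr_ge0//.
  by field.
case: ifP => _; first by rewrite /Rintegral integral0.
rewrite RintegralZl//; last exact: integrableD_EFin.
rewrite RintegralD// (@Rintegral_indic_itv R _ _ true); last lra.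
by rewrite (@Rintegral_indic_itv R _ _ true); [field|lra].
Qed.

End ResonantData.

(** * Lower bound for the second iterate *)

Section SecondIterate.
Variable R : realType.
Let mu := @lebesgue_measure R.

(** The factor [i xi] combines with that of the nonlinearity into a multiple of [xi^2], which has a
    sign; the Gaussian suppresses the uncontrolled outputs near [2 N] and [- 2 N]. *)
Definition test_profile (xi : R) : R[i] := imag xi * (gauss 1 xi)%:C.

Lemma schwartz_test_profile : schwartz test_profile.
Proof. exact/schwartz_imag/schwartz_gauss. Qed.

Section FixedData.
Variables (N A T : R).
Hypotheses (N_ge1 : 1 <= N) (A_ge0 : 0 <= A) (T_large : (32 * N ^+ 2)^-1 <= T).
Let t := (32 * N ^+ 2)^-1.
Let c (xi : R) : R[i] := (bumps N A xi)%:C.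
Let L := free_path T c.
Implicit Types (tau xi a : R).

Let t_ge0 : 0 <= t.
Proof. by rewrite invr_ge0 mulr_ge0// exprn_ge0// (le_trans _ N_ge1). Qed.

Let L_bounded : path_bounded (A * (1 + (N + 1) ^+ 2) ^+ 3) L.
Proof. exact/free_path_bounded/bumps_bounded. Qed.

Let conv_L := conv_bounded L_bounded L_bounded.

Lemma conv_resonant_lower tau xi : 0 <= tau <= t ->
  resonant_low N A xi <= Rec (kdvb_symbol (t - tau) xi * conv L L (tau, xi)).
Proof.
move=> taut; rewrite /conv -cintegralM//; last first.
  exact: (conv_kernel_integrable _ L_bounded L_bounded).
rewrite -Rintegral_resonant_lower//; apply: le_Rintegral => //.
- exact: integrable_resonant_lower.
- have [] // := cintegrableM (kdvb_symbol (t - tau) xi) measurableT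
    (conv_kernel_integrable (tau, xi) L_bounded L_bounded).
- move=> a _; apply: le_trans (resonant_lowerP N_ge1 A_ge0 xi a taut) _.
  have tauT : 0 <= tau <= T by move: taut => /andP[-> /le_trans]; apply.
  rewrite /conv_kernel -[((tau, xi), a).1]/(tau, xi) -[((tau, xi), a).2]/a.
  rewrite -[(tau, xi).1]/tau -[(tau, xi).2]/xi /L !free_pathE// /c.
  rewrite (_ : kdvb_symbol (t - tau) xi * _ =
      resonant_phase t tau xi a * (bumps N A a * bumps N A (xi - a))%:C); last first.
    by rewrite rmorphM /resonant_phase; ring.
  by rewrite [leRHS]ReM Re_real Im_real mulr0 subr0.
Qed.

Lemma duhamel_kernel_lower xi :
  t * resonant_low N A xi <=
  Rec (cintegral setT (fun tau => duhamel_kernel T (conv L L) ((t, xi), tau))).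
Proof.
have -> : t * resonant_low N A xi = \int[mu]_tau (resonant_low N A xi * \1_(`[0, t]%classic) tau).
  rewrite RintegralZl//; last exact: (integrable_indic_itv 0 t true).
  by rewrite (@Rintegral_indic_itv R 0 t true)// subr0 mulrC.
apply: le_Rintegral => //.
- by apply: integrable_scale; exact: (integrable_indic_itv 0 t true).
- by have [] := duhamel_kernel_integrable T (t, xi) conv_L.
- move=> tau _; rewrite indic_itvE /duhamel_kernel /causal.
  rewrite -[((t, xi), tau).1]/(t, xi) -[((t, xi), tau).2]/tau.
  rewrite -[(t, xi).1]/t -[(t, xi).2]/xi T_large andbT.
  case: ifPn => h; last by rewrite mulr0 mul0r.
  by rewrite rmorph1 mul1r mulr1; exact: conv_resonant_lower.
Qed.

(** On [[1/8, 1/4]], [xi^2 >= 1/64] and the Gaussian is at least 1/2; with the [A^2 / 8] of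
    [resonant_low] this gives 1/1024. For [|xi| >= N] one factor [xi^2] is exchanged for [N^2], and
    the bounds on the moments of order 4 and 6 leave an integrable error of size [N^-2]. *)
Lemma second_iterate_pointwise (M : R) xi :
  (forall y : R, `|y| ^+ 4 * gauss 1 y <= M) -> (forall y : R, `|y| ^+ 6 * gauss 1 y <= M) ->
  (4 * pi)^-1 * (t * A ^+ 2) * (1024^-1 * \1_(`[8^-1, 4^-1]%classic) xi - 2 * M / N ^+ 2 * wt xi) <=
  Rec (duhamel_op T (conv L L) (t, xi) * test_profile xi).
Proof.
move=> M4 M6; have g0 : 0 <= gauss 1 xi by exact: expR_ge0.
have N1 : 1 <= N := N_ge1.
have N2 : 0 < N ^+ 2 by rewrite exprn_gt0// (lt_le_trans _ N_ge1).
have M0 : 0 <= M by apply: le_trans (M4 0); rewrite mulr_ge0 ?exprn_ge0 ?expR_ge0.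
have tA : 0 <= t * A ^+ 2 by rewrite mulr_ge0 ?t_ge0// sqr_ge0.
have lo := duhamel_kernel_lower xi.
rewrite /duhamel_op -[(t, xi).2]/xi; set I := cintegral _ _ in lo *.
have -> : Rec ((- (4 * pi)^-1)%:C * imag xi * I * test_profile xi) =
    (4 * pi)^-1 * (xi ^+ 2 * gauss 1 xi * Rec I).
  by rewrite /test_profile !reimE; ring.
rewrite -mulrA ler_wpM2l ?fourpi_ge0//.
have x0 : 0 <= xi ^+ 2 * gauss 1 xi by rewrite mulr_ge0// sqr_ge0.
apply: le_trans (ler_wpM2l x0 lo).
have W0 : 0 <= 2 * M / N ^+ 2 * wt xi.
  by rewrite mulr_ge0 ?wt_ge0// divr_ge0 ?(ltW N2)// mulr_ge0.
rewrite indic_itvE /resonant_low; case: ifPn => [x1|_].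
  have x2 : 64^-1 <= xi ^+ 2 by have /andP[] := x1; nra.
  have x3 : xi ^+ 2 <= 16^-1 by have /andP[] := x1; nra.
  have g1 : 2^-1 <= gauss 1 xi.
    by have := expR_ge1Dx (- (1 * xi ^+ 2)); rewrite -/(gauss 1 xi); lra.
  have h : 128^-1 <= xi ^+ 2 * gauss 1 xi.
    by apply: (@le_trans _ _ (64^-1 * 2^-1)); [lra|apply: ler_pM => //; lra].
  apply: (@le_trans _ _ (128^-1 * (t * (A ^+ 2 / 8)))); last first.
    by rewrite ler_wpM2r// mulr_ge0 ?t_ge0// divr_ge0// sqr_ge0.
  rewrite mulr1 (_ : 128^-1 * _ = t * A ^+ 2 * 1024^-1); last by field.
  by rewrite ler_wpM2l// gerBl.
rewrite mulr0 sub0r; case: ifPn => [_|xN].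
  by rewrite !mulr0 mulrN oppr_le0 mulr_ge0.
rewrite -leNgt in xN.
rewrite [leRHS](_ : _ = - (t * A ^+ 2 * (xi ^+ 2 * gauss 1 xi))); last by ring.
rewrite mulrN lerN2 ler_wpM2l//.
rewrite -mulrA [N ^- 2 * _]mulrC mulrA ler_pdivlMr// ler_pdivlMr ?oneD_sqr_gt0//.
have NX : N ^+ 2 <= xi ^+ 2.
  by rewrite -[xi ^+ 2]real_normK ?num_real// lerXn2r ?nnegrE// (le_trans _ N1).
apply: (@le_trans _ _ (xi ^+ 2 * gauss 1 xi * xi ^+ 2 * (1 + xi ^+ 2))).
  rewrite ler_wpM2r ?(ltW (oneD_sqr_gt0 _))//; exact: ler_wpM2l.
have := M4 xi; have := M6 xi.
rewrite (_ : `|xi| ^+ 4 = xi ^+ 2 * xi ^+ 2); last by rewrite -[xi ^+ 2]real_normK ?num_real//; ring.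
rewrite (_ : `|xi| ^+ 6 = xi ^+ 2 * xi ^+ 2 * xi ^+ 2); last by rewrite -[xi ^+ 2]real_normK ?num_real//; ring.
lra.
Qed.

(** Integrating the pointwise bound over an interval of length 1/8 gives [8192 = 1024 * 8]. *)
Lemma second_iterate_fixed (M : R) :
  (forall y : R, `|y| ^+ 4 * gauss 1 y <= M) -> (forall y : R, `|y| ^+ 6 * gauss 1 y <= M) ->
  (4 * pi)^-1 * (t * A ^+ 2) * (8192^-1 - 2 * M * wt_mass R / N ^+ 2) <=
  Rec (cintegral setT (fun xi => duhamel_op T (conv L L) (t, xi) * test_profile xi)).
Proof.
move=> M4 M6; set k := (4 * pi)^-1 * (t * A ^+ 2).
have T0 : 0 <= T by exact: le_trans t_ge0 T_large.
pose b := 2 * M / N ^+ 2.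
have i1 : mu.-integrable setT (EFin \o (fun xi => 1024^-1 * \1_(`[8^-1, 4^-1]%classic) xi)).
  by apply: integrable_scale; exact: (integrable_indic_itv _ _ true).
have i2 : mu.-integrable setT (EFin \o (fun xi => - b * wt xi)).
  by apply: integrable_scale; exact: integrable_wt.
have -> : k * (8192^-1 - 2 * M * wt_mass R / N ^+ 2) =
    \int[mu]_xi (k * (1024^-1 * \1_(`[8^-1, 4^-1]%classic) xi + - b * wt xi)).
  rewrite RintegralZl//; last exact: integrableD_EFin.
  rewrite RintegralD// RintegralZl//; last exact: (integrable_indic_itv _ _ true).
  rewrite RintegralZl//; last exact: integrable_wt.
  rewrite (@Rintegral_indic_itv R _ _ true); last lra.
  congr (_ * _); rewrite /b -/(wt_mass R).
  rewrite (_ : 1024^-1 * (4^-1 - 8^-1) = 8192^-1); last by field.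
  by rewrite mulNr mulrAC.
apply: le_Rintegral => //.
- by apply: integrable_scale; exact: integrableD_EFin.
- have Db := path_bounded_slice t (duhamel_bounded T0 conv_L).
  by have [] := spectral_integrable Db schwartz_test_profile.
- by move=> xi _; rewrite mulNr; exact: second_iterate_pointwise.
Qed.

End FixedData.

Lemma second_iterate_lower : exists M : R, forall N A T L, 1 <= N -> 0 <= A ->
  (32 * N ^+ 2)^-1 <= T -> L = free_path T (fun xi => (bumps N A xi)%:C) ->
  (4 * pi)^-1 * ((32 * N ^+ 2)^-1 * A ^+ 2) * (8192^-1 - M / N ^+ 2) <=
  Rec (cintegral setT (fun xi =>
    duhamel_op T (conv L L) ((32 * N ^+ 2)^-1, xi) * test_profile xi)).
Proof.
have [M4 h4] := @gauss_bound R 1 4 ltr01; have [M6 h6] := @gauss_bound R 1 6 ltr01.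
exists (2 * Order.max M4 M6 * wt_mass R) => N A T _ N1 A0 T0 ->.
apply: second_iterate_fixed => // y.
  by rewrite (le_trans (h4 y))// le_max lexx.
by rewrite (le_trans (h6 y))// le_max lexx orbT.
Qed.

End SecondIterate.

(** * The norm of the resonant data *)

Section BumpNorm.
Variables (R : realType) (p q : \bar R) (s : R).
Hypotheses (p_ge1 : (1%:E <= p)%E) (q_ge1 : (1%:E <= q)%E).

(** The 2 accounts for the two blocks: each contributes one half to the l^1 norm that dominates the
    l^q norm. *)
Definition bump_height (n : nat) : R := (2 * japanese R n `^ s)^-1.

Lemma bump_height_ge0 n : 0 <= bump_height n.
Proof. by rewrite invr_ge0 mulr_ge0// powR_ge0. Qed.

Lemma bumps_fa_norm (n : nat) (e : R) : (0 < n)%N ->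
  (fa_norm p q s (spectral (fun xi => (e%:C * (bumps n%:R (bump_height n) xi)%:C)%R)) <= `|e|%:E)%E.
Proof.
move=> n0; have n1 : 1 <= n%:R :> R by rewrite ler1n.
set A := bump_height n; have A0 : 0 <= A by exact: bump_height_ge0.
have cb := wt_boundedZ e%:C (bumps_bounded n1 A0).
apply: le_trans (fa_norm_le p q s (spectral_fourier_is_fun cb)) _.
(* The blockwise supremum: the bumps meet only the blocks of [n] and [- n]. *)
pose B (k : int) : R := if (k == n%:Z) || (k == - n%:Z) then `|e| * A else 0.
have B0 k : 0 <= B k by rewrite /B; case: ifP => // _; rewrite mulr_ge0.
apply: le_trans (amalgam_norm_le _ p_ge1 q_ge1 cb.1 _ B0) _.
  move=> k xi /block_mem kx; rewrite Normc.normcM !normc_real (ger0_norm (bumps_ge0 _ A0 _)).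
  rewrite /B; case: ifPn => [_|]; first by rewrite ler_wpM2l// bumps_le.
  have [->|/bumps_out] := eqVneq (bumps n%:R A xi) 0; first by rewrite mulr0.
  have H (x y : int) : `|x%:~R - y%:~R| < 1 :> R -> x = y.
    move=> h; have : `|x - y| < 1 by rewrite ltr_norml -!(ltr_int R) intrD !mulrNz; move: h; rewrite ltr_norml; lra.
    by case: (x - y) (subrK y x) => [[|//]|//] <- _; rewrite add0r.
  have nE : (n%:Z)%:~R = n%:R :> R by [].
  rewrite negb_or => h /andP[/eqP k1 /eqP k2]; exfalso.
  have [x0|x0] := leP 0 xi; move: h; rewrite ?(ger0_norm x0) ?(ltr0_norm x0) => h.
    by apply: k1; apply: H; rewrite nE ltr_norml; lra.
  by apply: k2; apply: H; rewrite mulrNz nE ltr_norml; lra.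
pose w : R := `|e| * A * japanese R n `^ s.
have Jn : japanese R (- n%:Z) = japanese R n by rewrite /japanese mulrNz sqrrN.
have w2 : w *+ 2 = `|e|.
  rewrite /w /A /bump_height invfM mulrA -mulrA mulVf ?mulr1; last first.
    by rewrite gt_eqF// powR_gt0// (lt_le_trans _ (japanese_ge1 R n)).
  by rewrite -mulr_natr; field.
apply: (@le_trans _ _ (\int[counting]_k (w%:E * (\1_([set n%:Z]) k + \1_([set - n%:Z]) k)%:E))%E).
  apply: ge0_le_integral => //.
    by move=> k _; rewrite lee_fin mulr_ge0 ?powR_ge0.
  move=> k _; rewrite -EFinM lee_fin /B !indicE.
  case: ifPn => [/orP[/eqP ->|/eqP ->]|_].
  - rewrite [in leRHS]mem_set//= -/w ler_peMr ?lerDl//.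
    by rewrite /w mulr_ge0 ?powR_ge0// mulr_ge0.
  - rewrite Jn -/w addrC [in leRHS]mem_set//= ler_peMr ?lerDl//.
    by rewrite /w mulr_ge0 ?powR_ge0// mulr_ge0.
  - by rewrite mul0r mulr_ge0// /w mulr_ge0 ?powR_ge0// mulr_ge0.
rewrite integralZl_EFin//; last first.
  by rewrite /w mulr_ge0 ?powR_ge0// mulr_ge0.
under eq_integral do rewrite EFinD.
rewrite ge0_integralD//.
rewrite !integral_indic// !setIT.
rewrite [X in (_ * (X + _))%E]counting1 [X in (_ * (_ + X))%E]counting1 -EFinD -EFinM lee_fin.
by rewrite -[1 + 1]/(2%:R) mulr_natr w2.
Qed.

End BumpNorm.

(** * The theorem *)

Section Growth.
Variables (R : realType) (s : R).
Hypothesis s_lt : s < -1.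

(** The bracket [J] to the power [-2 s] splits as [J^(-2 s - 2) J^2]; both exponents are positive as
    [s < -1], and [n <= J]. The 128 is 32 times the 4 of the squared height. *)
Lemma bump_height_sqr (n : nat) : (0 < n)%N ->
  n%:R `^ (- 2 * s - 2) / 128 <= (32 * n%:R ^+ 2)^-1 * bump_height s n ^+ 2 :> R.
Proof.
move=> n0; have n1 : 0 < n%:R :> R by rewrite ltr0n.
set J := japanese R n; have J1 : 1 <= J := japanese_ge1 R n.
have J0 : 0 < J by exact: lt_le_trans J1.
have nJ : n%:R ^+ 2 <= J ^+ 2 by rewrite japanese_sqr lerDr.
have nJ' : n%:R <= J by move: nJ; rewrite ler_pXn2r ?nnegrE// ltW.
have s' := s_lt.
have hA : bump_height s n ^+ 2 = 4^-1 * (J `^ (- 2 * s - 2) * J ^+ 2).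
  rewrite /bump_height -/J exprVn exprMn invfM; congr (_ * _); first by rewrite expr2; field.
  rewrite -(powR_mulrn 2 (ltW J0)) -powRD; last by rewrite (gt_eqF J0) implybT.
  rewrite -powR_mulrn ?powR_ge0// -powRrM -powRN; congr (_ `^ _); ring.
have P0 : 0 <= n%:R `^ (- 2 * s - 2) :> R by exact: powR_ge0.
have P1 : n%:R `^ (- 2 * s - 2) <= J `^ (- 2 * s - 2).
  by rewrite ge0_ler_powR ?nnegrE ?(ltW n1) ?(ltW J0)//; lra.
rewrite hA invfM mulrCA -[32^-1 * _ * _]mulrA [X in _ <= _ * X]mulrA.
rewrite (_ : 4^-1 * _ = 128^-1 * (n%:R ^- 2 * (J `^ (- 2 * s - 2) * J ^+ 2))); last by field; rewrite gt_eqF.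
rewrite mulrC ler_wpM2l// [leRHS]mulrC ler_pdivlMr ?exprn_gt0//.
by rewrite ler_pM// exprn_ge0// ltW.
Qed.

Lemma bump_height_growth (k B M T : R) : 0 < k -> 0 < T -> exists n : nat, [/\ (0 < n)%N,
  (32 * n%:R ^+ 2)^-1 <= T &
  B <= (32 * n%:R ^+ 2)^-1 * bump_height s n ^+ 2 * (k - M / n%:R ^+ 2)].
Proof.
move=> k0 T0; have s' := s_lt; pose d := - 2 * s - 2; have d0 : 0 < d by rewrite /d; lra.
pose B1 := `|B| * (2 / k); pose B' := 128 * B1.
have k2 : 0 < 2 / k by rewrite divr_gt0.
have B10 : 0 <= B1 by rewrite mulr_ge0// ltW.
have B'0 : 0 <= B' by rewrite mulr_ge0.
(* Thresholds for [n]: above [x1] the correction [M / n^2] is at most [k / 2], above [x2] the power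
   of [n] reaches [B'], and above [x3] the observation time is at most [T]. *)
pose x1 := `|M| * (2 / k); pose x2 := B' `^ d^-1; pose x3 := T^-1.
have x10 : 0 <= x1 by rewrite mulr_ge0// ltW.
have x20 : 0 <= x2 by exact: powR_ge0.
have x30 : 0 < x3 by rewrite invr_gt0.
have x0 : 0 <= 1 + x3 + x1 + x2 by rewrite !addr_ge0// ltW.
have sum4 (y1 y2 y3 z : R) : 0 <= y1 -> 0 <= y2 -> 0 < y3 -> 1 + y3 + y1 + y2 < z ->
  [/\ 1 <= z, y3 <= z, y1 <= z & y2 <= z] by clear; move=> *; split; lra.
have := archi_boundP x0; set n := Num.bound _ => xn; exists n.
have [n1 nx3 nx1 nx2] : [/\ 1 <= n%:R :> R, x3 <= n%:R, x1 <= n%:R & x2 <= n%:R].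
  exact: sum4.
have n0 : 0 < n%:R :> R by exact: lt_le_trans n1.
have n2 : n%:R <= n%:R ^+ 2 :> R by rewrite expr2 ler_peMr// ltW.
have nn : (0 < n)%N by rewrite -(ltr0n R).
have n20 : 0 < n%:R ^+ 2 :> R by rewrite exprn_gt0.
split => //.
  rewrite invf_ple ?posrE ?mulr_gt0//; apply: (le_trans nx3); apply: (le_trans n2).
  by rewrite ler_peMl ?(ltW n20)// ler1n.
have h := bump_height_sqr nn; rewrite -/d in h.
have hM : M / n%:R ^+ 2 <= k / 2.
  rewrite ler_pdivrMr//; apply: (le_trans (ler_norm M)).
  by rewrite -[k / 2]invf_div ler_pdivlMl// mulrC (le_trans nx1).
have hB : B' <= n%:R `^ d.
  have -> : B' = x2 `^ d by rewrite -powRrM mulVf ?powRr1 ?(gt_eqF d0).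
  by rewrite ge0_ler_powR ?nnegrE ?(ltW d0) ?(ltW n0).
have h2 : B1 <= (32 * n%:R ^+ 2)^-1 * bump_height s n ^+ 2.
  by apply: le_trans h; rewrite ler_pdivlMr// mulrC.
have hk : k / 2 <= k - M / n%:R ^+ 2 by move: hM; move: (M / _) => y; lra.
apply: (@le_trans _ _ (B1 * (k / 2))).
  rewrite /B1 -mulrA -[k / 2]invf_div mulfV ?mulr1 ?ler_norm//; exact: lt0r_neq0.
by apply: ler_pM => //; rewrite divr_ge0// ltW.
Qed.

End Growth.

(** * Observation at a fixed time through a test function *)

Section PathFunctional.
Variables (R : realType) (p q : \bar R) (s T : R) (eta : R -> R[i]) (t : R).
Hypothesis t_in : t \in `[0, T].

Definition path_functional (y : R -> (R -> R[i]) -> R[i]) : R := Rec (y t (fourier eta)).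

Lemma path_functionalD y z : path_functional (y + z) = path_functional y + path_functional z.
Proof. by rewrite /path_functional -ReD. Qed.

Lemma path_functionalZ (a : R) y : path_functional (a%:C *: y) = a * path_functional y.
Proof.
rewrite /path_functional -[_ t _]/(a%:C * y t (fourier eta)) ReM Re_real Im_real.
by rewrite mul0r subr0.
Qed.

Lemma path_functional_le (C : R) : 0 <= C -> (forall f : distr R,
    ((normc (f (fourier eta)))%:E <= C%:E * fa_norm p q s f)%E) ->
  forall y, (`|path_functional y|%:E <=
    C%:E * nnorm (path_space T (real_fourier_amalgam p q s)) y)%E.
Proof.
move=> C0 HC y; apply: (@le_trans _ _ (C%:E * fa_norm p q s (y t))%E).
  by apply: le_trans (HC _); rewrite lee_fin Re_le_normc.
apply: lee_wpmul2l; first by rewrite lee_fin.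
by apply: ereal_sup_ubound; exists t.
Qed.

End PathFunctional.

Lemma small_enough (R : realType) (d r y z : R) : 0 < d -> 0 < r -> 0 <= y -> 0 <= z ->
  exists2 e, 0 < e & [/\ e < d, e < r, e * y <= 1 & e * z <= 1].
Proof.
move=> d0 r0 y0 z0.
have bound (a b : R) : 0 < a -> 0 < b ->
    [/\ 0 < a + b + y + z, a < a + b + y + z, b < a + b + y + z, y <= a + b + y + z &
      z <= a + b + y + z].
  by clear d0 r0; move=> *; split; lra.
have d1 : 0 < d^-1 by rewrite invr_gt0.
have r1 : 0 < r^-1 by rewrite invr_gt0.
have [] := bound _ _ d1 r1; move: (_ + z) => w w0 wd wr wy wz.
exists w^-1; first by rewrite invr_gt0.
by split; [rewrite invf_plt|rewrite invf_plt|rewrite ler_pdivrMl ?mulr1|rewrite ler_pdivrMl ?mulr1].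
Qed.

(** Adding the two expansions cancels the linear terms, so [v + w] is at least
    [(k + 2) e^2 - 2 E e^3], hence at least [(k + 1) e^2] for such small [e]. *)
Lemma second_order_contradiction (R : realType) (v w e a b k E : R) : 0 < e ->
  e * (2 * `|E|) <= 1 -> (k + 2) / 2 <= b ->
  `|v - e * a - e ^+ 2 * b| <= E * e ^+ 3 -> `|w + e * a - e ^+ 2 * b| <= E * e ^+ 3 ->
  `|v + w| <= k * e ^+ 2 -> False.
Proof.
move=> e0 eE kb; have e2 : 0 < e ^+ 2 by rewrite exprn_gt0.
have h1 : 2 * (E * e ^+ 3) <= e ^+ 2.
  rewrite (_ : 2 * _ = e ^+ 2 * (e * (2 * E))); last by ring.
  by rewrite ler_piMr ?(ltW e2)// (le_trans _ eE)// !ler_pM2l// ler_norm.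
have h2 : e ^+ 2 * (k + 2) <= e ^+ 2 * (2 * b) by rewrite ler_pM2l//; lra.
by rewrite !ler_norml => /andP[h3 _] /andP[h4 _] /andP[_ h5]; lra.
Qed.

Theorem theorem1p1 (R : realType) (p q : \bar R) (s : R)
    (hp : (1%:E <= p)%E) (hq : (1%:E <= q)%E) (hs : s < -1) :
  ~ exists T : R, 0 < T /\
      exists Phi : ((R -> R[i]) -> R[i]) -> R -> (R -> R[i]) -> R[i],
        kdvb_flow_map p q s T Phi /\
        C2_at_zero (real_fourier_amalgam p q s)
          (path_space T (real_fourier_amalgam p q s)) Phi.
Proof.
move=> [T [T0 [Phi [[r r0 flow] C2]]]].
have s0 : s <= 0 by rewrite (le_trans (ltW hs))// lerN10.
set X := real_fourier_amalgam p q s in C2 flow *.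
pose c n (xi : R) : R[i] := (bumps n%:R (bump_height s n) xi)%:C.
pose h n : distr R := spectral (c n).
have cb n (n1 : 1 <= n%:R :> R) := bumps_bounded n1 (bump_height_ge0 s n).
have eqh n (a : R) : (0 < n)%N -> distr_eq (spectral (fun xi => a%:C * c n xi)) (a%:C *: h n).
  by rewrite -(ler1n R) => n1; exact: spectralZ (cb n n1).
have line n (a : R) : (0 < n)%N -> carrier X (a%:C *: h n) /\
    ((0 <= fa_norm p q s (a%:C *: h n)) /\ (fa_norm p q s (a%:C *: h n) <= `|a|%:E))%E.
  move=> n0; have n1 : 1 <= n%:R :> R by rewrite ler1n.
  split.
    apply: carrier_eq (eqh n a n0) _; apply: spectral_carrier (wt_boundedZ _ (cb n n1)) _ => //.
    by move=> xi; rewrite /c bumpsN conjcM !conjc_ofreal.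
  rewrite -(fa_norm_eq p q s (eqh n a n0)); split; last exact: bumps_fa_norm.
  by apply: le_ereal_inf_tmp => _ [g _ <-]; exact: Lnorm_ge0.
(* The case [a = 0] of [line] places the zero distribution in the space with norm at most 0. *)
have [X0 [_ N0]] := line 1 0 isT; rewrite scale0r normr0 in X0 N0.
have [K K0 [d d0 HK]] := C2_second_difference X0 N0 C2.
have [C C0 HC] := fa_norm_pairing s hp hq (schwartz_test_profile R).
have [M HM] := second_iterate_lower R.
have k0 : 0 < (4 * pi)^-1 :> R by rewrite invr_gt0 mulr_gt0// pi_gt0.
have k'0 : 0 < 8192^-1 :> R by rewrite invr_gt0 ltr0n.
(* The frequency is chosen once [C] and [K] are known: the target makes the quadratic coefficient at
   least [(C K + 2) / 2], more than a second difference bounded by [C K e^2] permits. *)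
have [n [n0 tT HB]] := bump_height_growth hs ((C * K + 2) / 2 / (4 * pi)^-1) M k'0 T0.
set t := (32 * n%:R ^+ 2)^-1 in tT HB.
have n1 : 1 <= n%:R :> R by rewrite ler1n.
have t0 : 0 <= t by rewrite invr_ge0 mulr_ge0// exprn_ge0.
have tin : t \in `[0, T] by rewrite in_itv /= t0.
have cnb := cb n n1; set m := _ * _ in cnb.
pose W := duhamel_const T * conv_const R.
have W0 : 0 <= W by rewrite mulr_ge0 ?duhamel_const_ge0 ?conv_const_ge0 ?ltW.
have := solution_pairing_expansion (ltW T0) cnb (schwartz_test_profile R) t.
rewrite -/W; set b := cintegral _ _ => -[a [E HE]].
have bB : (C * K + 2) / 2 <= Rec b.
  apply: le_trans (HM _ _ _ _ n1 (bump_height_ge0 s n) tT erefl).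
  by rewrite -/t -mulrA [leRHS]mulrC -ler_pdivrMr.
have m0 := wt_bounded_ge0 cnb.
pose l := @path_functional R (@test_profile R) t.
pose u (e : R) := l (Phi (e%:C *: h n)).
have bound := HK l C (h n) (ltW C0) (@path_functionalD _ _ t) (@path_functionalZ _ _ t)
  (path_functional_le tin (ltW C0) HC) (fun a => line n a n0).
(* Both signs of [e] are needed for the second difference, so sizes are expressed by [|e|]. The
   constructed solution has data equal to [e h] on Schwartz functions, and uniqueness identifies the
   values there. *)
have value e : `|e| < r -> 8 * W * (`|e| * m) <= 1 ->
    Phi (e%:C *: h n) t (fourier (@test_profile R)) =
    solution T (fun xi => e%:C * c n xi) (`|e| * m) t (fourier (@test_profile R)).
  move=> er em; have [ch [_ nh]] := line n e n0.
  have eb : wt_bounded 3 (`|e| * m) (fun xi => e%:C * c n xi).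
    by rewrite -normc_real; exact: wt_boundedZ.
  have es xi : e%:C * c n (- xi) = conjc (e%:C * c n xi).
    by rewrite /c bumpsN conjcM !conjc_ofreal.
  have [solc sold] := solution_kdvb hp hq s0 (ltW T0) eb em es.
  have [_ uniq] := flow _ ch (le_lt_trans nh (er : (`|e|%:E < r%:E)%E)).
  have sol : kdvb_solution p q s T (e%:C *: h n) (solution T (fun xi => e%:C * c n xi) (`|e| * m)).
    by split => //; exact: duhamel_eq (eqh n e n0) sold.
  exact/esym/(uniq _ sol t tin)/schwartz_fourier/schwartz_test_profile.
have expand e : `|e| < r -> 8 * W * (`|e| * m) <= 1 ->
    `|u e - e * Rec a - e ^+ 2 * Rec b| <= E * `|e| ^+ 3.
  move=> er em; apply: le_trans (HE e em); rewrite -value//.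
  apply: le_trans (Re_le_normc _); rewrite !ReB !ReM !Re_real !Im_real !mul0r !subr0.
  by rewrite /u /l /path_functional.
have W8 : 0 <= 8 * W * m by apply: mulr_ge0 m0; exact: mulr_ge0 W0.
have E8 : 0 <= 2 * `|E| by rewrite mulr_ge0.
have [e e0 [ed er eW eE]] := small_enough d0 r0 W8 E8.
have ea : `|e| = e by rewrite ger0_norm// ltW.
have := bound e; rewrite (ltW e0) ed => /(_ isT); rewrite -/(u e) -/(u (- e)).
have small : 8 * W * (e * m) <= 1 by rewrite mulrCA.
(* The expansion at [e = 0] has remainder 0, which gives the value of the flow at zero data. *)
have u0 : u 0 = 0.
  have := expand 0; rewrite normr0 mul0r mulr0 expr0n /= !mul0r !subr0 expr0n mulr0.
  by move=> /(_ r0 ler01); rewrite normr_le0 => /eqP.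
have -> : l (Phi 0) = u 0 by rewrite /u scale0r.
have := expand e; have := expand (- e); rewrite normrN ea => /(_ er small) + /(_ er small).
rewrite u0 mulr0 subr0 sqrrN mulNr opprK => hm hp'.
exact: second_order_contradiction e0 eE bB hp' hm.
Qed.
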